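(* Let $\rho:B\twoheadrightarrow\Gamma$ be a Fell bundle over an étale groupoid $\Gamma$. The reduced C*-algebra $\mathcal{C}^\rho_{\mathsf r}=\mathrm{cl}_{\mathsf b}(\mathcal{C}^\rho_{\mathsf c})$ is isomorphic to the classical reduced C*-algebra $$\mathcal{C}^*_{\mathsf r}(\Gamma)=\mathrm{cl}(\{a_{\mathsf B}:a\in\mathcal{C}^\rho_{\mathsf c}\})\subseteq\mathsf{B}(\mathcal{H}^\rho),$$ where the closure is in the operator norm and $a_{\mathsf B}$ is the operator of left convolution $a_{\mathsf B}(b)=ab$ on $\mathcal{H}^\rho$.
   Context: Groupoids. For a groupoid $\Gamma$, $\mathsf{s}(\gamma)=\gamma^{-1}\gamma$, $\mathsf{r}(\gamma)=\gamma\gamma^{-1}$, $\Gamma^0\subseteq\Gamma$ is the set of units, and $\Gamma^2$ is the set of composable pairs ($(\alpha,\beta)\in\Gamma^2$ iff $\mathsf{s}(\alpha)=\mathsf{r}(\beta)$). For $x\in\Gamma^0$, $\Gamma x=\{\gamma:\mathsf{s}(\gamma)=x\}$. An étale groupoid is a groupoid with a topology making product and inverse continuous and such that $\mathsf{s}$ is an open map. No Hausdorff, local compactness or countability assumption is made, even on $\Gamma^0$. A slice is a subset on which $\mathsf{s}$ and $\mathsf{r}$ are injective. A subset $K\subseteq\Gamma$ is biclosed if $\mathsf{s}[K]$ and $\mathsf{r}[K]$ are closed in $\Gamma^0$; it is bicompact if it is a biclosed compact subset of an open slice. Fell bundles. A semigroupoid is a set with a partial binary operation such that $(ab)c$ is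 defined iff $a(bc)$ is, in which case they are equal; a *-semigroupoid also has an involution with $a^{**}=a$ and $(ab)^*=b^*a^*$ whenever $ab$ is defined. A Banach bundle is an open continuous surjection $\rho:B\twoheadrightarrow X$ of topological spaces such that each fibre $B_x=\rho^{-1}\{x\}$ is a complex Banach space (zero $0_x$); for each $\lambda\in\mathbb{C}$, $b\mapsto\lambda b$ is continuous on $B$; addition is continuous on $\{(a,b):\rho(a)=\rho(b)\}$; the norm is upper semicontinuous on $B$; and $\rho(b_\lambda)\to x$, $\|b_\lambda\|\to0$ imply $b_\lambda\to0_x$ for nets. A Fell bundle is a Banach bundle $\rho:B\twoheadrightarrow\Gamma$ such that: (1) $B$ is a *-semigroupoid with continuous product and involution, products are bilinear and $*$ is antilinear; (2) the norm is submultiplicative, $\Gamma$ is an étale groupoid, $ab$ is defined iff $(\rho(a),\rho(b))\in\Gamma^2$, in which case $\rho(ab)=\rho(a)\rho(b)$, and $\rho(a^* )=\rho(a)^{-1}$; (3) for all $b\in B$, $\|b^*b\|=\|b\|^2$ and there is $a\in B_{\rho(b^*b)}$ with $a^*a=b^*b$. Sections. $\mathcal{S}^\rho$ is the vector space (pointwise operations) of all, possibly discontinuous, sections $a:\Gamma\to B$, $\rho\circ a=\mathrm{id}_\Gamma$. Put $\mathrm{supp}(a)=\{\gamma:a(\gamma)\ne0_\gamma\}$ and $a^*(\gamma)=a(\gamma^{-1})^*$. The convolution $ab(\gamma)=\sum_{\gamma=\alpha\beta}a(\alpha)b(\beta)$ is ''defined'' if for every $\gamma\in\Gamma$ the net of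 finite partial sums converges in norm in $B_\gamma$. $\mathcal{F}^\rho$ denotes the finitely supported sections. Define $[0,\infty]$-valued norms by $$\|a\|_2=\sup_{x\in\Gamma^0}\ \sup_{F\subseteq\Gamma x\text{ finite}}\Big\|\sum_{\gamma\in F}a(\gamma)^*a(\gamma)\Big\|^{1/2},\qquad \|a\|_{\mathsf b}=\sup_{f\in\mathcal{F}^\rho}\frac{\|af\|_2}{\|f\|_2}\quad(0/0=0).$$ Let $\mathcal{S}^\rho_{\mathsf b}=\{a:\|a\|_{\mathsf b}<\infty\}$. The big C*-algebra is $\mathcal{B}^\rho=\{a\in\mathcal{S}^\rho_{\mathsf b}:a^*a\text{ and }aa^*\text{ are defined}\}$, with convolution, $*$ and norm $\|\cdot\|_{\mathsf b}$. For $Y\subseteq\Gamma$, $\mathcal{C}^\rho(Y)$ is the set of $a\in\mathcal{S}^\rho$ with $\mathrm{supp}(a)\subseteq Y$ that are, as functions on $\Gamma$, continuous at every point of $Y$. $\mathcal{C}^\rho_{\mathsf c}=\mathrm{span}\{a\in\mathcal{C}^\rho(K):K\subseteq\Gamma\text{ bicompact}\}$, and $\mathcal{C}^\rho_{\mathsf r}=\mathrm{cl}_{\mathsf b}(\mathcal{C}^\rho_{\mathsf c})$ is its $\|\cdot\|_{\mathsf b}$-closure, a C*-subalgebra of $\mathcal{B}^\rho$. Hilbert module. $\mathcal{H}^\rho=\{a\in\mathcal{S}^\rho:\|a\|_2<\infty,\ a^*a\text{ is defined}\}$ is a right Hilbert module over the C*-algebra $\mathcal{D}^\rho$ of sections $d$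 with $\mathrm{supp}(d)\subseteq\Gamma^0$ and $\sup_\gamma\|d(\gamma)\|<\infty$ (pointwise operations on $\Gamma^0$, sup norm), with inner product $\langle a,b\rangle=\Phi(a^*b)$, where $\Phi(c)$ equals $c$ on $\Gamma^0$ and $0_\gamma$ at $\gamma\notin\Gamma^0$. $\mathsf{B}(\mathcal{H}^\rho)$ is the C*-algebra of adjointable operators on $\mathcal{H}^\rho$. *)

(* Defs.v *)
From HB Require Import structures.
From mathcomp Require Import all_boot all_order all_algebra finmap.
From mathcomp Require Import complex.
From mathcomp Require Import all_classical all_reals all_analysis.
From mathcomp Require Import summability.

Set Implicit Arguments.
Unset Strict Implicit.
Unset Printing Implicit Defensive.

Import Order.TTheory GRing.Theory Num.Theory numFieldNormedType.Exports.

Local Open Scope classical_set_scope.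
Local Open Scope ring_scope.

(* The product is a total function whose values outside
   Gamma^2 = {(g, h) | s(g) = r(h)} are irrelevant: no axiom mentions them. *)
Record groupoid := Groupoid {
  gpt :> topologicalType;
  gmul : gpt -> gpt -> gpt;
  ginv : gpt -> gpt;
  gsrc := fun g => gmul (ginv g) g;
  grng := fun g => gmul g (ginv g);
  composable := fun g h => gsrc g = grng h;
  ginvK : involutive ginv;
  composableMl : forall g h k, composable g h -> composable h k ->
    composable (gmul g h) k;
  composableMr : forall g h k, composable g h -> composable h k ->
    composable g (gmul h k);
  gmulA : forall g h k, composable g h -> composable h k ->
    gmul (gmul g h) k = gmul g (gmul h k);
  gmulKl : forall g h, composable g h -> gmul (ginv g) (gmul g h) = h;
  gmulKr : forall g h, composable g h -> gmul (gmul g h) (ginv h) = g }.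

Arguments gsrc {_} _.
Arguments grng {_} _.
Arguments composable {_} _ _.

Definition units (G : groupoid) : set G := range (@gsrc G).
Arguments units : clear implicits.

(* The source map is open as a map from Gamma to Gamma, so that Gamma^0 is
   open in Gamma; openness onto the subspace Gamma^0 would not be enough. *)
Record etaleGroupoid := EtaleGroupoid {
  egpd :> groupoid;
  gmul_continuous :
    {within [set p : egpd * egpd | composable p.1 p.2],
       continuous (fun p => gmul p.1 p.2)};
  ginv_continuous : continuous (@ginv egpd);
  gsrc_open : forall U : set egpd, open U -> open (gsrc @` U) }.

Section Slices.
Variable G : groupoid.

Definition slice (U : set G) : Prop :=
  set_inj U (@gsrc G) /\ set_inj U (@grng G).

Definition closed_in_units (A : set G) : Prop :=
  exists2 C : set G, closed C & A = C `&` units G.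

Definition biclosed (K : set G) : Prop :=
  closed_in_units (gsrc @` K) /\ closed_in_units (grng @` K).

Definition bicompact (K : set G) : Prop :=
  [/\ biclosed K, compact K &
      exists U : set G, [/\ open U, slice U & K `<=` U]].

Definition factorizations (g : G) : set (G * G) :=
  [set p | composable p.1 p.2 /\ gmul p.1 p.2 = g].

End Slices.

Section RealNorm.
Variable R : realType.

(* The library norm on a module over R[i] takes values in R[i]. *)
Definition rnorm (V : normedModType R[i]) (v : V) : R := complex.Re `|v|.

(* supremum in [0, +oo], where the empty set has supremum 0 *)
Definition nnsup (A : set (\bar R)) : \bar R := maxe 0%E (ereal_sup A).

End RealNorm.

(* The fibre over x is a Banach space identified with rho^-1{x} by the
   bijection inc x; in particular rho is onto. *)
Record banachBundle (R : realType) (X : topologicalType) := BanachBundle {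
  totalSpace :> topologicalType;
  rho : totalSpace -> X;
  fibre : X -> completeNormedModType R[i];
  inc : forall x : X, fibre x -> totalSpace;
  rho_inc : forall (x : X) (v : fibre x), rho (inc v) = x;
  inc_inj : forall x : X, injective (@inc x);
  inc_surj : forall b : totalSpace, exists v : fibre (rho b), inc v = b;
  (* [at_fibre x b] is the element b of the fibre over x; it is 0 if
     rho b <> x *)
  at_fibre := fun (x : X) (b : totalSpace) => xget 0 [set v : fibre x | inc v = b];
  coord := fun b : totalSpace => at_fibre (rho b) b;
  rho_continuous : continuous rho;
  rho_open : forall U : set totalSpace, open U -> open (rho @` U);
  scale_continuous : forall l : R[i],
    continuous (fun b : totalSpace => inc (l *: coord b));
  add_continuous :
    {within [set p : totalSpace * totalSpace | rho p.1 = rho p.2],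
       continuous (fun p => inc (coord p.1 + at_fibre (rho p.1) p.2))};
  norm_usc : forall t : R, open [set b : totalSpace | rnorm (coord b) < t];
  cvg_zero : forall (F : set_system totalSpace) (x : X), ProperFilter F ->
    rho @ F --> x -> (fun b => rnorm (coord b)) @ F --> (0 : R) ->
    F --> inc (0 : fibre x) }.

Arguments inc {_ _ _ _} _.
Arguments at_fibre {_ _ _} _ _.
Arguments coord {_ _ _} _.
Arguments rho {_ _ _} _.

(* Products of fibre elements over non-composable pairs are irrelevant.
   Equalities between elements of fibres over points that are only
   propositionally equal are stated in the total space, through inc. *)
Record fellBundle (R : realType) (G : etaleGroupoid) := FellBundle {
  fbundle :> banachBundle R G;
  fmul : forall g h : G,
    fibre fbundle g -> fibre fbundle h -> fibre fbundle (gmul g h);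
  fstar : forall g : G, fibre fbundle g -> fibre fbundle (ginv g);
  fmul_linearl : forall (g h : G) (w : fibre fbundle h),
    composable g h -> linear (fun u : fibre fbundle g => fmul u w);
  fmul_linearr : forall (g h : G) (u : fibre fbundle g),
    composable g h -> linear (fun w : fibre fbundle h => fmul u w);
  fmulA : forall (g h k : G) (u : fibre fbundle g) (v : fibre fbundle h)
      (w : fibre fbundle k), composable g h -> composable h k ->
    inc (fmul (fmul u v) w) = inc (fmul u (fmul v w));
  fstar_antilinear : forall (g : G) (l : R[i]) (u v : fibre fbundle g),
    fstar (l *: u + v) = l^* *: fstar u + fstar v;
  fstarK : forall (g : G) (u : fibre fbundle g),
    inc (fstar (fstar u)) = inc u;
  fstarM : forall (g h : G) (u : fibre fbundle g) (v : fibre fbundle h),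
    composable g h -> inc (fstar (fmul u v)) = inc (fmul (fstar v) (fstar u));
  fmul_continuous :
    {within [set p : fbundle * fbundle | composable (rho p.1) (rho p.2)],
       continuous (fun p => inc (fmul (coord p.1) (coord p.2)))};
  fstar_continuous : continuous (fun b : fbundle => inc (fstar (coord b)));
  fmul_norm : forall (g h : G) (u : fibre fbundle g) (v : fibre fbundle h),
    composable g h -> rnorm (fmul u v) <= rnorm u * rnorm v;
  fstar_norm : forall (g : G) (u : fibre fbundle g),
    rnorm (fmul (fstar u) u) = rnorm u ^+ 2;
  fstar_pos : forall (g : G) (u : fibre fbundle g),
    exists v : fibre fbundle (gsrc g),
      inc (fmul (fstar v) v) = inc (fmul (fstar u) u) }.

Section Sections.
Variables (R : realType) (G : etaleGroupoid) (B : fellBundle R G).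

Definition bsection : Type := forall g : G, fibre B g.

Implicit Types (a b c f : bsection) (g : G).

Definition s_add a b : bsection := fun g => a g + b g.
Definition s_sub a b : bsection := fun g => a g - b g.
Definition s_scale (l : R[i]) a : bsection := fun g => l *: a g.

Definition s_star a : bsection :=
  fun g => at_fibre g (inc (fstar (a (ginv g)))).

Definition supp a : set G := [set g | a g != 0].

Definition convol_term a b g (p : factorizations g) : fibre B g :=
  at_fibre g (inc (fmul (a (val p).1) (b (val p).2))).

(* "ab is defined": at every g the net of finite partial sums, indexed by the
   finite sets of factorizations of g, converges in norm *)
Definition convol_defined a b : Prop :=
  forall g, cvg (partial_sum (@convol_term a b g) @ totally).

Definition convol a b : bsection := fun g => summability.sum (@convol_term a b g).

Definition finsupp_section f : Prop := finite_set (supp f).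

Definition norm2 a : \bar R :=
  nnsup [set y | exists x : G, exists F : {fset G},
    [/\ units G x, (forall g, g \in F -> gsrc g = x) &
        y = (Num.sqrt (rnorm (\sum_(g <- F)
               at_fibre x (inc (fmul (fstar (a g)) (a g))))))%:E]].

(* Only 0/0 can occur as a fraction with zero denominator, and the library
   convention 0 * +oo = 0 makes it 0. *)
Definition normb a : \bar R :=
  nnsup [set (norm2 (convol a f) * (norm2 f)^-1)%E | f in finsupp_section].

Definition cont_sections (Y : set G) : set bsection :=
  [set a | supp a `<=` Y /\
    forall g, Y g -> {for g, continuous (fun h : G => inc (a h))}].

Definition Cc : set bsection :=
  [set a | exists n : nat, exists l : 'I_n -> R[i],
    exists s : 'I_n -> bsection,
      (forall i, exists2 K : set G, bicompact K & cont_sections K (s i)) /\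
      (forall g, a g = \sum_(i < n) l i *: s i g)].

Definition Cr : set bsection :=
  [set a | forall e : R, 0 < e ->
    exists2 c, Cc c & (normb (s_sub a c) < e%:E)%E].

Definition Hilb : set bsection :=
  [set a | (norm2 a < +oo)%E /\ convol_defined (s_star a) a].

Definition restr_units c : bsection :=
  fun g => if `[< units G g >] then c g else 0.

Definition inner a b : bsection := restr_units (convol (s_star a) b).

Definition normD (d : bsection) : \bar R :=
  nnsup (range (fun g => (rnorm (d g))%:E)).

Definition normH a : \bar R := sqrte (normD (inner a a)).

(* Operators on the Hilbert module are represented by functions on all
   sections; only their values on Hilb matter, and they are compared by
   op_eq. *)
Definition operator : Type := bsection -> bsection.

Implicit Types S T : operator.

Definition op_eq S T : Prop := forall b, Hilb b -> S b = T b.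

Definition op_add S T : operator := fun b => s_add (S b) (T b).
Definition op_sub S T : operator := fun b => s_sub (S b) (T b).
Definition op_scale (l : R[i]) T : operator := fun b => s_scale l (T b).

Definition is_adjoint T S : Prop :=
  [/\ (forall a, Hilb a -> Hilb (T a)), (forall a, Hilb a -> Hilb (S a)) &
      forall a b, Hilb a -> Hilb b -> inner (T a) b = inner a (S b)].

Definition adjointable : set operator := [set T | exists S, is_adjoint T S].

Definition normop T : \bar R :=
  nnsup [set normH (T b) | b in [set b | Hilb b /\ (normH b <= 1)%E]].

Definition classical_Cr : set operator :=
  [set T | adjointable T /\
    forall e : R, 0 < e ->
      exists2 c, Cc c & (normop (op_sub T (convol c)) < e%:E)%E].

(* Isomorphisms of C*-algebras from Cr, with convolution, involution and
   norm normb, onto classical_Cr.  The clauses for the operations also state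
   that Cr is closed under them, and in particular that the convolution
   products are defined. *)
Record cstar_isomorphism (phi : bsection -> operator) : Prop := {
  iso_mem : forall a, Cr a -> classical_Cr (phi a);
  iso_inj : forall a b, Cr a -> Cr b -> op_eq (phi a) (phi b) -> a = b;
  iso_surj : forall T, classical_Cr T -> exists2 a, Cr a & op_eq (phi a) T;
  iso_add : forall a b, Cr a -> Cr b ->
    Cr (s_add a b) /\ op_eq (phi (s_add a b)) (op_add (phi a) (phi b));
  iso_scale : forall l a, Cr a ->
    Cr (s_scale l a) /\ op_eq (phi (s_scale l a)) (op_scale l (phi a));
  iso_mul : forall a b, Cr a -> Cr b ->
    [/\ convol_defined a b, Cr (convol a b) &
        op_eq (phi (convol a b)) (phi a \o phi b)];
  iso_star : forall a, Cr a ->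
    Cr (s_star a) /\ is_adjoint (phi a) (phi (s_star a));
  iso_norm : forall a, Cr a -> normop (phi a) = normb a }.

End Sections.

Arguments Cc {R G} B.
Arguments Hilb {R G} B.

(* Main.v *)
Require Import Defs.
From mathcomp Require Import all_boot all_order all_algebra finmap complex.
From mathcomp Require Import all_classical all_reals all_analysis summability.
From mathcomp Require Import ring lra.

(* The isomorphism is [a |-> (b |-> a b)]. Everything is decided fibrewise over a
   unit [x]: on [Gamma x] a section of the Hilbert module is a norm limit of
   finitely supported ones, and for these the supremum defining [normb] bounds
   [||a f||] by [||a|| ||f||]. Convergence of [a b] is a Cauchy argument: a
   section in [Cc] meets each range fibre in finitely many points, so a tail of
   the sum for [a b] is a tail for [a - c] with [c] in [Cc] close to [a].

   The C*-theory that is needed reduces to one fact: omitting terms from a finite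
   sum of elements [u^* u] does not increase its norm. It rests on the positivity
   of [u^* u], proved for adjointable operators on a Banach space with a
   [u^* v]-like pairing. It gives the Cauchy-Schwarz inequality: for
   [w = sum_i u_i^* v_i] and real [t], the sum of the squares of [v_i - t u_i w]
   is positive, so that
     [2 t |w|^2 <= |sum_i v_i^* v_i| + t^2 |w|^2 |sum_i u_i^* u_i|]. *)

Set Implicit Arguments.
Unset Strict Implicit.
Unset Printing Implicit Defensive.

Import Order.TTheory GRing.Theory Num.Theory numFieldNormedType.Exports.

Local Open Scope classical_set_scope.
Local Open Scope ring_scope.

(** * Positive operators *)

(** Positivity is read off left multiplication on fibres: the condition |t - h| <= t takes the place
    of the spectrum, and square roots are limits of an explicit iteration. That a root commutes with
    every adjointable operator commuting with the original one is all the functional calculus that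
    is used. The axiom [fstar_pos] brings u^* u, for u in any B_g, back to v^* v with v in the
    C*-algebra over a unit.

    Two absences shape the proof. The fibres need have no unit, so |a|_2 <= |a|_b requires a test
    section built from a itself. The unit space need not be Hausdorff, so compactness does not yield
    closedness: products of bicompact sets are treated by lifting along open slices, with the
    closedness of s[K] and r[K] as data.

    Norms in [0, +oo] are handled through their real upper bounds, one source fibre at a time
    ([l2_le], [op_le]), which turns comparisons into inequalities between finite sums. Surjectivity
    is a matter of completeness: approximants of T in operator norm are Cauchy for |.|_b, they
    converge at each point, and the limit section convolves as T does. *)

Section RealNorm.
Variables (R : realType) (V : normedModType R[i]).
Implicit Types u v : V.

Lemma normE v : `|v| = real_complex R (rnorm v).
Proof. by rewrite /rnorm RRe_real // ger0_real. Qed.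

Lemma rnorm_ge0 v : 0 <= rnorm v.
Proof. by rewrite -ler0c -normE. Qed.

Lemma rnorm0 : rnorm (0 : V) = 0.
Proof. by rewrite /rnorm normr0. Qed.

Lemma rnorm_eq0 v : (rnorm v == 0) = (v == 0).
Proof. by rewrite -(normr_eq0 v) normE fmorph_eq0. Qed.

Lemma rnormN v : rnorm (- v) = rnorm v.
Proof. by rewrite /rnorm normrN. Qed.

Lemma rnormD u v : rnorm (u + v) <= rnorm u + rnorm v.
Proof. by rewrite -lecR rmorphD /= -!normE ler_normD. Qed.

Lemma rnormB u v : rnorm (u - v) <= rnorm u + rnorm v.
Proof. by rewrite -(rnormN v) rnormD. Qed.

Lemma rdistC u v : rnorm (u - v) = rnorm (v - u).
Proof. by rewrite -rnormN opprB. Qed.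

Lemma rnormZ l v : rnorm (l *: v) = complex.Re `|l| * rnorm v.
Proof.
by apply: complexI; rewrite rmorphM /= -!normE normrZ.
Qed.

Lemma rnormZr (t : R) v : rnorm (t%:C%C *: v) = `|t| * rnorm v.
Proof. by rewrite rnormZ normc_def /= expr0n addr0 sqrtr_sqr. Qed.

Lemma ler_rnorm_sum (I : Type) (r : seq I) (P : pred I) (F : I -> V) :
  rnorm (\sum_(i <- r | P i) F i) <= \sum_(i <- r | P i) rnorm (F i).
Proof.
elim/big_ind2: _ => [|x1 x2 y1 y2 h1 h2|//]; first by rewrite rnorm0.
by rewrite (le_trans (rnormD _ _)) // lerD.
Qed.

Lemma rnorm_small v : (forall e : R, 0 < e -> rnorm v <= e) -> v = 0.
Proof.
move=> h; apply/eqP; rewrite -rnorm_eq0 eq_le rnorm_ge0 andbT.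
by apply/ler_addgt0Pr => e /h; rewrite add0r.
Qed.

(** Balls of [V] have radii in [R[i]]; a positive radius there is real, so real radii define the
    same neighbourhoods. *)
Lemma nbhs_rnormP (l : V) (A : set V) :
  nbhs l A <-> exists2 e : R, 0 < e & [set v | rnorm (l - v) < e] `<=` A.
Proof.
split.
  move=> /nbhs_ballP[e /= e0 lA].
  have er : e = (complex.Re e)%:C%C by rewrite RRe_real // gtr0_real.
  exists (complex.Re e); first by rewrite -ltcR -er.
  move=> v /= lv; apply: lA; rewrite -ball_normE /ball_ /= normE er.
  by rewrite ltcR.
move=> [e e0 lA]; apply/nbhs_ballP; exists e%:C%C => /=; first by rewrite ltcR.
move=> v; rewrite -ball_normE /ball_ /= normE ltcR => lv.
exact: lA.
Qed.

Lemma cvg_rnormP (F : set_system V) (FF : Filter F) (l : V) :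
  F --> l <-> forall e : R, 0 < e -> F [set v | rnorm (l - v) < e].
Proof.
split=> [Fl e e0|h A /nbhs_rnormP[e e0]].
  by apply: Fl; apply/nbhs_rnormP; exists e.
by move/filterS; apply; apply: h.
Qed.

End RealNorm.

Lemma rnorm_cauchy (R : realType) (V : completeNormedModType R[i])
    (F : set_system V) (FF : ProperFilter F) :
  (forall e : R, 0 < e -> exists v, F [set w | rnorm (v - w) < e]) -> cvg F.
Proof.
move=> h; apply: cauchy_cvg; apply: cauchy_exP => e e0.
have er : e = (complex.Re e)%:C%C by rewrite RRe_real // gtr0_real.
have [|v hv] := h (complex.Re e); first by rewrite -ltcR -er.
exists v; apply: filterS hv => w /= vw.
by rewrite -ball_normE /ball_ /= normE er ltcR.
Qed.

Lemma conj_real (R : realType) (t : R) : (t%:C%C : R[i])^* = t%:C%C.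
Proof. by apply: CrealP; rewrite complex_real. Qed.

Lemma conjN1 (R : realType) : ((-1) : R[i])^* = -1.
Proof. by apply: CrealP; rewrite rpredN rpred1. Qed.

(** The form in which approximation arguments end: an error proportional to [e]. The factor [c] may
    vanish, hence the division by [c + 1]. *)
Lemma rnorm_small_mul (R : realType) (V : normedModType R[i]) (v : V) (c : R) :
  0 <= c -> (forall e : R, 0 < e -> rnorm v <= e * c) -> v = 0.
Proof.
move=> c0 h; apply: rnorm_small => e e0.
have c1 : 0 < c + 1 by rewrite ltr_wpDl.
apply: le_trans (h (e / (c + 1)) _) _; first by rewrite divr_gt0.
by rewrite mulrAC ler_pdivrMr // ler_pM2l // lerDl.
Qed.

(** A stand-in for an inner-product module. Neither a product nor an order on [D] is used, and the
    Cauchy-Schwarz inequality is a field. The intended instance is u^* v on a fibre B_g, with values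
    in the fibre over the source of g. *)
Record pairing (R : realType) (E D : normedModType R[i]) := Pairing {
  pair_fun :> E -> E -> D;
  pair_linearr : forall a, linear (pair_fun a);
  pair_linearl : forall l a b c,
    pair_fun (l *: a + b) c = l^* *: pair_fun a c + pair_fun b c;
  pair_norm : forall a b, rnorm (pair_fun a b) <= rnorm a * rnorm b;
  pair_diag : forall a, rnorm (pair_fun a a) = rnorm a ^+ 2 }.

(** * Adjointable operators for a pairing *)

Section Pairing.
Variables (R : realType) (E D : normedModType R[i]) (p : pairing E D).
Implicit Types (a b : E) (T S : E -> E).

Lemma pairDr a b c : p a (b + c) = p a b + p a c.
Proof. by have := pair_linearr p a 1 b c; rewrite !scale1r. Qed.

Lemma pair0r a : p a 0 = 0.
Proof. by apply: (addIr (p a 0)); rewrite -pairDr !add0r. Qed.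

Lemma pairZr a l b : p a (l *: b) = l *: p a b.
Proof. by have := pair_linearr p a l b 0; rewrite !addr0 pair0r addr0. Qed.

Lemma pairNr a b : p a (- b) = - p a b.
Proof. by rewrite -scaleN1r pairZr scaleN1r. Qed.

Lemma pairBr a b c : p a (b - c) = p a b - p a c.
Proof. by rewrite pairDr pairNr. Qed.

Lemma pairDl a b c : p (a + b) c = p a c + p b c.
Proof. by have := pair_linearl p 1 a b c;
  rewrite !scale1r (conjC1 R[i]) scale1r. Qed.

Lemma pair0l a : p 0 a = 0.
Proof. by apply: (addIr (p 0 a)); rewrite -pairDl !add0r. Qed.

Lemma pairZl l a b : p (l *: a) b = l^* *: p a b.
Proof. by have := pair_linearl p l a 0 b; rewrite !addr0 pair0l addr0. Qed.

Lemma pairNl a b : p (- a) b = - p a b.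
Proof. by rewrite -scaleN1r pairZl conjN1 scaleN1r. Qed.

Lemma pairBl a b c : p (a - b) c = p a c - p b c.
Proof. by rewrite pairDl pairNl. Qed.

Lemma pair_eq0 a : (forall b, p a b = 0) -> a = 0.
Proof.
move=> h; apply/eqP; rewrite -rnorm_eq0 -sqrf_eq0 -(pair_diag p) h.
by rewrite rnorm0.
Qed.

Definition bnd T (c : R) := forall b, rnorm (T b) <= c * rnorm b.

(** The second identity is stated separately, [D] having no involution that would exchange the two
    arguments. *)
Definition adj T S := [/\ forall a b, p (T a) b = p a (S b),
  forall a b, p (S a) b = p a (T b) & exists2 c, 0 <= c & bnd T c].

(** |S b|^2 = |p (S b) (S b)| = |p b (T (S b))| <= |b| c |S b|. *)
Lemma adj_bnd_sym T S c : adj T S -> bnd T c -> bnd S c.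
Proof.
move=> [_ ST _] Tc b.
have [->|Sb] := eqVneq (S b) 0.
  by rewrite rnorm0 (le_trans _ (Tc b)) ?rnorm_ge0.
have Sb0 : 0 < rnorm (S b) by rewrite lt_def rnorm_eq0 Sb rnorm_ge0.
rewrite -(ler_pM2r Sb0) -expr2 -(pair_diag p) ST.
apply: (le_trans (pair_norm _ _ _)).
by rewrite mulrAC [leRHS]mulrC ler_wpM2l ?rnorm_ge0.
Qed.

Lemma adj_sym T S : adj T S -> adj S T.
Proof.
move=> TS; have [h1 h2 [c c0 Tc]] := TS.
by split=> //; exists c => //; exact: adj_bnd_sym Tc.
Qed.

(** Linearity comes for free with an adjoint: both sides have the same pairing with every vector,
    and the pairing is nondegenerate. *)
Lemma adj_linear T S l a b : adj T S -> T (l *: a + b) = l *: T a + T b.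
Proof.
move=> [TS _ _]; apply/eqP; rewrite -subr_eq0; apply/eqP/pair_eq0 => c.
by rewrite pairBl TS !pair_linearl !TS subrr.
Qed.

Lemma adj_addE T S a b : adj T S -> T (a + b) = T a + T b.
Proof. by move=> /(adj_linear 1 a b); rewrite !scale1r. Qed.

Lemma adj_scaleE T S l a : adj T S -> T (l *: a) = l *: T a.
Proof.
move=> TS; have T0 : T 0 = 0 by apply: (addIr (T 0));
  rewrite -(adj_addE _ _ TS) !add0r.
by have := adj_linear l a 0 TS; rewrite T0 !addr0.
Qed.

Lemma adj_oppE T S a : adj T S -> T (- a) = - T a.
Proof. by move=> TS; rewrite -scaleN1r (adj_scaleE _ _ TS) scaleN1r. Qed.

Lemma adj_subE T S a b : adj T S -> T (a - b) = T a - T b.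
Proof. by move=> TS; rewrite (adj_addE _ _ TS) (adj_oppE _ TS). Qed.

Lemma adj_id : adj id id.
Proof. by split=> //; exists 1 => // b; rewrite mul1r. Qed.

Lemma adj_add T S T1 S1 : adj T S -> adj T1 S1 ->
  adj (fun b => T b + T1 b) (fun b => S b + S1 b).
Proof.
move=> [TS ST [c c0 Tc]] [TS1 ST1 [d d0 Td]]; split.
- by move=> a b; rewrite pairDl pairDr TS TS1.
- by move=> a b; rewrite pairDl pairDr ST ST1.
- exists (c + d) => [|b]; first exact: addr_ge0.
  by rewrite (le_trans (rnormD _ _)) // mulrDl lerD.
Qed.

Lemma adj_scale l T S : adj T S ->
  adj (fun b => l *: T b) (fun b => l^* *: S b).
Proof.
move=> [TS ST [c c0 Tc]]; split.
- by move=> a b; rewrite pairZl pairZr TS.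
- by move=> a b; rewrite pairZl pairZr ST conjCK.
- exists (complex.Re `|l| * c) => [|b].
    by rewrite mulr_ge0 // -ler0c RRe_real // ger0_real.
  by rewrite rnormZ -mulrA ler_wpM2l // -ler0c RRe_real // ger0_real.
Qed.

Lemma adj_opp T S : adj T S -> adj (fun b => - T b) (fun b => - S b).
Proof.
move=> /(adj_scale (-1)).
rewrite conjN1; under eq_fun do rewrite scaleN1r.
by under [X in adj _ X -> _]eq_fun do rewrite scaleN1r.
Qed.

Lemma adj_sub T S T1 S1 : adj T S -> adj T1 S1 ->
  adj (fun b => T b - T1 b) (fun b => S b - S1 b).
Proof. by move=> TS TS1; apply: adj_add => //; exact: adj_opp. Qed.

Lemma adj_comp T S T1 S1 : adj T S -> adj T1 S1 ->
  adj (fun b => T (T1 b)) (fun b => S1 (S b)).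
Proof.
move=> [TS ST [c c0 Tc]] [TS1 ST1 [d d0 Td]]; split.
- by move=> a b; rewrite TS TS1.
- by move=> a b; rewrite ST1 ST.
- exists (c * d) => [|b]; first exact: mulr_ge0.
  by rewrite (le_trans (Tc _)) // -mulrA ler_wpM2l.
Qed.

(** Half of the C*-identity for operators: |T b|^2 = |p b (S (T b))| <= c^2 |b|^2. *)
Lemma adj_bnd T S c : 0 <= c -> adj T S ->
  bnd (fun b => S (T b)) (c ^+ 2) -> bnd T c.
Proof.
move=> c0 [TS _ _] h b.
rewrite -(ler_pXn2r (n:=2)) ?nnegrE ?mulr_ge0 ?rnorm_ge0 //.
rewrite -(pair_diag p) TS (le_trans (pair_norm _ _ _)) //.
by rewrite exprMn [X in _ <= _ * X]expr2 mulrCA ler_wpM2l ?rnorm_ge0 //;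
  exact: h.
Qed.

End Pairing.

(** * Square roots of 1 - y for a self-adjoint contraction y *)

Section SquareRoot.
Variables (R : realType) (E : completeNormedModType R[i]).
Variables (D : normedModType R[i]) (p : pairing E D).
Implicit Types (a b : E) (T S : E -> E).

Let half : R[i] := (2^-1 : R)%:C%C.

Let halfJ : half^* = half. Proof. exact: conj_real. Qed.

Let half2 b : half *: b + half *: b = b.
Proof.
rewrite -scalerDl -rmorphD /= (_ : 2^-1 + 2^-1 = 1 :> R) ?rmorph1 ?scale1r //.
by lra.
Qed.

Let rnorm_half b : rnorm (half *: b) = 2^-1 * rnorm b.
Proof. by rewrite rnormZr ger0_norm // invr_ge0. Qed.

Fixpoint sqrt_iter (y : E -> E) (n : nat) (b : E) : E :=
  if n is m.+1 then half *: (y b + sqrt_iter y m (sqrt_iter y m b)) else 0.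

Fixpoint sqrt_bound (n : nat) : R :=
  if n is m.+1 then 2^-1 * (1 + sqrt_bound m * sqrt_bound m) else 0.

Let z := sqrt_bound.

Lemma sqrt_bound_ge0 n : 0 <= z n.
Proof.
by elim: n => //= n IH; rewrite mulr_ge0 ?invr_ge0 // addr_ge0 // mulr_ge0.
Qed.

Lemma sqrt_bound_le1 n : z n <= 1.
Proof.
elim: n => [|n IH] /=; first exact: ler01.
have := sqrt_bound_ge0 n; rewrite -/z => z0; nra.
Qed.

Lemma sqrt_boundS n : z n <= z n.+1.
Proof.
elim: n => [|n IH]; first exact: sqrt_bound_ge0.
by rewrite /= ler_wpM2l ?invr_ge0 // lerD2l ler_pM ?sqrt_bound_ge0.
Qed.

Lemma sqrt_bound_lim : exists L, (forall n, z n <= L) /\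
  forall e, 0 < e -> exists n, L - z n < e.
Proof.
have zub : has_sup (range z).
  split; first by exists (z 0%N), 0%N.
  by exists 1 => _ [n _ <-]; exact: sqrt_bound_le1.
exists (sup (range z)); split=> [n|e e0].
  by apply: ub_le_sup; [case: zub|exists n].
have [_ [n _ <-] h] := sup_adherent e0 zub.
by exists n; rewrite ltrBlDr -ltrBlDl.
Qed.

Section Iteration.
Variable y : E -> E.
Hypotheses (ysa : adj p y y) (y1 : bnd y 1).

Let Z := sqrt_iter y.

Lemma sqrt_iter_adj n : adj p (Z n) (Z n).
Proof.
elim: n => [|n IH].
  split=> [a b|a b|]; rewrite ?pair0l ?pair0r //.
  by exists 0 => // b; rewrite rnorm0 mul0r.
have := adj_scale half (adj_add ysa (adj_comp IH IH)).
by rewrite halfJ.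
Qed.

Lemma sqrt_iter_comm T S n : adj p T S -> (forall b, T (y b) = y (T b)) ->
  forall b, T (Z n b) = Z n (T b).
Proof.
move=> TS Ty; elim: n => [|n IH] b /=.
  by apply: (addIr (T 0)); rewrite -(adj_addE _ _ TS) !add0r.
by rewrite (adj_scaleE _ _ TS) (adj_addE _ _ TS) Ty !IH.
Qed.

Lemma sqrt_iter_bnd n : bnd (Z n) (z n).
Proof.
elim: n => [|n IH] b /=; first by rewrite rnorm0 mul0r.
rewrite rnorm_half -mulrA ler_wpM2l ?invr_ge0 //.
apply: (le_trans (rnormD _ _)); rewrite mulrDl lerD //.
by rewrite (le_trans (IH _)) // -mulrA ler_wpM2l ?sqrt_bound_ge0.
Qed.

Lemma sqrt_iter_step n : bnd (fun b => Z n.+1 b - Z n b) (z n.+1 - z n).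
Proof.
elim: n => [|n IH] b.
  have := sqrt_iter_bnd 1 b.
  by rewrite (_ : Z 0 b = 0) // (_ : z 0 = 0) // !subr0.
(* The factorization P^2 - Q^2 = P (P - Q) + (P - Q) Q respects the order of the factors, so no
   commutation is involved; the scalar iteration obeys the same identity. *)
have -> : Z n.+2 b - Z n.+1 b = half *: (Z n.+1 (Z n.+1 b - Z n b) +
    (Z n.+1 (Z n b) - Z n (Z n b))).
  rewrite (adj_subE _ _ (sqrt_iter_adj _)) addrA subrK.
  by rewrite [Z n.+2 b]/= [in LHS]/Z [X in _ - X]/= -scalerBr opprD addrACA
    subrr add0r.
have -> : z n.+2 - z n.+1 = 2^-1 * (z n.+1 * (z n.+1 - z n) +
   (z n.+1 - z n) * z n) by rewrite /z /=; ring.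
rewrite rnorm_half -mulrA ler_wpM2l ?invr_ge0 //.
apply: (le_trans (rnormD _ _)); rewrite mulrDl lerD //.
  rewrite (le_trans (sqrt_iter_bnd _ _)) // -mulrA ler_wpM2l ?sqrt_bound_ge0 //.
rewrite (le_trans (IH _)) // -mulrA ler_wpM2l ?subr_ge0 ?sqrt_boundS //.
exact: sqrt_iter_bnd.
Qed.

Lemma sqrt_iter_dist m n : bnd (fun b =>
  Z (m + n)%N b - Z m b) (z (m + n)%N - z m).
Proof.
elim: n => [|n IH] b; first by rewrite addn0 !subrr rnorm0 mul0r.
rewrite addnS -(subrKA (Z (m + n) b)) (le_trans (rnormD _ _)) //.
have -> : z (m + n).+1 - z m =
  (z (m + n).+1 - z (m + n)%N) + (z (m + n)%N - z m) by ring.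
by rewrite mulrDl lerD // sqrt_iter_step.
Qed.

(** The bound [L - z n] does not depend on the vector, so the pointwise limit is a limit in operator
    norm. The estimate for [n.+1] is recorded with the one for [n] because the fixed point equation
    compares [x] with Z_{n+1} = (y + Z_n^2) / 2. *)
Lemma sqrt_iter_lim : exists x : E -> E,
  forall e, 0 < e -> exists n, bnd (fun b => x b - Z n b) e /\
                               bnd (fun b => x b - Z n.+1 b) e.
Proof.
have [L [zL Lz]] := sqrt_bound_lim.
have dist m n b : (m <= n)%N -> rnorm (Z n b - Z m b) <= (L - z m) * rnorm b.
  move=> /subnKC <-; rewrite (le_trans (sqrt_iter_dist _ _ _)) //.
  by rewrite ler_wpM2r ?rnorm_ge0 // lerD2r.
have Zc b : cvg (Z n b @[n --> \oo]).
  apply: rnorm_cauchy => e e0.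
  have b1 : 0 < rnorm b + 1 by rewrite ltr_wpDl ?rnorm_ge0.
  have [m Lm] := Lz (e / (rnorm b + 1)) (divr_gt0 e0 b1).
  exists (Z m b); exists m => // n /= mn; rewrite rdistC.
  apply: (le_lt_trans (dist _ _ _ mn)).
  move: Lm; rewrite ltr_pdivlMr // => /(le_lt_trans _); apply.
  by rewrite ler_wpM2l ?subr_ge0 // lerDl.
exists (fun b => lim (Z n b @[n --> \oo])).
have lims m b : rnorm (lim (Z n b @[n --> \oo]) - Z m b) <= (L - z m) * rnorm b.
  apply/ler_addgt0Pr => e e0.
  have /cvg_rnormP/(_ e e0) [n _ hn] := Zc b.
  have /hn /= h1 := leq_maxl n m; have h2 := dist _ _ b (leq_maxr n m).
  rewrite -(subrKA (Z (maxn n m) b)) (le_trans (rnormD _ _)) // addrC lerD //.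
  exact: ltW.
move=> e e0; have [n Ln] := Lz e e0; exists n; split=> b.
  by rewrite (le_trans (lims _ _)) // ler_wpM2r ?rnorm_ge0 // ltW.
rewrite (le_trans (lims _ _)) // ler_wpM2r ?rnorm_ge0 // ltW //.
by apply: le_lt_trans Ln; rewrite lerD2l lerN2 sqrt_boundS.
Qed.

(* With [y = 1 - k^2] and [x = 1 - k], the equation [k^2 = 1 - y] is the fixed
   point equation [x = (y + x^2) / 2]. The iterates from 0 are polynomials in
   [y] with nonnegative coefficients, so their differences are dominated by
   those of the scalar iteration for [y = 1]. *)
Lemma sqrt_exists : exists k : E -> E, [/\ adj p k k,
  forall b, k (k b) = b - y b, bnd (fun b => b - k b) 1 &
  forall T S, adj p T S -> (forall b, T (y b) = y (T b)) ->
    forall b, T (k b) = k (T b)].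
Proof.
have [x xZ] := sqrt_iter_lim.
have x1 : bnd x 1.
  move=> b; apply/ler_addgt0Pr => e e0.
  have b1 : 0 < rnorm b + 1 by rewrite ltr_wpDl ?rnorm_ge0.
  have [n [xn _]] := xZ _ (divr_gt0 e0 b1).
  rewrite -[x b](subrK (Z n b)) (le_trans (rnormD _ _)) // addrC lerD //.
    rewrite (le_trans (sqrt_iter_bnd _ _)) // ler_wpM2r ?rnorm_ge0 //.
    exact: sqrt_bound_le1.
  by rewrite (le_trans (xn _)) // mulrAC ler_pdivrMr // ler_pM2l // lerDl.
have xpair a b : p (x a) b = p a (x b).
  apply/eqP; rewrite -subr_eq0; apply/eqP.
  apply: (@rnorm_small_mul _ _ _ (rnorm a * rnorm b + rnorm a * rnorm b)).
    by rewrite addr_ge0 // mulr_ge0 ?rnorm_ge0.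
  move=> e e0; have [n [xn _]] := xZ e e0.
  have [Zn _ _] := sqrt_iter_adj n.
  have -> : p (x a) b - p a (x b) = p (x a - Z n a) b - p a (x b - Z n b).
    by rewrite pairBl pairBr Zn opprB addrC addrA subrK addrC.
  rewrite (le_trans (rnormB _ _)) // mulrDr lerD //.
    by rewrite (le_trans (pair_norm _ _ _)) // mulrA ler_wpM2r ?rnorm_ge0 //.
  by rewrite (le_trans (pair_norm _ _ _)) // mulrCA ler_wpM2l ?rnorm_ge0 //.
have xsa : adj p x x by split=> //; exists 1.
have xx b : x b = half *: (y b + x (x b)).
  apply/eqP; rewrite -subr_eq0; apply/eqP.
  apply: (@rnorm_small_mul _ _ _ (rnorm b + 2^-1 * (rnorm b + rnorm b))).
    by rewrite addr_ge0 ?mulr_ge0 ?addr_ge0 ?invr_ge0 ?rnorm_ge0.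
  move=> e e0; have [n [xn xn1]] := xZ e e0.
  have -> : x b - half *: (y b + x (x b)) = (x b - Z n.+1 b) -
      half *: (x (x b - Z n b) + (x (Z n b) - Z n (Z n b))).
    rewrite (adj_subE _ _ xsa) addrA subrK [Z n.+1 b]/=.
    rewrite -addrA; congr (_ + _); rewrite -opprD -scalerDr addrACA.
    by rewrite subrr addr0.
  rewrite (le_trans (rnormB _ _)) // mulrDr lerD //.
  rewrite rnorm_half mulrCA ler_wpM2l ?invr_ge0 // mulrDr.
  rewrite (le_trans (rnormD _ _)) // lerD //.
    by rewrite (le_trans (x1 _)) // mul1r; exact: xn.
  rewrite (le_trans (xn _)) // ler_wpM2l // ?(ltW e0) //.
  rewrite (le_trans (sqrt_iter_bnd _ _)) // ler_piMl ?rnorm_ge0 //.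
  exact: sqrt_bound_le1.
have ksa := adj_sub (adj_id p) xsa.
exists (fun b => b - x b); split=> //.
- move=> b; have x2 : x b + x b = y b + x (x b).
    by rewrite [in LHS]xx half2.
  have -> : y b = x b + x b - x (x b) by rewrite x2 addrK.
  by rewrite (adj_subE _ _ xsa) -addrA -opprD addrA.
- by move=> b; rewrite opprB addrC subrK; exact: x1.
- move=> T S TS Ty b; rewrite (adj_subE _ _ TS); congr (_ - _).
  have [_ _ [c c0 Tc]] := TS.
  apply/eqP; rewrite -subr_eq0; apply/eqP.
  apply: (@rnorm_small_mul _ _ _ (c * rnorm b + c * rnorm b)).
    by rewrite addr_ge0 // mulr_ge0 ?rnorm_ge0.
  move=> e e0; have [n [xn _]] := xZ e e0.
  have -> : T (x b) - x (T b) = T (x b - Z n b) - (x (T b) - Z n (T b)).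
    by rewrite (adj_subE _ _ TS) (sqrt_iter_comm _ TS Ty) opprB addrA subrK.
  rewrite (le_trans (rnormB _ _)) // mulrDr lerD //.
    by rewrite (le_trans (Tc _)) // mulrCA ler_wpM2l.
  by rewrite (le_trans (xn _)) // ler_wpM2l // (ltW e0).
Qed.

End Iteration.
End SquareRoot.

(** * Positivity of T^* T *)

Section Positivity.
Variables (R : realType) (E : completeNormedModType R[i]).
Variables (D : normedModType R[i]) (p : pairing E D).
Implicit Types (a b : E) (T S h k l : E -> E) (t c : R).

Lemma adj_scale_real t T S : adj p T S ->
  adj p (fun b => t%:C%C *: T b) (fun b => t%:C%C *: S b).
Proof. by move=> /(adj_scale t%:C%C); rewrite conj_real. Qed.

Lemma rnorm_double b : rnorm (b + b) = rnorm b + rnorm b.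
Proof.
have -> : b + b = (2 : R)%:C%C *: b.
  by rewrite -mulr2n -scaler_nat rmorph_nat.
by rewrite rnormZr ger0_norm // mulrDl mul1r.
Qed.

Lemma scale_ii b : 'i *: ('i *: b) = - b.
Proof. by rewrite scalerA -expr2 sqrCi scaleN1r. Qed.

(* The operator [u = k + i l] satisfies [u^* u = k^2 + l^2], and [2 k] is
   [u + u^*]. *)
Lemma bnd_sum_squares k l c : 0 <= c -> adj p k k -> adj p l l ->
  (forall b, k (l b) = l (k b)) ->
  bnd (fun b => k (k b) + l (l b)) (c ^+ 2) -> bnd k c.
Proof.
move=> c0 kk ll kl klc.
have := adj_add kk (adj_scale 'i ll); rewrite conjCi.
set u := fun b => _ + _; set v := fun b => _ + _ => uv.
have uc : bnd u c.
  apply: (adj_bnd c0 uv) => b; rewrite /v (adj_addE _ _ kk) (adj_addE _ _ ll).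
  rewrite (adj_scaleE _ _ kk) (adj_scaleE _ _ ll) scalerDr !scaleNr scale_ii.
  rewrite opprK kl addrA addrK; exact: klc.
have vc := adj_bnd_sym uv uc.
move=> b; have := rnorm_double (k b).
have -> : k b + k b = u b + v b by rewrite /u /v addrACA scaleNr subrr addr0.
by have := rnormD (u b) (v b); have := uc b; have := vc b; lra.
Qed.

(** Let k be the root of 1 - h^2. From k^2 + h^2 = 1 one gets |k| <= 1, whence |1 - h^2| = |k^2| <=
    1. *)
Lemma bnd_1_sub_square h : adj p h h -> bnd h 1 ->
  bnd (fun b => b - h (h b)) 1.
Proof.
move=> hh h1.
have hh1 : bnd (fun b => h (h b)) 1.
  by move=> b; rewrite (le_trans (h1 _)) // mul1r.
have [k [kk k2 _ kc]] := sqrt_exists (adj_comp hh hh) hh1.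
have k1 : bnd k 1.
  apply: (bnd_sum_squares (l := h)) => //.
    by move=> b; rewrite (kc _ _ hh).
  by move=> b; rewrite k2 subrK expr1n mul1r.
by move=> b; rewrite -k2 (le_trans (k1 _)) // mul1r.
Qed.

(* For [t >= |h|], the condition [|t - h| <= t] says that the spectrum of the
   self-adjoint operator [h] is nonnegative. *)
Definition Pos h :=
  adj p h h /\ exists2 t, 0 < t & bnd (fun b => t%:C%C *: b - h b) t.

(** The norm form of positivity makes this the triangle inequality. *)
Lemma PosD h k : Pos h -> Pos k -> Pos (fun b => h b + k b).
Proof.
move=> [hh [t t0 ht]] [kk [s s0 ks]]; split; first exact: adj_add.
exists (t + s) => [|b]; first exact: addr_gt0.
rewrite rmorphD /= scalerDl opprD addrACA (le_trans (rnormD _ _)) // mulrDl.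
by rewrite lerD.
Qed.

Lemma Pos_sub c h : 0 < c -> adj p h h -> bnd h c ->
  Pos (fun b => c%:C%C *: b - h b).
Proof.
move=> c0 hh hc; split.
  by apply: adj_sub => //; exact: (adj_scale_real c (adj_id p)).
by exists c => // b; rewrite opprB addrC subrK.
Qed.

(** [bnd_1_sub_square] applied to h / d, where d = c + 1 exceeds the bound of h and is positive even
    if c is 0. *)
Lemma Pos_square h : adj p h h -> Pos (fun b => h (h b)).
Proof.
move=> hh; split; first exact: adj_comp.
have [_ _ [c c0 hc]] := hh.
have d0 : 0 < c + 1 by rewrite ltr_wpDl.
have hd b : rnorm (h b) <= (c + 1) * rnorm b.
  by rewrite (le_trans (hc _)) // ler_wpM2r ?rnorm_ge0 // lerDl.
move: (c + 1) d0 hd => d d0 hd.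
have g1 : bnd (fun b => (d^-1)%:C%C *: h b) 1.
  move=> b; rewrite rnormZr ger0_norm ?invr_ge0 ?(ltW d0) // mul1r.
  by rewrite ler_pdivrMl.
exists (d ^+ 2) => [|b]; first exact: exprn_gt0.
have := bnd_1_sub_square (adj_scale_real d^-1 hh) g1 b.
rewrite mul1r (adj_scaleE _ _ hh) scalerA -rmorphM /=.
have -> : (d ^+ 2)%:C%C *: b - h (h b) =
    (d ^+ 2)%:C%C *: (b - (d^-1 * d^-1)%:C%C *: h (h b)).
  rewrite scalerBr scalerA -rmorphM /=; congr (_ - _).
  by rewrite -expr2 exprVn mulfV ?expf_neq0 ?gt_eqF // rmorph1 scale1r.
move=> g2; rewrite rnormZr ger0_norm ?exprn_ge0 ?(ltW d0) //.
by rewrite ler_pM2l // exprn_gt0.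
Qed.

(** From |t - h| <= t, the operator y = 1 - h / t is a contraction, and the root of 1 - y multiplied
    by the square root of t squares to h. *)
Lemma Pos_sqrt h : Pos h -> exists k, [/\ Pos k, forall b, k (k b) = h b &
  forall T S, adj p T S -> (forall b, T (h b) = h (T b)) ->
    forall b, T (k b) = k (T b)].
Proof.
move=> [hh [t t0 ht]].
pose y b := b - (t^-1)%:C%C *: h b.
have ysa : adj p y y by apply: adj_sub (adj_id p) _; exact: adj_scale_real.
have tK b : t%:C%C *: ((t^-1)%:C%C *: b) = b.
  by rewrite scalerA -rmorphM /= mulfV ?gt_eqF // rmorph1 scale1r.
have y1 : bnd y 1.
  move=> b; have := ht b; rewrite -{1}(tK (h b)) -scalerBr rnormZr.
  by rewrite ger0_norm ?(ltW t0) // ler_pM2l // mul1r.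
have [k [kk k2 k1 kc]] := sqrt_exists ysa y1.
have s0 : 0 < Num.sqrt t by rewrite sqrtr_gt0.
exists (fun b => (Num.sqrt t)%:C%C *: k b); split.
- split; first exact: adj_scale_real.
  exists (Num.sqrt t) => // b; rewrite -scalerBr rnormZr ger0_norm ?(ltW s0) //.
  by rewrite ler_pM2l // -[leRHS]mul1r.
- move=> b; rewrite (adj_scaleE _ _ kk) scalerA -rmorphM /= -expr2.
  by rewrite sqr_sqrtr ?ltW // k2 /y opprB addrC subrK tK.
- move=> T S TS Th b; rewrite (adj_scaleE _ _ TS) (kc _ _ TS) // => {}b.
  by rewrite /y (adj_subE _ _ TS) (adj_scaleE _ _ TS) Th.
Qed.

(** For d > c the operator d - h = (d - (h + k)) + k is positive. The roots r of h and l of d - h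
    commute and r^2 + l^2 = d, so |r|^2 <= d. The detour through d > c covers c = 0, where [Pos_sub]
    does not apply. *)
Lemma Pos_bnd h k c : Pos h -> Pos k -> 0 <= c ->
  bnd (fun b => h b + k b) c -> bnd h c.
Proof.
move=> hP kP c0 hkc b; apply/ler_addgt0Pr => e e0.
have b1 : 0 < rnorm b + 1 by rewrite ltr_wpDl ?rnorm_ge0.
suff hd : bnd h (c + e / (rnorm b + 1)).
  rewrite (le_trans (hd _)) // mulrDl lerD2l mulrAC.
  by rewrite ler_pdivrMr // ler_pM2l // lerDl.
set d := c + _.
have d0 : 0 < d by rewrite ltr_wpDl ?divr_gt0.
have hkd : bnd (fun b => h b + k b) d.
  move=> a; rewrite (le_trans (hkc _)) // ler_wpM2r ?rnorm_ge0 // lerDl.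
  by rewrite ltW // divr_gt0.
have [hh _] := hP; have [kk _] := kP.
have dh : Pos (fun b => d%:C%C *: b - h b).
  have := PosD (Pos_sub d0 (adj_add hh kk) hkd) kP.
  by under eq_fun do rewrite opprD addrA subrK.
have [r [[rr _] r2 _]] := Pos_sqrt hP.
have [l [[ll _] l2 lc]] := Pos_sqrt dh.
have rs : bnd r (Num.sqrt d).
  apply: (bnd_sum_squares (l := l)); rewrite ?sqrtr_ge0 //.
    apply: (lc _ _ rr) => a.
    by rewrite (adj_subE _ _ rr) (adj_scaleE _ _ rr) -!r2.
  move=> a; rewrite r2 l2 addrC subrK sqr_sqrtr ?(ltW d0) //.
  by rewrite rnormZr ger0_norm ?(ltW d0).
move=> a; rewrite -r2 -(sqr_sqrtr (ltW d0)) expr2 -mulrA.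
by rewrite (le_trans (rs _)) // ler_wpM2l ?sqrtr_ge0.
Qed.

Lemma adj_square_eq0 k : adj p k k -> (forall b, k (k b) = 0) ->
  forall b, k b = 0.
Proof.
move=> kk k2 b; apply/eqP; rewrite -rnorm_eq0 eq_le rnorm_ge0 andbT.
rewrite -(mul0r (rnorm b)); apply: (adj_bnd (lexx 0) kk) => a.
by rewrite k2 rnorm0 expr0n mul0r.
Qed.

(* Kaplansky: if [y] and [y^*] satisfy [y^* y = - a^2] and [y y^* = - w^2], then
   [y^* y + y y^*] is both positive, as a sum of two squares, and negative;
   hence [a^2 = 0]. *)
Lemma square_eq0 T S k l : adj p T S -> adj p k k -> adj p l l ->
  (forall b, S (T b) = - k (k b)) -> (forall b, T (S b) = - l (l b)) ->
  forall b, k b = 0.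
Proof.
move=> TS kk ll STk TSl; have ST := adj_sym TS.
apply: adj_square_eq0 => // b.
have aa := adj_add TS ST; have dd := adj_scale 'i (adj_sub TS ST).
have aa2 : (fun b => S b + T b) = (fun b => T b + S b).
  by apply/funext => a; rewrite addrC.
rewrite aa2 in aa.
have dd2 : (fun b => 'i^* *: (S b - T b)) = (fun b => 'i *: (T b - S b)).
  by apply/funext => a; rewrite conjCi scaleNr -scalerN opprB.
rewrite dd2 in dd.
have kP := Pos_square kk; have lP := Pos_square ll.
(* The last two squares are those of T + S and 'i (T - S); they add up to 2 (T S + S T) = - 2 l^2 -
   2 k^2, so k^2 + P = 0. *)
have P := PosD (PosD (PosD (PosD lP lP) kP) (Pos_square aa)) (Pos_square dd).
apply/eqP; rewrite -rnorm_eq0 eq_le rnorm_ge0 andbT -(mul0r (rnorm b)).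
apply: (Pos_bnd kP P (lexx 0)) => a; rewrite mul0r.
rewrite (_ : _ + _ = 0) ?rnorm0 //.
rewrite (adj_scaleE 'i _ TS) (adj_scaleE 'i _ ST) -scalerBr scale_ii.
rewrite (adj_subE _ _ TS) (adj_subE _ _ ST) (adj_addE _ _ TS) (adj_addE _ _ ST).
rewrite !STk !TSl; set u := k (k a); set v := l (l a).
set x := T (T a); set y := S (S a).
have -> : x + - v + (- u + y) = (x + y) - (v + u).
  by rewrite opprD [- u + y]addrC addrACA.
have -> : - (x - - v - (- u - y)) = - (x + y) - (v + u).
  by rewrite !opprD !opprK [- u - y]addrC addrACA.
have UVW (e f g : E) : e + (f - g) + (- f - g) = e - g - g.
  by rewrite [f - g]addrC !addrA addrK.
rewrite UVW -[v + v + u]addrA addrK opprD.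
by rewrite [v + _]addrA subrr add0r subrr.
Qed.

(** With h = S T and r = |h|, the operator m = r - h is twice the negative part of h, to be shown
    zero. As r^2 = h^2, one has m r = - m h, so k = m r^{1/2} satisfies k^2 = - m h m. For y = T m k
    this gives y^* y = - k^4 and y y^* = - w^2 with w = T m^2 S, and [square_eq0] yields k^2 = 0,
    hence k = 0. Then m^2 r = 0 and m^2 h = - m^2 r = 0, so m^4 = 0 and m = 0. *)
Lemma Pos_adj T S : adj p T S -> Pos (fun b => S (T b)).
Proof.
move=> TS; have ST := adj_sym TS.
set h := fun b => S (T b).
have hh : adj p h h by exact: adj_comp.
have [r [rP r2 rc]] := Pos_sqrt (Pos_square hh); have [rr _] := rP.
have hr b : h (r b) = r (h b) by apply: (rc _ _ hh).
have [q [[qq _] q2 qc]] := Pos_sqrt rP.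
have hq b : h (q b) = q (h b) by apply: (qc _ _ hh).
have rq b : r (q b) = q (r b) by rewrite -!q2.
pose m b := r b - h b.
have mm : adj p m m by exact: adj_sub.
have hm b : h (m b) = m (h b) by rewrite /m (adj_subE _ _ hh) hr.
have mq b : m (q b) = q (m b) by rewrite /m (adj_subE _ _ qq) hq rq.
have mr b : m (r b) = - m (h b).
  by rewrite /m r2 opprB hr.
pose k b := m (q b).
have kk : adj p k k.
  have := adj_comp mm qq; rewrite (_ : (fun b => q (m b)) = k) //.
  by apply/funext => b; rewrite /k mq.
have k2 b : k (k b) = - m (h (m b)).
  by rewrite /k -mq q2 mr (adj_oppE _ mm) hm.
pose w b := T (m (m (S b))).
have ww : adj p w w by exact: (adj_comp TS (adj_comp mm (adj_comp mm ST))).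
have kk2 : adj p (fun b => k (k b)) (fun b => k (k b)) by exact: adj_comp.
have TmS : adj p (fun b => T (m (k b))) (fun b => k (m (S b))).
  exact: (adj_comp TS (adj_comp mm kk)).
have k0 b : k b = 0.
  apply: (adj_square_eq0 kk) => {}b; apply: (square_eq0 TmS kk2 ww) => {}b.
    by rewrite -/(h _) -[m (h _)]opprK -k2 (adj_oppE _ kk).
  by rewrite k2 (adj_oppE _ mm) (adj_oppE _ TS).
have m0 b : m b = 0.
  apply: (adj_square_eq0 mm) => {}b.
  apply: (adj_square_eq0 (adj_comp mm mm)) => {}b.
  have mmr a : m (m (r a)) = 0 by rewrite -q2 (mq (q a)); exact: k0.
  have mmh a : m (m (h a)) = 0.
    by rewrite -[m (h a)]opprK -mr (adj_oppE _ mm) mmr oppr0.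
  by rewrite -/(m _) -[RHS](subrr (0 : E)) -{1}(mmr (m b)) -(mmh (m b))
    -!(adj_subE _ _ mm).
have -> : h = r; last exact: rP.
by apply/funext => b; apply/esym/eqP; rewrite -subr_eq0; apply/eqP/m0.
Qed.

End Positivity.

(** * Fibres of a Fell bundle *)

Section Groupoid.
Variable G : groupoid.
Implicit Types g h k l m n x : G.

Lemma gsrcV g : gsrc (ginv g) = grng g.
Proof. by rewrite /gsrc /grng ginvK. Qed.

Lemma grngV g : grng (ginv g) = gsrc g.
Proof. by rewrite /gsrc /grng ginvK. Qed.

Lemma gsrcM g h : composable g h -> gsrc (gmul g h) = gsrc h.
Proof.
move=> gh; have hh : composable h (ginv h) by rewrite /composable grngV.
by have := composableMl gh hh; rewrite /composable grngV.
Qed.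

Lemma grngM g h : composable g h -> grng (gmul g h) = grng g.
Proof.
move=> gh; have gg : composable (ginv g) g by rewrite /composable gsrcV.
by have := composableMr gg gh; rewrite /composable gsrcV => <-.
Qed.

(** Relational form of the product. Fibre elements are typed by their base point, so it is
    convenient to name the base point of a product freely and to carry this proposition along
    instead of rewriting in types. *)
Definition mult g h k := composable g h /\ gmul g h = k.

Lemma mult_src g h k : mult g h k -> gsrc k = gsrc h.
Proof. by move=> [gh <-]; rewrite gsrcM. Qed.

Lemma mult_rng g h k : mult g h k -> grng k = grng g.
Proof. by move=> [gh <-]; rewrite grngM. Qed.

Lemma mult_mid g h k : mult g h k -> gsrc g = grng h.
Proof. by case. Qed.

Lemma mult_divl g h k : mult g h k -> mult (ginv g) k h.
Proof.
move=> [gh <-]; split; last exact: gmulKl.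
by rewrite /composable gsrcV grngM.
Qed.

Lemma mult_divr g h k : mult g h k -> mult k (ginv h) g.
Proof.
move=> [gh <-]; split; last exact: gmulKr.
by rewrite /composable grngV gsrcM.
Qed.

Lemma mult_srcr g : mult g (gsrc g) g.
Proof.
have gg : mult (ginv g) g (gsrc g) by split=> //; rewrite /composable gsrcV.
by have := mult_divl gg; rewrite ginvK.
Qed.

Lemma mult_rngl g : mult (grng g) g g.
Proof.
have gg : mult g (ginv g) (grng g) by split=> //; rewrite /composable grngV.
by have := mult_divr gg; rewrite ginvK.
Qed.

Lemma multVg g : mult (ginv g) g (gsrc g).
Proof. by split=> //; rewrite /composable gsrcV. Qed.

Lemma gsrc_src g : gsrc (gsrc g) = gsrc g.
Proof. exact: mult_src (multVg g). Qed.

Lemma grng_src g : grng (gsrc g) = gsrc g.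
Proof. by rewrite (mult_rng (multVg g)) grngV. Qed.

Lemma mult_assoc g h k l m n : mult g h k -> mult k l m -> mult h l n ->
  mult g n m.
Proof.
move=> [gh <-] [kl <-] [hl <-]; split; last by rewrite gmulA.
exact: composableMr.
Qed.

Lemma mult_assocV g h k l m n : mult h l n -> mult g n m -> mult g h k ->
  mult k l m.
Proof.
move=> [hl <-] [gn <-] [gh <-]; split; last by rewrite gmulA.
exact: composableMl.
Qed.

Lemma multV g h k : mult g h k -> mult (ginv h) (ginv g) (ginv k).
Proof.
move=> ghk; have := mult_divl ghk.
by move=> /mult_divr/mult_divl; rewrite ?ginvK.
Qed.

Lemma units_src x : units G x -> gsrc x = x.
Proof. by move=> [g _ <-]; rewrite gsrc_src. Qed.

Lemma units_rng x : units G x -> grng x = x.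
Proof. by move=> [g _ <-]; rewrite grng_src. Qed.

Lemma units_inv x : units G x -> ginv x = x.
Proof.
move=> xu; have := mult_srcr (ginv x); rewrite gsrcV (units_rng xu) => h1.
have := multVg x; rewrite (units_src xu) => h2.
by rewrite -h1.2 h2.2.
Qed.

Lemma units_gsrc g : units G (gsrc g). Proof. by exists g. Qed.

Lemma units_grng g : units G (grng g).
Proof. by rewrite -gsrcV; exact: units_gsrc. Qed.

Lemma mult_exl g h : gsrc h = gsrc g -> mult (gmul g (ginv h)) h g.
Proof.
move=> hg; have gh : composable g (ginv h) by rewrite /composable grngV.
by have := mult_divr (conj gh erefl); rewrite ginvK.
Qed.

Lemma mult_exr g h : grng h = grng g -> mult h (gmul (ginv h) g) g.
Proof.
move=> hg; have gh : composable (ginv h) g by rewrite /composable gsrcV.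
by have := mult_divl (conj gh erefl); rewrite ginvK.
Qed.

End Groupoid.

Section Fibres.
Variables (R : realType) (G : etaleGroupoid) (B : fellBundle R G).
Implicit Types g h k l m n x y : G.

(* transport along an equality [g = k]; it is 0 if [g <> k] *)
Definition tr k g (u : fibre B g) : fibre B k := at_fibre k (inc u).

Lemma trE g (u : fibre B g) : tr g u = u.
Proof.
rewrite /tr /at_fibre; case: xgetP => [v _ /= uv|/(_ u)/(_ erefl)//].
exact: Defs.inc_inj uv.
Qed.

Lemma inc_tr g k (u : fibre B g) : g = k -> inc (tr k u) = inc u.
Proof. by move=> <-; rewrite trE. Qed.

Lemma inc_eq g h (u : fibre B g) (v : fibre B h) :
  inc u = inc v -> g = h /\ v = tr h u.
Proof.
move=> uv; have gh : g = h by rewrite -(rho_inc u) uv rho_inc.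
by split=> //; apply: Defs.inc_inj; rewrite inc_tr.
Qed.

Lemma rnorm_inc g h (u : fibre B g) (v : fibre B h) :
  inc u = inc v -> rnorm u = rnorm v.
Proof. by move=> /inc_eq[? ->]; subst h; rewrite trE. Qed.

Lemma inc_fmul g h (u : fibre B g) (v : fibre B h) g' h' (u' : fibre B g')
    (v' : fibre B h') : inc u = inc u' -> inc v = inc v' ->
  inc (fmul u v) = inc (fmul u' v').
Proof. by move=> /inc_eq[? ->] /inc_eq[? ->]; subst g' h'; rewrite !trE. Qed.

Lemma inc_fstar g (u : fibre B g) g' (u' : fibre B g') :
  inc u = inc u' -> inc (fstar u) = inc (fstar u').
Proof. by move=> /inc_eq[? ->]; subst g'; rewrite !trE. Qed.

Lemma trD g k (u v : fibre B g) : g = k -> tr k (u + v) = tr k u + tr k v.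
Proof. by move=> <-; rewrite !trE. Qed.

Lemma trZ g k (t : R[i]) (u : fibre B g) : g = k -> tr k (t *: u) = t *: tr k u.
Proof. by move=> <-; rewrite !trE. Qed.

(** The product placed in a prescribed fibre, meaningful under [mult g h k]. It lets associativity
    be an equation inside one fibre. *)
Definition ml k g h (u : fibre B g) (v : fibre B h) : fibre B k :=
  tr k (fmul u v).

Lemma inc_ml g h k (u : fibre B g) (v : fibre B h) :
  mult g h k -> inc (ml k u v) = inc (fmul u v).
Proof. by move=> [_ ghk]; exact: inc_tr. Qed.

Section Product.
Variables (g h k : G) (ghk : mult g h k).
Implicit Types (u : fibre B g) (v : fibre B h).

Lemma ml_linearl v : linear (fun u : fibre B g => ml k u v).
Proof. by case: ghk => gh <- c a b; rewrite /ml !trE fmul_linearl. Qed.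

Lemma ml_linearr u : linear (fun v : fibre B h => ml k u v).
Proof. by case: ghk => gh <- c a b; rewrite /ml !trE fmul_linearr. Qed.

Lemma mlDl u u' v : ml k (u + u') v = ml k u v + ml k u' v.
Proof. by have := ml_linearl v 1 u u'; rewrite !scale1r. Qed.

Lemma mlDr u v v' : ml k u (v + v') = ml k u v + ml k u v'.
Proof. by have := ml_linearr u 1 v v'; rewrite !scale1r. Qed.

Lemma ml0l v : ml k (0 : fibre B g) v = 0.
Proof. by apply: (addIr (ml k (0 : fibre B g) v)); rewrite -mlDl !add0r. Qed.

Lemma ml0r u : ml k u (0 : fibre B h) = 0.
Proof. by apply: (addIr (ml k u (0 : fibre B h))); rewrite -mlDr !add0r. Qed.

Lemma mlZl (c : R[i]) u v : ml k (c *: u) v = c *: ml k u v.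
Proof. by have := ml_linearl v c u 0; rewrite !addr0 ml0l addr0. Qed.

Lemma mlZr (c : R[i]) u v : ml k u (c *: v) = c *: ml k u v.
Proof. by have := ml_linearr u c v 0; rewrite !addr0 ml0r addr0. Qed.

Lemma mlNl u v : ml k (- u) v = - ml k u v.
Proof. by rewrite -scaleN1r mlZl scaleN1r. Qed.

Lemma mlNr u v : ml k u (- v) = - ml k u v.
Proof. by rewrite -scaleN1r mlZr scaleN1r. Qed.

Lemma mlBl u u' v : ml k (u - u') v = ml k u v - ml k u' v.
Proof. by rewrite mlDl mlNl. Qed.

Lemma mlBr u v v' : ml k u (v - v') = ml k u v - ml k u v'.
Proof. by rewrite mlDr mlNr. Qed.

Lemma ml_suml (I : Type) (r : seq I) (P : pred I) (F : I -> fibre B g) v :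
  ml k (\sum_(i <- r | P i) F i) v = \sum_(i <- r | P i) ml k (F i) v.
Proof. by apply: (big_morph _ (fun a b => mlDl a b v) (ml0l v)). Qed.

Lemma ml_sumr (I : Type) (r : seq I) (P : pred I) (F : I -> fibre B h) u :
  ml k u (\sum_(i <- r | P i) F i) = \sum_(i <- r | P i) ml k u (F i).
Proof. by apply: (big_morph _ (mlDr u) (ml0r u)). Qed.

Lemma ml_norm u v : rnorm (ml k u v) <= rnorm u * rnorm v.
Proof. by case: ghk => gh <-; rewrite /ml trE fmul_norm. Qed.

End Product.

Lemma ml_trl g h g' k (u : fibre B g') (v : fibre B h) : g' = g ->
  ml k (tr g u) v = ml k u v.
Proof. by move=> <-; rewrite trE. Qed.

Lemma ml_trr g h h' k (u : fibre B g) (v : fibre B h') : h' = h ->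
  ml k u (tr h v) = ml k u v.
Proof. by move=> <-; rewrite trE. Qed.

Lemma mlA g h k l m n (u : fibre B g) (v : fibre B h) (w : fibre B l) :
  mult g h k -> mult k l m -> mult h l n ->
  ml m (ml k u v) w = ml m u (ml n v w).
Proof.
move=> ghk klm hln; have gnm := mult_assoc ghk klm hln.
apply: Defs.inc_inj; rewrite (inc_ml _ _ klm) (inc_ml _ _ gnm).
rewrite (inc_fmul (inc_ml u v ghk) (erefl (inc w))).
rewrite (inc_fmul (erefl (inc u)) (inc_ml v w hln)).
by rewrite fmulA //; [case: ghk|case: hln].
Qed.

Lemma fstar0 g : fstar (0 : fibre B g) = 0.
Proof.
have := fstar_antilinear 1 (0 : fibre B g) 0; rewrite scaler0 addr0.
by rewrite (conjC1 R[i]) scale1r => /esym/eqP; rewrite -subr_eq0 addrK => /eqP.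
Qed.

Lemma fstarD g (u v : fibre B g) : fstar (u + v) = fstar u + fstar v.
Proof.
by have := fstar_antilinear 1 u v; rewrite scale1r (conjC1 R[i]) scale1r.
Qed.

Lemma fstarZ g (c : R[i]) (u : fibre B g) : fstar (c *: u) = c^* *: fstar u.
Proof.
by have := fstar_antilinear c u 0; rewrite !addr0 fstar0 addr0.
Qed.

Lemma fstarN g (u : fibre B g) : fstar (- u) = - fstar u.
Proof. by rewrite -scaleN1r fstarZ conjN1 scaleN1r. Qed.

Lemma fstar_sum g (I : Type) (r : seq I) (P : pred I) (F : I -> fibre B g) :
  fstar (\sum_(i <- r | P i) F i) = \sum_(i <- r | P i) fstar (F i).
Proof. by apply: (big_morph _ (@fstarD g) (fstar0 g)). Qed.

(** The C*-identity gives |v|^2 = |v^* v| <= |v^*| |v|; applying this to v^* as well gives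
    equality. *)
Lemma rnorm_fstar g (u : fibre B g) : rnorm (fstar u) = rnorm u.
Proof.
have le h (v : fibre B h) : rnorm v <= rnorm (fstar v).
  have [->|v0] := eqVneq v 0; first by rewrite rnorm0 rnorm_ge0.
  have : 0 < rnorm v by rewrite lt_def rnorm_eq0 v0 rnorm_ge0.
  move=> /ler_pM2r <-; rewrite -expr2 -fstar_norm fmul_norm //.
  by rewrite /composable gsrcV.
apply/eqP; rewrite eq_le le andbT; apply: (le_trans (le _ _)).
by rewrite (rnorm_inc (fstarK u)).
Qed.

Definition ip k g h (u : fibre B g) (v : fibre B h) : fibre B k :=
  ml k (fstar u) v.

Definition sq k g (u : fibre B g) : fibre B k := ip k u u.

Lemma ml_fstar g h k (u : fibre B g) (v : fibre B h) : mult g h k ->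
  fstar (ml k u v) = ml (ginv k) (fstar v) (fstar u).
Proof.
move=> ghk; apply: Defs.inc_inj; rewrite (inc_ml _ _ (multV ghk)).
by rewrite (inc_fstar (inc_ml u v ghk)) fstarM //; case: ghk.
Qed.

Section Pairing.
Variable g : G.
Implicit Types u v w : fibre B g.

Let gg := multVg g.

Fact fell_linearr u : linear (ip (gsrc g) u : fibre B g -> _).
Proof. exact: ml_linearr. Qed.

Fact fell_linearl (c : R[i]) u v w :
  ip (gsrc g) (c *: u + v) w = c^* *: ip (gsrc g) u w + ip (gsrc g) v w.
Proof. by rewrite /ip fstarD fstarZ (mlDl gg) (mlZl gg). Qed.

Fact fell_norm u v : rnorm (ip (gsrc g) u v) <= rnorm u * rnorm v.
Proof. by rewrite (le_trans (ml_norm gg _ _)) // rnorm_fstar. Qed.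

Fact fell_diag u : rnorm (ip (gsrc g) u u) = rnorm u ^+ 2.
Proof. by rewrite /ip /ml trE fstar_norm. Qed.

Definition fell_pairing : pairing (fibre B g) (fibre B (gsrc g)) :=
  Pairing fell_linearr fell_linearl fell_norm fell_diag.

End Pairing.

Definition lmult g y (w : fibre B y) (b : fibre B g) : fibre B g := ml g w b.

Arguments lmult g {y} w b.

(** [fstar w] lies over the inverse of the unit y, which equals y only propositionally; [tr] brings
    it back. *)
Lemma lmult_adj g y (w : fibre B y) : grng g = y ->
  adj (fell_pairing g) (lmult g w) (lmult g (tr y (fstar w))).
Proof.
move=> gy; subst y; have yg := mult_rngl g.
have yy : ginv (grng g) = grng g by rewrite units_inv //; exact: units_grng.
have assoc (w' w'' : fibre B (grng g)) : inc w'' = inc (fstar w') ->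
    forall a b : fibre B g, ip (gsrc g) (lmult g w' a) b =
      ip (gsrc g) a (lmult g w'' b).
  move=> ww a b; rewrite /ip /lmult (ml_fstar _ _ yg).
  have yVg : mult (ginv (grng g)) g g by rewrite yy.
  rewrite (mlA _ _ _ (multV yg) (multVg g) yVg); congr (ml _ _ _).
  apply: Defs.inc_inj; rewrite (inc_ml _ _ yVg) (inc_ml _ _ yg).
  exact: inc_fmul.
split=> /=.
- by apply: assoc; rewrite inc_tr.
- by apply: assoc; rewrite (inc_fstar (inc_tr _ yy)) fstarK.
- by exists (rnorm w); [exact: rnorm_ge0|move=> b; exact: ml_norm].
Qed.

(** Positivity in the C*-algebra over a unit x, through its left multiplication on itself. *)
Definition posf x (w : fibre B x) := Pos (fell_pairing x) (lmult x w).

Lemma rnorm_sq x g (u : fibre B g) : gsrc g = x ->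
  rnorm (sq x u) = rnorm u ^+ 2.
Proof. by move=> <-; exact: fell_diag. Qed.

Section Positive.
Variables (x : G) (xu : units G x).
Implicit Types a b : fibre B x.

Let xx : mult x x x.
Proof. by rewrite -{2}(units_src xu); exact: mult_srcr. Qed.

Lemma posfD a b : posf a -> posf b -> posf (a + b).
Proof.
move=> ha hb; have := PosD ha hb.
rewrite (_ : (fun c => _) = lmult x (a + b)) //.
by apply/funext => c; rewrite /lmult (mlDl xx).
Qed.

(** By [fstar_pos] the element u may be taken in the fibre over x itself; left multiplication by v^*
    v is then the adjoint of left multiplication by v composed with that multiplication, and
    [Pos_adj] applies. *)
Lemma posf_sq g (u : fibre B g) : gsrc g = x -> posf (sq x u).
Proof.
move=> gx; have [v vu] : exists v : fibre B x,
    inc (fmul (fstar v) v) = inc (fmul (fstar u) u).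
  by rewrite -gx; exact: fstar_pos.
have xV := units_inv xu.
have gg : mult (ginv g) g x by rewrite -gx; exact: multVg.
have Vxx : mult (ginv x) x x by rewrite xV.
have -> : sq x u = sq x v.
  by apply: Defs.inc_inj; rewrite (inc_ml _ _ gg) -vu (inc_ml _ _ Vxx).
have := Pos_adj (lmult_adj v (units_rng xu)).
rewrite /posf; set T := fun b => _; rewrite (_ : T = lmult x (sq x v)) //.
apply/funext => c; rewrite /T /lmult /sq /ip ml_trl //.
by rewrite (mlA _ _ _ Vxx xx xx).
Qed.

Lemma posf0 : posf (0 : fibre B x).
Proof.
have := posf_sq (0 : fibre B x) (units_src xu).
by rewrite /sq /ip ml0r // units_inv.
Qed.

Lemma posf_sum (I : Type) (r : seq I) (P : pred I) (F : I -> fibre B x) :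
  (forall i, P i -> posf (F i)) -> posf (\sum_(i <- r | P i) F i).
Proof.
move=> h; elim/big_ind: _ => //; [exact: posf0|exact: posfD].
Qed.

(** [Pos_bnd] bounds left multiplication by a by |a + b|. Evaluation at a^*, where |a a^*| = |a|^2,
    recovers |a|; this does the work of a unit. *)
Lemma rnorm_posfD a b : posf a -> posf b -> rnorm a <= rnorm (a + b).
Proof.
move=> aP bP.
have abn : bnd (fun c => lmult x a c + lmult x b c) (rnorm (a + b)).
  by move=> c; rewrite /lmult -(mlDl xx) ml_norm.
have /(_ (tr x (fstar a))) := Pos_bnd aP bP (rnorm_ge0 _) abn.
have xV := units_inv xu.
have -> : rnorm (tr x (fstar a)) = rnorm a.
  by rewrite (rnorm_inc (inc_tr _ xV)) rnorm_fstar.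
have -> : rnorm (lmult x a (tr x (fstar a))) = rnorm a ^+ 2.
  have := fstar_norm (fstar a); rewrite rnorm_fstar => <-; apply: rnorm_inc.
  rewrite /lmult ml_trr // (inc_ml (k := x)); last by rewrite xV.
  by apply: inc_fmul => //; rewrite fstarK.
have [->|a0] := eqVneq a 0; first by rewrite rnorm0 rnorm_ge0.
have a1 : 0 < rnorm a by rewrite lt_def rnorm_eq0 a0 rnorm_ge0.
by rewrite expr2 ler_pM2r.
Qed.

End Positive.

Lemma posf_scale x (t : R) (a : fibre B x) : units G x -> 0 <= t -> posf a ->
  posf (t%:C%C *: a).
Proof.
move=> xu; rewrite le_eqVlt => /predU1P[<- _|t0 [aa [s s0 sa]]].
  by rewrite scale0r; exact: posf0.
have xx : mult x x x by rewrite -{2}(units_src xu); exact: mult_srcr.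
have -> : posf (t%:C%C *: a) =
  Pos (fell_pairing x) (fun b => t%:C%C *: lmult x a b).
  by congr (Pos _ _); apply/funext => b; rewrite /lmult (mlZl xx).
split; first exact: adj_scale_real.
exists (t * s) => [|b]; first exact: mulr_gt0.
rewrite rmorphM /= -scalerA -scalerBr rnormZr gtr0_norm // -mulrA.
by rewrite ler_pM2l.
Qed.

(* Since [t >= |d|^2], the operator [t - d^* d] is a square [c^2], and
   [t w^* w - w^* d^* d w = (c w)^* (c w)]. *)
Lemma posf_mul_bound g h m x (d : fibre B g) (w : fibre B h) (t : R) :
  mult g h m -> gsrc h = x -> 0 < t -> rnorm d ^+ 2 <= t ->
  posf (t%:C%C *: sq x w - sq x (ml m d w)).
Proof.
move=> ghm hx t0 dt; subst x; have gh := mult_mid ghm.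
pose e := sq (grng h) d.
have dd : mult (ginv g) g (grng h) by rewrite -gh; exact: multVg.
have eV : tr (grng h) (fstar e) = e.
  apply: Defs.inc_inj; rewrite inc_tr ?units_inv //; last exact: units_grng.
  rewrite (inc_fstar (inc_ml _ _ dd)) fstarM; last by case: dd.
  by rewrite (inc_ml _ _ dd); apply: inc_fmul => //; rewrite fstarK.
have ea : adj (fell_pairing h) (lmult h e) (lmult h e).
  by have := lmult_adj e (erefl (grng h)); rewrite eV.
have et : bnd (lmult h e) t.
  move=> b; rewrite (le_trans (ml_norm (mult_rngl h) _ _)) //.
  by rewrite ler_wpM2r ?rnorm_ge0 // rnorm_sq.
have [c [[cc _] c2 _]] := Pos_sqrt (Pos_sub t0 ea et).
have -> : t%:C%C *: sq (gsrc h) w - sq (gsrc h) (ml m d w) = sq (gsrc h) (c w).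
  have -> : sq (gsrc h) (c w) = fell_pairing h (c w) (c w) by [].
  have [-> _ _] := cc; rewrite c2 pairBr pairZr; congr (_ - _).
  rewrite /= /sq /ip (ml_fstar _ _ ghm).
  have mm : mult (ginv m) m (gsrc h) by rewrite -(mult_src ghm); exact: multVg.
  rewrite (mlA _ _ _ (multV ghm) mm (mult_divl ghm)); congr (ml _ _ _).
  by rewrite -(mlA _ _ _ dd (mult_rngl h) ghm).
by apply: posf_sq => //; exact: units_gsrc.
Qed.

Lemma fstar_ip g h k (u : fibre B g) (v : fibre B h) : mult g k h ->
  fstar (ip k u v) = ip (ginv k) v u.
Proof.
move=> gkh; have ghk := mult_divl gkh.
rewrite /ip (ml_fstar _ _ ghk); apply: Defs.inc_inj.
have m1 := multV ghk; have m2 := m1; rewrite ginvK in m2.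
by rewrite (inc_ml _ _ m1) (inc_ml _ _ m2); apply: inc_fmul => //;
  rewrite fstarK.
Qed.

Lemma ipBr g h k (u : fibre B g) (v v' : fibre B h) : mult (ginv g) h k ->
  ip k u (v - v') = ip k u v - ip k u v'.
Proof. by move=> ghk; rewrite /ip mlBr. Qed.

Lemma ipBl g h k (u u' : fibre B g) (v : fibre B h) : mult (ginv g) h k ->
  ip k (u - u') v = ip k u v - ip k u' v.
Proof. by move=> ghk; rewrite /ip fstarD fstarN mlDl // mlNl. Qed.

Lemma sq_sub_scale x g (t : R) (u v : fibre B g) : gsrc g = x ->
  sq x (u - t%:C%C *: v) =
  sq x u - t%:C%C *: (ip x u v + ip x v u) + (t ^+ 2)%:C%C *: sq x v.
Proof.
move=> <-; have gg := multVg g.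
rewrite /sq (ipBr _ _ _ gg) !(ipBl _ _ _ gg) /ip fstarZ conj_real.
rewrite !(mlZl gg) !(mlZr gg) scalerA -rmorphM -expr2 opprB scalerDr opprD.
rewrite [X in _ + X = _]addrC !addrA; congr (_ + _).
by rewrite addrAC.
Qed.

(** The products u_i^* v_i may lie over any k, not only over a unit: the value at g of a convolution
    a^* b is such a sum, with [al] of the form h g^{-1} and [be] equal to h. *)
Lemma ip_sum_sqr_le (I : Type) (r : seq I) (P : pred I) (al be : I ->
  G) (k x y : G)
    (u : forall i, fibre B (al i)) (v : forall i, fibre B (be i)) :
  (forall i, P i -> mult (al i) k (be i)) -> gsrc k = x -> grng k = y ->
  rnorm (\sum_(i <- r | P i) ip k (u i) (v i)) ^+ 2 <=
  rnorm (\sum_(i <- r | P i) sq y (u i)) * rnorm (\sum_(i <- r | P i) sq x (v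
    i)).
Proof.
move=> ab kx ky; subst x y.
set w := \sum_(i <- r | P i) ip k (u i) (v i).
set U := \sum_(i <- r | P i) sq _ (u i).
set V := \sum_(i <- r | P i) sq _ (v i).
pose c i := ml (be i) (u i) w.
have xu := units_gsrc k.
have key t : 0 <= t -> 2 * t * rnorm w ^+ 2 <=
  rnorm V + t ^+ 2 * (rnorm w ^+ 2 * rnorm U).
  move=> t0.
  have wP : posf ((2 * t)%:C%C *: sq (gsrc k) w).
    by apply: posf_scale; rewrite ?mulr_ge0 //; exact: posf_sq.
  have sP : posf (\sum_(i <- r | P i) sq (gsrc k) (v i - t%:C%C *: c i)).
    apply: posf_sum => // i Pi; apply: posf_sq => //.
    by rewrite (mult_src (ab i Pi)).
  have := rnorm_posfD xu wP sP.
  (* The cross terms of the squares add up to - 2 t w^* w, so the summand placed in front cancels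
     them; it is positive, which keeps the sum of both an upper bound for its norm. *)
  have -> : (2 * t)%:C%C *: sq (gsrc k) w +
      \sum_(i <- r | P i) sq (gsrc k) (v i - t%:C%C *: c i) =
      V + (t ^+ 2)%:C%C *: ip (gsrc k) w (ml k U w).
    have ->: \sum_(i <- r | P i) sq (gsrc k) (v i - t%:C%C *: c i) =
        \sum_(i <- r | P i) (sq (gsrc k) (v i) -
        t%:C%C *: (ip (gsrc k) (ip k (u i) (v i)) w +
          ip (gsrc k) w (ip k (u i) (v i))) +
        (t ^+ 2)%:C%C *: ip (gsrc k) w (ml k (sq (grng k) (u i)) w)).
      apply: eq_bigr => i Pi; have aik := ab i Pi.
      have bk : gsrc (be i) = gsrc k by exact: mult_src aik.
      have bb : mult (ginv (be i)) (be i) (gsrc k) by rewrite -bk;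
        exact: multVg.
      have aa : mult (ginv (al i)) (al i) (grng k).
        by rewrite -(mult_mid aik); exact: multVg.
      rewrite sq_sub_scale //; congr (_ - _ *: (_ + _) + _ *: _).
      - have := multV (mult_divl aik); rewrite ginvK => ba.
        by rewrite [in RHS]/ip (fstar_ip _ _ aik) /ip /c (mlA _ _ _ ba (multVg
          k) aik).
      - by rewrite /ip /c (ml_fstar _ _ aik) (mlA _ _ _ (multV aik) bb
        (mult_divl aik)).
      - rewrite /sq /ip /c (ml_fstar _ _ aik) (mlA _ _ _ (multV aik) bb
        (mult_divl aik)).
        by rewrite -(mlA _ _ _ aa (mult_rngl k) aik).
    rewrite !big_split /= sumrN -!scaler_sumr big_split /= -/V.
    have kk := multVg k.
    rewrite -!(ml_sumr kk) -(ml_suml (mult_rngl k)) -(ml_suml kk) -fstar_sum -/w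
      -/U.
    rewrite -/(sq _ w) rmorphM /= -scalerA.
    rewrite rmorph_nat scaler_nat mulr2n scalerDr addrA; congr (_ + _).
    by rewrite addrC subrK.
  rewrite rnormZr ger0_norm ?mulr_ge0 // rnorm_sq // => /le_trans; apply.
  rewrite (le_trans (rnormD _ _)) // lerD2l rnormZr ger0_norm ?sqr_ge0 //.
  rewrite ler_wpM2l ?sqr_ge0 // expr2 -mulrA.
  rewrite (le_trans (ml_norm (multVg k) _ _)) // rnorm_fstar.
  rewrite ler_wpM2l ?rnorm_ge0 // mulrC.
  exact: (ml_norm (mult_rngl k)).
(* For U nonzero take t = 1 / |U|. For U = 0 the inequality 2 t |w|^2 <= |V| holds for all t >= 0,
   and t = (|V| + 1) / |w|^2 contradicts it unless w = 0. *)
have [U0|U0] := eqVneq (rnorm U) 0; last first.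
  have {}U0 : 0 < rnorm U by rewrite lt_def U0 rnorm_ge0.
  have := key (rnorm U)^-1; rewrite invr_ge0 ltW // => /(_ isT).
  have -> : (rnorm U)^-1 ^+ 2 * (rnorm w ^+ 2 * rnorm U) =
    (rnorm U)^-1 * rnorm w ^+ 2.
    by field; rewrite gt_eqF.
  rewrite mulrDl mul1r mulrDl lerD2r.
  by rewrite ler_pdivrMl.
rewrite U0 mul0r; have [|w0] := leP (rnorm w ^+ 2) 0; first by [].
have := key ((rnorm V + 1) / rnorm w ^+ 2).
rewrite divr_ge0 ?sqr_ge0 ?addr_ge0 ?rnorm_ge0 // => /(_ isT).
rewrite -[2 * _ * _]mulrA divfK ?gt_eqF // U0 !mulr0 addr0.
by have := rnorm_ge0 V; lra.
Qed.

End Fibres.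

(** * Unordered sums and convolution *)

#[local] Existing Instance totally_filter.

Section Summation.
Variables (R : realType) (I : choiceType).

Definition has_sum (V : normedModType R[i]) (f : I -> V) (l : V) :=
  forall e : R, 0 < e -> exists J : {fset I}, forall K : {fset I},
    (J `<=` K)%fset -> rnorm (l - \sum_(i <- K) f i) < e.

Section Normed.
Variable V : normedModType R[i].
Implicit Types (f : I -> V) (J K : {fset I}).

Lemma has_sumP f l : has_sum f l <-> (partial_sum f @ totally --> l)%classic.
Proof.
split=> [h|/cvg_rnormP h e /h[J _ JK]].
  apply/cvg_rnormP => e /h[J JK]; exists J => // K /= /JK.
  by rewrite /partial_sum big_seq_fsetE.
by exists J => K /JK /=; rewrite /partial_sum big_seq_fsetE.
Qed.

Lemma has_sum_cvg f l : has_sum f l -> cvg (partial_sum f @ totally)%classic.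
Proof. by move=> /has_sumP fl; exact: cvgP fl. Qed.

Lemma has_sum_sum f l : has_sum f l -> summability.sum f = l.
Proof.
by move=> /has_sumP; apply: cvg_lim; exact: norm_hausdorff.
Qed.

Lemma cvg_has_sum f : cvg (partial_sum f @ totally)%classic ->
  has_sum f (summability.sum f).
Proof. by move=> h; apply/has_sumP. Qed.

Lemma fsum_disjU J K f : (forall i, i \in K -> i \notin J) ->
  \sum_(i <- (J `|` K)%fset) f i = \sum_(i <- J) f i + \sum_(i <- K) f i.
Proof.
move=> JK; rewrite (eq_bigr (fun i => (if i \in J then f i else 0) +
  (if i \in J then 0 else f i))); last first.
  by move=> i _; case: ifP; rewrite (addr0, add0r).
rewrite big_split /=; congr (_ + _).
  rewrite -(big_fset_incl _ (fsubsetUl J K)) => [|i _ /negbTE -> //].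
  by apply: eq_big_seq => i ->.
rewrite -(big_fset_incl _ (fsubsetUr J K)).
  by apply: eq_big_seq => i /JK /negbTE ->.
by move=> i; rewrite inE => /orP[->//|->].
Qed.

Lemma has_sum_fin f J : (forall i, i \notin J -> f i = 0) ->
  has_sum f (\sum_(i <- J) f i).
Proof.
move=> fJ e e0; exists J => K JK.
by rewrite (big_fset_incl _ JK) ?subrr ?rnorm0 // => i _ /fJ.
Qed.

Lemma has_sum_tail f l : has_sum f l -> forall e : R, 0 < e ->
  exists J, forall K, (forall i, i \in K -> i \notin J) ->
    rnorm (\sum_(i <- K) f i) <= e.
Proof.
move=> fl e e0; have e2 : 0 < e / 2 by rewrite divr_gt0.
have [J JK] := fl _ e2; exists J => K /fsum_disjU KJ.
have := JK _ (fsubsetUl J K); have := JK _ (fsubset_refl J); rewrite KJ.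
set s := \sum_(i <- J) _; set t := \sum_(i <- K) _ => h1 h2.
have -> : t = (l - s) - (l - (s + t)).
  by rewrite opprB [RHS]addrC addrA subrK addrAC subrr add0r.
by rewrite (le_trans (rnormB _ _)) // [leRHS]splitr lerD // ltW.
Qed.

Lemma has_sum_le f l (c : R) : has_sum f l ->
  (forall K, rnorm (\sum_(i <- K) f i) <= c) -> rnorm l <= c.
Proof.
move=> fl fc; apply/ler_addgt0Pr => e /fl[J /(_ _ (fsubset_refl J)) h].
by rewrite -(subrK (\sum_(i <- J) f i) l) (le_trans (rnormD _ _)) // addrC lerD
  // ltW.
Qed.

Lemma has_sumD f f' l l' : has_sum f l -> has_sum f' l' ->
  has_sum (fun i => f i + f' i) (l + l').
Proof.
move=> fl fl' e e0; have e2 : 0 < e / 2 by rewrite divr_gt0.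
have [J JK] := fl _ e2; have [J' JK'] := fl' _ e2.
exists (J `|` J')%fset => K; rewrite fsubUset => /andP[/JK h /JK' h'].
rewrite big_split /= opprD addrACA (le_lt_trans (rnormD _ _)) //.
by rewrite [ltRHS]splitr ltrD.
Qed.

Lemma has_sum0 : has_sum (fun _ => 0 : V) 0.
Proof. by move=> e e0; exists fset0 => K _; rewrite big1 // subrr rnorm0. Qed.

Lemma has_sum_sumr (T : Type) (r : seq T) (F : T -> I -> V) (L : T -> V) :
  (forall t, has_sum (F t) (L t)) ->
  has_sum (fun i => \sum_(t <- r) F t i) (\sum_(t <- r) L t).
Proof.
move=> FL; elim: r => [|t r IH].
  by rewrite big_nil (_ : (fun _ => _) = fun=> 0);
    [exact: has_sum0|apply/funext => i; rewrite big_nil].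
rewrite big_cons (_ : (fun _ => _) = fun i => F t i + \sum_(t <- r) F t i).
  exact: has_sumD.
by apply/funext => i; rewrite big_cons.
Qed.

Lemma eq_has_sum f f' l : f =1 f' -> has_sum f l -> has_sum f' l.
Proof. by move=> /funext ->. Qed.

End Normed.

Lemma has_sum_map (V W : normedModType R[i]) (phi : V -> W) (c : R)
    (f : I -> V) (l : V) :
  (forall u v, phi (u - v) = phi u - phi v) ->
  (forall v, rnorm (phi v) <= c * rnorm v) ->
  has_sum f l -> has_sum (phi \o f) (phi l).
Proof.
move=> phiB phic fl e e0.
have phi0 : phi 0 = 0 by rewrite -(subrr (0 : V)) phiB subrr.
have phiD u v : phi (u + v) = phi u + phi v.
  by rewrite -{1}(opprK v) phiB -[- v]add0r phiB phi0 add0r opprK.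
have c1 : 0 < `|c| + 1 by rewrite ltr_wpDl.
have [J JK] := fl (e / (`|c| + 1)) (divr_gt0 e0 c1); exists J => K /JK h.
rewrite -(big_morph phi phiD phi0) -phiB (le_lt_trans (phic _)) //.
move: h; rewrite ltr_pdivlMr // => /(le_lt_trans _); apply.
rewrite mulrC ler_wpM2l ?rnorm_ge0 // (le_trans (ler_norm c)) //.
by rewrite lerDl.
Qed.

Lemma has_sum_cauchy (V : completeNormedModType R[i]) (f : I -> V) :
  (forall e : R, 0 < e -> exists J : {fset I}, forall K : {fset I},
    (forall i, i \in K -> i \notin J) -> rnorm (\sum_(i <- K) f i) <= e) ->
  exists l, has_sum f l.
Proof.
move=> h; suff /cvg_has_sum : cvg (partial_sum f @ totally)%classic.
  by move=> ?; eexists; eassumption.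
apply: rnorm_cauchy => e e0; have e2 : 0 < e / 2 by rewrite divr_gt0.
have [J JK] := h _ e2; exists (\sum_(i <- J) f i); exists J => // K /= JK'.
rewrite /partial_sum -(big_seq_fsetE _ K xpredT f) /=.
have -> : K = (J `|` (K `\` J))%fset by rewrite fsetUDl fsetDv fsetD0;
  apply/esym/fsetUidPr.
rewrite fsum_disjU; last by move=> i; rewrite inE => /andP[].
rewrite opprD addrA subrr add0r rnormN (le_lt_trans (JK _ _)) //.
  by move=> i; rewrite inE => /andP[].
by rewrite ltr_pdivrMr // mulr_natr mulr2n ltrDl.
Qed.

End Summation.

Section Reindexing.
Variables (R : realType) (I I' : choiceType) (V : normedModType R[i]).
Variables (phi : I -> I') (f : I -> V) (f' : I' -> V).
Hypotheses (phiI : injective phi) (fE : forall i, f i = f' (phi i)).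
Hypothesis f'0 : forall j, f' j != 0 -> exists i, phi i = j.

Let inv (K : {fset I'}) : {fset I} := fset_set (phi @^-1` [set` K])%classic.

Let invE K i : (i \in inv K) = (phi i \in K).
Proof.
rewrite /inv in_fset_set; last first.
  by apply: finite_preimage => // ? ? _ _; exact: phiI.
by apply/idP/idP; rewrite inE.
Qed.

Let sum_inv K : \sum_(i <- inv K) f i = \sum_(j <- K) f' j.
Proof.
transitivity (\sum_(j <- [fset phi i | i in inv K]%fset) f' j).
  rewrite big_imfset /=; first by apply: eq_bigr => i _; rewrite fE.
  by move=> ? ? _ _; exact: phiI.
apply: big_fset_incl => [|j jK].
  by apply/fsubsetP => _ /imfsetP[i /= iK ->]; rewrite -invE.
apply: contraNeq => /f'0[i ij]; apply/imfsetP; exists i => //=.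
by rewrite invE ij.
Qed.

(** Indices outside the image of [phi] contribute 0 to every finite sum. This replaces the dependent
    type of factorizations of g by the groupoid itself. *)
Lemma has_sum_reindex l : has_sum f l <-> has_sum f' l.
Proof.
split=> h e /h[J JK].
  exists [fset phi i | i in J]%fset => K /fsubsetP PK.
  rewrite -sum_inv; apply: JK; apply/fsubsetP => i iJ.
  by rewrite invE PK // in_imfset.
exists (inv J) => K /fsubsetP IK.
rewrite (_ : \sum_(i <- K) f i =
  \sum_(j <- (J `|` [fset phi i | i in K])%fset) f' j).
  by apply: JK; exact: fsubsetUl.
rewrite -sum_inv; apply: congr_big => //; congr enum_fset.
apply/fsetP => i; rewrite invE inE; apply/idP/orP => [iK|[iJ|]].
- by right; rewrite in_imfset.
- by rewrite IK // invE.
- by move=> /imfsetP[k /= kK /phiI ->].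
Qed.

End Reindexing.

(** * Convolution as a sum over one factor *)

Section Convolution.
Variables (R : realType) (G : etaleGroupoid) (B : fellBundle R G).
Implicit Types (a b f : bsection B) (g h k x y : G) (J K F : {fset G}).

Definition sec_cut (P : pred G) a : bsection B :=
  fun g => if P g then a g else 0.

(** A factorization of g is determined by either factor: [cterm] is indexed by the right factor and
    [rterm] by the left one. The value 0 elsewhere makes the whole groupoid the index set. *)
Definition cterm a b g h : fibre B g :=
  if gsrc h == gsrc g then ml g (a (gmul g (ginv h))) (b h) else 0.

Definition rterm a b g k : fibre B g :=
  if grng k == grng g then ml g (a k) (b (gmul (ginv k) g)) else 0.

Lemma has_sum_cterm a b g l :
  has_sum (@convol_term R G B a b g) l <-> has_sum (cterm a b g) l.
Proof.
apply: (has_sum_reindex (phi := fun p : factorizations g => (val p).2)).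
- move=> [[k h] kP] [[k' h'] kP'] /= hh.
  have [/= kh khg] := set_mem kP; have [/= kh' khg'] := set_mem kP'.
  subst h'; apply/val_inj => /=; congr pair.
  by rewrite -(mult_divr (conj kh khg)).2 -(mult_divr (conj kh' khg')).2.
- move=> [[k h] kP]; have [/= kh khg] := set_mem kP;
  rewrite /convol_term /cterm /=.
  by rewrite (mult_src (conj kh khg)) eqxx (mult_divr (conj kh khg)).2.
- move=> h; rewrite /cterm; case: (gsrc h =P gsrc g) => [hg _|_ /eqP//].
  have [gh ghg] := mult_exl hg.
  have gP : (gmul g (ginv h), h) \in factorizations g by rewrite inE.
  by exists (SigSub gP).
Qed.

Lemma has_sum_rterm a b g l :
  has_sum (@convol_term R G B a b g) l <-> has_sum (rterm a b g) l.
Proof.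
apply: (has_sum_reindex (phi := fun p : factorizations g => (val p).1)).
- move=> [[k h] kP] [[k' h'] kP'] /= hh.
  have [/= kh khg] := set_mem kP; have [/= kh' khg'] := set_mem kP'.
  subst k'; apply/val_inj => /=; congr pair.
  by rewrite -(mult_divl (conj kh khg)).2 -(mult_divl (conj kh' khg')).2.
- move=> [[k h] kP]; have [/= kh khg] := set_mem kP;
  rewrite /convol_term /rterm /=.
  by rewrite (mult_rng (conj kh khg)) eqxx (mult_divl (conj kh khg)).2.
- move=> k; rewrite /rterm; case: (grng k =P grng g) => [kg _|_ /eqP//].
  have [gh ghg] := mult_exr kg.
  have gP : (k, gmul (ginv k) g) \in factorizations g by rewrite inE.
  by exists (SigSub gP).
Qed.

(** Definedness of the convolution at a single point; bounds are often available on one source fibre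
    only. *)
Definition convol_at a b g := has_sum (cterm a b g) (convol a b g).

Lemma convolE a b g l : has_sum (cterm a b g) l -> convol a b g = l.
Proof. by move=> /has_sum_cterm /has_sum_sum. Qed.

Lemma convol_atI a b g l : has_sum (cterm a b g) l -> convol_at a b g.
Proof. by move=> h; rewrite /convol_at (convolE h). Qed.

Lemma convol_atP a b g :
  cvg (partial_sum (@convol_term R G B a b g) @ totally) <-> convol_at a b g.
Proof.
split=> [/cvg_has_sum/has_sum_cterm//|/has_sum_cterm]; exact: has_sum_cvg.
Qed.

Lemma convol_definedP a b : convol_defined a b <-> forall g, convol_at a b g.
Proof. by split=> h g; apply/convol_atP; exact: h. Qed.

Lemma convol_at_rterm a b g : convol_at a b g ->
  has_sum (rterm a b g) (convol a b g).
Proof. by move=> /has_sum_cterm/has_sum_rterm. Qed.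

Lemma cterm_mult a b g h : gsrc h = gsrc g ->
  cterm a b g h = ml g (a (gmul g (ginv h))) (b h).
Proof. by move=> hg; rewrite /cterm hg eqxx. Qed.

Lemma ctermDl a a' b g h : cterm (s_add a a') b g h =
  cterm a b g h + cterm a' b g h.
Proof.
rewrite /cterm; case: eqP => [hg|]; last by rewrite addr0.
exact: (mlDl (mult_exl hg)).
Qed.

Lemma ctermDr a b b' g h : cterm a (s_add b b') g h =
  cterm a b g h + cterm a b' g h.
Proof.
rewrite /cterm; case: eqP => [hg|]; last by rewrite addr0.
exact: (mlDr (mult_exl hg)).
Qed.

Lemma ctermZl (t : R[i]) a b g h : cterm (s_scale t a) b g h =
  t *: cterm a b g h.
Proof.
rewrite /cterm; case: eqP => [hg|]; last by rewrite scaler0.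
exact: (mlZl (mult_exl hg)).
Qed.

Lemma ctermZr (t : R[i]) a b g h : cterm a (s_scale t b) g h =
  t *: cterm a b g h.
Proof.
rewrite /cterm; case: eqP => [hg|]; last by rewrite scaler0.
exact: (mlZr (mult_exl hg)).
Qed.

Lemma has_sumZ (I : choiceType) (V : normedModType R[i]) (t : R[i]) (f : I ->
  V) l :
  has_sum f l -> has_sum (fun i => t *: f i) (t *: l).
Proof.
apply: (has_sum_map (phi := fun v => t *: v)) => [u v|v]; first exact: scalerBr.
by rewrite rnormZ.
Qed.

Lemma convol_atDl a a' b g : convol_at a b g -> convol_at a' b g ->
  convol_at (s_add a a') b g /\ convol (s_add a a') b g =
    convol a b g + convol a' b g.
Proof.
move=> h h'; have H := has_sumD h h'.
have {}H : has_sum (cterm (s_add a a') b g) (convol a b g + convol a' b g).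
  by apply: eq_has_sum H => k; rewrite ctermDl.
by split; [exact: convol_atI H|exact: convolE].
Qed.

Lemma convol_atDr a b b' g : convol_at a b g -> convol_at a b' g ->
  convol_at a (s_add b b') g /\ convol a (s_add b b') g =
    convol a b g + convol a b' g.
Proof.
move=> h h'; have H := has_sumD h h'.
have {}H : has_sum (cterm a (s_add b b') g) (convol a b g + convol a b' g).
  by apply: eq_has_sum H => k; rewrite ctermDr.
by split; [exact: convol_atI H|exact: convolE].
Qed.

Lemma convol_atZl (t : R[i]) a b g : convol_at a b g ->
  convol_at (s_scale t a) b g /\ convol (s_scale t a) b g = t *: convol a b g.
Proof.
move=> h; have H := has_sumZ t h.
have {}H : has_sum (cterm (s_scale t a) b g) (t *: convol a b g).
  by apply: eq_has_sum H => k; rewrite ctermZl.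
by split; [exact: convol_atI H|exact: convolE].
Qed.

Lemma convol_atZr (t : R[i]) a b g : convol_at a b g ->
  convol_at a (s_scale t b) g /\ convol a (s_scale t b) g = t *: convol a b g.
Proof.
move=> h; have H := has_sumZ t h.
have {}H : has_sum (cterm a (s_scale t b) g) (t *: convol a b g).
  by apply: eq_has_sum H => k; rewrite ctermZr.
by split; [exact: convol_atI H|exact: convolE].
Qed.

Lemma s_subE a b : s_sub a b = s_add a (s_scale (-1) b).
Proof. by apply: functional_extensionality_dep => g;
  rewrite /s_sub /s_add /s_scale scaleN1r. Qed.

Lemma convol_atBl a a' b g : convol_at a b g -> convol_at a' b g ->
  convol_at (s_sub a a') b g /\ convol (s_sub a a') b g =
    convol a b g - convol a' b g.
Proof.
move=> h /(convol_atZl (-1))[h' e]; rewrite s_subE.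
by have := convol_atDl h h'; rewrite e scaleN1r.
Qed.

Lemma convol_atBr a b b' g : convol_at a b g -> convol_at a b' g ->
  convol_at a (s_sub b b') g /\ convol a (s_sub b b') g =
    convol a b g - convol a b' g.
Proof.
move=> h /(convol_atZr (-1))[h' e]; rewrite s_subE.
by have := convol_atDr h h'; rewrite e scaleN1r.
Qed.

Lemma eq_convol_at a b b' g : (forall h, gsrc h = gsrc g -> b h = b' h) ->
  convol_at a b g -> convol_at a b' g /\ convol a b' g = convol a b g.
Proof.
move=> bb H; have {}H : has_sum (cterm a b' g) (convol a b g).
  by apply: eq_has_sum H => h; rewrite /cterm; case: eqP => // /bb ->.
by split; [exact: convol_atI H|exact: convolE].
Qed.

Definition fin_supp f J := forall g, g \notin J -> f g = 0.

Lemma has_sum_fin_supp a f J g : (forall h, gsrc h = gsrc g -> h \notin J ->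
  f h = 0) ->
  has_sum (cterm a f g) (\sum_(h <- J) cterm a f g h).
Proof.
move=> fJ; apply: has_sum_fin => h hJ; rewrite /cterm; case: eqP => // hg.
by rewrite fJ // (ml0r (mult_exl hg)).
Qed.

Lemma convol_fin a f J g : (forall h, gsrc h = gsrc g -> h \notin J ->
  f h = 0) ->
  convol_at a f g /\ convol a f g = \sum_(h <- J) cterm a f g h.
Proof.
by move=> /(@has_sum_fin_supp a) H; split; [exact: convol_atI H|exact: convolE].
Qed.

Lemma finsupp_sectionP f : finsupp_section f <-> exists J, fin_supp f J.
Proof.
split=> [fin|[J fJ]].
  exists (fset_set (supp f)) => g; rewrite in_fset_set // notin_setE /supp /=.
  by move=> /negP; rewrite negbK => /eqP.
apply: (sub_finite_set (B := [set` J])); last exact: finite_fset.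
by move=> g; rewrite /supp /=; apply: contraNT => /fJ ->.
Qed.

Lemma fin_supp_sec_cut J a : fin_supp (sec_cut (mem J) a) J.
Proof. by move=> g gJ; rewrite /sec_cut /= (negbTE gJ). Qed.

(* Associativity, when the right-hand factor has finite support: it is the
   sum over [k] in [a(k) (b f)(k^-1 g)] that converges. *)
Lemma convolA_fin a b f : convol_defined a b -> finsupp_section f ->
  convol (convol a b) f = convol a (convol b f).
Proof.
move=> /convol_definedP ab /finsupp_sectionP[J fJ].
apply: functional_extensionality_dep => g; apply/esym.
have fJ' : forall h g', gsrc h = gsrc g' -> h \notin J -> f h = 0.
  by move=> h g' _; exact: fJ.
have [_ ->] := convol_fin (convol a b) (fun h => @fJ' h g).
apply/has_sum_sum/has_sum_rterm.
have -> : rterm a (convol b f) g =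
    (fun k => \sum_(h <- J) if gsrc h == gsrc g then
       ml g (rterm a b (gmul g (ginv h)) k) (f h) else 0).
  apply/funext => k; rewrite /rterm; case: eqP => [kg|kg]; last first.
    rewrite big1 // => h _; case: eqP => // hg; case: eqP => [kgh|_].
      by case: kg; rewrite kgh (mult_rng (mult_divr (mult_exl hg))) //.
    by rewrite (ml0l (mult_exl hg)).
  have kg' := mult_exr kg.
  have [_ ->] := convol_fin b (fun h => @fJ' h (gmul (ginv k) g)).
  rewrite (ml_sumr kg'); apply: eq_bigr => h _.
  rewrite /cterm (mult_src (mult_divl kg')); case: eqP => [hg|_]; last first.
    by rewrite (ml0r kg').
  have gh := mult_exl hg; have ghr := mult_rng (mult_divr gh).
  rewrite ghr kg eqxx; have kn := mult_exr (etrans kg (esym ghr)).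
  have nh := mult_assocV gh (mult_divl kg') (mult_divl kn).
  by rewrite (mult_divr nh).2 (mlA _ _ _ kn gh nh).
apply: has_sum_sumr => h; rewrite /cterm; case: eqP => [hg|_];
  last exact: has_sum0.
have gh := mult_exl hg.
apply: (has_sum_map (phi := fun v => ml g v (f h)) (c := rnorm (f h))).
- by move=> u v; exact: mlBl.
- by move=> v; rewrite mulrC; exact: ml_norm.
- exact: convol_at_rterm.
Qed.

End Convolution.

(** * The Hilbert module and its bounded operators *)

Lemma fsum_filter (I : choiceType) (V : zmodType) (P : pred I) (F : {fset I}) (f
  : I -> V) :
  \sum_(i <- [fset i in F | P i]%fset) f i = \sum_(i <- F | P i) f i.
Proof.
have sub : ([fset i in F | P i] `<=` F)%fset by apply/fsubsetP => i;
  rewrite !inE => /andP[].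
rewrite [RHS]big_mkcond -(big_fset_incl _ sub) => [|i iF].
  by apply: eq_big_seq => i; rewrite !inE => /andP[_ ->].
by rewrite !inE iF /= => /negbTE ->.
Qed.

Lemma sqr_le_add_eps (R : realType) (s c : R) : 0 <= c ->
  (forall e, 0 < e -> s <= (c + e) ^+ 2) -> s <= c ^+ 2.
Proof.
move=> c0 h; have [s0|/ltW s0] := leP 0 s;
  last by rewrite (le_trans s0) ?sqr_ge0.
rewrite -(sqr_sqrtr s0) ler_pXn2r ?nnegrE ?sqrtr_ge0 //.
apply/ler_addgt0Pr => e e0; have := h e e0.
by rewrite -{1}(sqr_sqrtr s0) ler_pXn2r ?nnegrE ?sqrtr_ge0 // addr_ge0 // ltW.
Qed.

Section L2.
Variables (R : realType) (G : etaleGroupoid) (B : fellBundle R G).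
Implicit Types (a b f : bsection B) (g h k x y : G) (J K F : {fset G}) (c d :
  R).

(* the l^2-norm of the restriction of [a] to [Gamma x] is at most [c] *)
Definition l2_le x a c := forall F,
  rnorm (\sum_(g <- F | gsrc g == x) sq x (a g)) <= c ^+ 2.

Lemma l2_leP x a c : l2_le x a c <->
  forall F, (forall g, g \in F -> gsrc g = x) ->
    rnorm (\sum_(g <- F) sq x (a g)) <= c ^+ 2.
Proof.
split=> h F; last first.
  by rewrite -fsum_filter; apply: h => g; rewrite !inE => /andP[_ /eqP].
move=> Fx; rewrite (_ : \sum_(g <- F) _ =
  \sum_(g <- F | gsrc g == x) sq x (a g)) //.
by rewrite [RHS]big_seq_cond big_seq; apply: eq_bigl => g;
  case: (boolP (g \in F)) => //= /Fx ->; rewrite eqxx.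
Qed.

Lemma eq_l2_le x a b c : (forall g, gsrc g = x -> a g = b g) ->
  l2_le x a c -> l2_le x b c.
Proof.
move=> ab h F; rewrite (eq_bigr (fun g => sq x (a g))) // => g /eqP gx.
by rewrite ab.
Qed.

Lemma l2_le_mono x a c c' : 0 <= c -> c <= c' -> l2_le x a c -> l2_le x a c'.
Proof.
move=> c0 cc h F; rewrite (le_trans (h F)) // ler_pXn2r // nnegrE //.
exact: le_trans cc.
Qed.

Lemma l2_le_eps x a c : 0 <= c -> (forall e, 0 < e -> l2_le x a (c + e)) ->
  l2_le x a c.
Proof. by move=> c0 h F; apply: sqr_le_add_eps => // e /h. Qed.

Lemma l2_le_pt x a c g : 0 <= c -> l2_le x a c -> gsrc g = x ->
  rnorm (a g) <= c.
Proof.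
move=> c0 h gx; have := h [fset g]%fset.
rewrite big_mkcond big_seq_fset1 gx eqxx rnorm_sq //.
by rewrite ler_pXn2r ?nnegrE ?rnorm_ge0.
Qed.

Lemma sec_cut_fsum x a (P : pred G) F :
  \sum_(g <- F | gsrc g == x) sq x (sec_cut P a g) =
  \sum_(g <- [fset g in F | P g]%fset | gsrc g == x) sq x (a g).
Proof.
rewrite -[RHS]fsum_filter.
have sub : ([fset g in [fset g in F | P g] | gsrc g == x] `<=` [fset g in F |
  gsrc g == x])%fset.
  by apply/fsubsetP => i; rewrite !inE => /andP[/andP[-> _] ->].
rewrite -[LHS]fsum_filter -(big_fset_incl _ sub).
  by apply: eq_big_seq => g; rewrite !inE /sec_cut => /andP[/andP[_ ->]].
move=> g; rewrite !inE => /andP[-> /= /eqP gx];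
  rewrite gx eqxx andbT /sec_cut => /negbTE ->.
by rewrite /sq /ip ml0r // -gx; exact: multVg.
Qed.

Lemma l2_le_cut x a c (P : pred G) : l2_le x a c -> l2_le x (sec_cut P a) c.
Proof. by move=> h F; rewrite sec_cut_fsum. Qed.

Lemma ip_fsum_le x a b c d F : units G x -> 0 <= c -> 0 <= d ->
  l2_le x a c -> l2_le x b d ->
  rnorm (\sum_(g <- F | gsrc g == x) ip x (a g) (b g)) <= c * d.
Proof.
move=> xu c0 d0 ac bd.
rewrite -(ler_pXn2r (n:=2)) ?nnegrE ?mulr_ge0 ?rnorm_ge0 //.
apply: (le_trans (ip_sum_sqr_le F (P := fun g => gsrc g == x) (al := id)
  (be := id) (k := x) (x := x) (y := x) (fun g => a g) (fun g => b g) _ _ _)).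
- by move=> g /eqP <-; exact: mult_srcr.
- exact: units_src.
- exact: units_rng.
- by rewrite exprMn ler_pM ?rnorm_ge0.
Qed.

(** Minkowski's inequality: the square is expanded and [ip_fsum_le] bounds the cross terms. *)
Lemma l2_leD x a b c d : units G x -> 0 <= c -> 0 <= d ->
  l2_le x a c -> l2_le x b d -> l2_le x (s_add a b) (c + d).
Proof.
move=> xu c0 d0 ac bd F.
have -> : \sum_(g <- F | gsrc g == x) sq x (s_add a b g) =
    \sum_(g <- F | gsrc g == x) sq x (a g) + \sum_(g <- F | gsrc g == x) ip x (a
      g) (b g) +
    (\sum_(g <- F | gsrc g == x) ip x (b g) (a g) + \sum_(g <- F | gsrc g == x)
      sq x (b g)).
  rewrite -!big_split /=; apply: eq_bigr => g /eqP <-.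
  by rewrite /sq /ip /s_add fstarD (mlDl (multVg g)) !(mlDr (multVg g)).
apply: (le_trans (rnormD _ _)).
have h1 := rnormD (\sum_(g <- F | gsrc g == x) sq x (a g)) (\sum_(g <- F | gsrc
  g == x) ip x (a g) (b g)).
have h2 := rnormD (\sum_(g <- F | gsrc g == x) ip x (b g) (a g)) (\sum_(g <- F |
  gsrc g == x) sq x (b g)).
have h3 := ip_fsum_le F xu c0 d0 ac bd; have h4 := ip_fsum_le F xu d0 c0 bd ac.
have := ac F; have := bd F; move: h1 h2 h3 h4; lra.
Qed.

Lemma l2_leZ x a c (t : R[i]) : l2_le x a c ->
  l2_le x (s_scale t a) (complex.Re `|t| * c).
Proof.
move=> h F; rewrite (eq_bigr (fun g => (t^* * t) *: sq x (a g))); last first.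
  move=> g /eqP <-; rewrite /sq /ip /s_scale fstarZ (mlZl (multVg g)).
  by rewrite (mlZr (multVg g)) scalerA.
rewrite -scaler_sumr rnormZ normrM norm_conjC -expr2 exprMn.
have -> : complex.Re (`|t| ^+ 2) = (complex.Re `|t|) ^+ 2.
  by rewrite normc_def !expr2 /= mulr0 subr0.
by rewrite ler_wpM2l // sqr_ge0.
Qed.

Lemma l2_leB x a b c d : units G x -> 0 <= c -> 0 <= d ->
  l2_le x a c -> l2_le x b d -> l2_le x (s_sub a b) (c + d).
Proof.
move=> xu c0 d0 ac /(l2_leZ (-1)) bd; rewrite s_subE; apply: l2_leD => //.
by move: bd; rewrite normrN1 mul1r.
Qed.

(** At most n terms of norm c^2 each, and n c^2 <= (n c)^2. *)
Lemma l2_le_fin x a c J : units G x -> 0 <= c ->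
  (forall g, g \in J -> gsrc g = x -> rnorm (a g) <= c) ->
  l2_le x (sec_cut (mem J) a) (#|` J|%:R * c).
Proof.
move=> xu c0 ac F; rewrite sec_cut_fsum.
rewrite (le_trans (ler_rnorm_sum _ _ _)) //.
have -> : \sum_(g <- [fset g in F | mem J g]%fset | gsrc g == x) rnorm (sq x (a
  g)) =
    \sum_(g <- [fset g in F | mem J g]%fset | gsrc g == x) rnorm (a g) ^+ 2.
  by apply: eq_bigr => g /eqP gx; rewrite rnorm_sq.
have sub : ([fset g in [fset g in F | mem J g] | gsrc g == x] `<=` J)%fset.
  by apply/fsubsetP => g; rewrite !inE => /andP[/andP[]].
rewrite -fsum_filter; set K := [fset g in _ | _]%fset in sub *.
apply: (@le_trans _ _ (\sum_(g <- K) c ^+ 2)).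
  rewrite big_seq [leRHS]big_seq; apply: ler_sum => g.
  rewrite !inE => /andP[/andP[_ gJ] /eqP gx].
  by rewrite ler_pXn2r ?nnegrE ?rnorm_ge0 // ac.
rewrite big_const_seq count_predT iter_addr addr0 exprMn -[leLHS]mulr_natl.
rewrite ler_wpM2r ?sqr_ge0 // -natrX ler_nat.
rewrite (leq_trans (fsubset_leq_card sub)) // -mulnn.
by case: #|` J| => // n; rewrite leq_pmulr.
Qed.

(** A Fatou property: a bound is tested on one finite set at a time, so approximants that are close
    at its points are enough. The tolerance e / (n + 1), with n the size of F, makes the difference
    on F at most e in the l^2-norm. *)
Lemma l2_le_lim x a c : units G x -> 0 <= c ->
  (forall F (e : R), 0 < e -> exists2 b, l2_le x b c &
     forall g, g \in F -> gsrc g = x -> rnorm (a g - b g) <= e) ->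
  l2_le x a c.
Proof.
move=> xu c0 h F; apply: sqr_le_add_eps => // e e0.
have n0 : 0 < #|` F|%:R + 1 :> R by rewrite ltr_wpDl.
have [b bc ab] := h F (e / (#|` F|%:R + 1)) (divr_gt0 e0 n0).
have abF : forall g, g \in F -> gsrc g = x ->
   rnorm (s_sub a b g) <= e / (#|` F|%:R + 1) by [].
have := l2_le_fin xu (ltW (divr_gt0 e0 n0)) abF.
have le : #|` F|%:R * (e / (#|` F|%:R + 1)) <= e.
  by rewrite mulrCA -[leRHS]mulr1 ler_pM2l // ler_pdivrMr // mul1r lerDl.
have ge : 0 <= #|` F|%:R * (e / (#|` F|%:R + 1)).
  by rewrite mulr_ge0 // divr_ge0 // ltW.
move=> /(l2_le_mono ge le) /(l2_leD xu c0 (ltW e0) bc) /(_ F).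
rewrite big_seq_cond [X in _ -> rnorm X <= _]big_seq_cond.
rewrite (eq_bigr (fun g => sq x (a g))) // => g /andP[gF _].
by rewrite /s_add /sec_cut /= gF /s_sub addrC subrK.
Qed.

(** Here positivity enters: the omitted terms add up to a positive element. *)
Lemma l2_le_sub x a c F K : units G x -> (F `<=` K)%fset ->
  rnorm (\sum_(g <- F | gsrc g == x) sq x (a g)) <=
  rnorm (\sum_(g <- K | gsrc g == x) sq x (a g)).
Proof.
move=> xu FK; have -> : K = (F `|` (K `\` F))%fset.
  by rewrite fsetUDl fsetDv fsetD0; apply/esym/fsetUidPr.
rewrite ![\sum_(g <- _ | gsrc g == x) _]big_mkcond fsum_disjU; last first.
  by move=> g; rewrite inE => /andP[].
have P (r : {fset G}) :
    posf (\sum_(g <- r) if gsrc g == x then sq x (a g) else 0).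
  by apply: (posf_sum xu) => g _; case: eqP => [gx|_];
    [exact: posf_sq|exact: posf0].
exact: (rnorm_posfD xu (P _) (P _)).
Qed.

(** On the source fibre of x, the section is an l^2-limit of its finite truncations. *)
Definition l2_tail x a := forall e : R, 0 < e ->
  exists J, l2_le x (sec_cut (predC (mem J)) a) e.

Lemma l2_tail_fin x a J : (forall g, gsrc g = x -> g \notin J -> a g = 0) ->
  l2_tail x a.
Proof.
move=> aJ e e0; exists J => F; rewrite big1 ?rnorm0 ?sqr_ge0 // => g /eqP gx.
rewrite /sec_cut /=; case: (boolP (g \in J)) => /= [_|/aJ ->//];
  rewrite /sq /ip ml0r //.
all: by rewrite -gx; exact: multVg.
Qed.

End L2.

Section HilbertModule.
Variables (R : realType) (G : etaleGroupoid) (B : fellBundle R G).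
Implicit Types (a b f : bsection B) (g h k x y : G) (J K F : {fset G}) (c d :
  R).

Lemma inc_section a g h : g = h -> inc (a g) = inc (a h).
Proof. by move=> ->. Qed.

Lemma inc_s_star a g : inc (s_star a g) = inc (fstar (a (ginv g))).
Proof. by apply: inc_tr; rewrite ginvK. Qed.

Lemma s_starV a g : s_star a (ginv g) = fstar (a g).
Proof.
apply: Defs.inc_inj; rewrite inc_s_star; apply: inc_fstar.
by apply: inc_section; rewrite ginvK.
Qed.

Lemma s_starD a b : s_star (s_add a b) = s_add (s_star a) (s_star b).
Proof.
apply: functional_extensionality_dep => g; rewrite /s_add /s_star.
by rewrite -!/(tr _ _) fstarD trD // ginvK.
Qed.

Lemma s_starZ (t : R[i]) a : s_star (s_scale t a) = s_scale t^* (s_star a).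
Proof.
apply: functional_extensionality_dep => g; rewrite /s_scale /s_star.
by rewrite -!/(tr _ _) fstarZ trZ // ginvK.
Qed.

Lemma s_starB a b : s_star (s_sub a b) = s_sub (s_star a) (s_star b).
Proof. by rewrite !s_subE s_starD s_starZ conjN1. Qed.

Lemma mult_quotV g h : gsrc h = gsrc g ->
  ginv (gmul h (ginv g)) = gmul g (ginv h).
Proof.
move=> hg; have m := mult_divr (mult_exl (esym hg)).
by have := multV m; rewrite ginvK => -[_ <-].
Qed.

Lemma cterm_star a b g h : gsrc h = gsrc g ->
  cterm (s_star a) b g h = ip g (a (gmul h (ginv g))) (b h).
Proof.
by move=> hg; rewrite cterm_mult // -(mult_quotV hg) s_starV.
Qed.

(** In the sum of a(h g^{-1})^* b(h), the element h g^{-1} runs injectively through the source fibre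
    of r(g); that is where a bound on [a] is required. *)
Lemma star_fsum_le g a b c d F : 0 <= c -> 0 <= d ->
  l2_le (grng g) a c -> l2_le (gsrc g) b d ->
  rnorm (\sum_(h <- F) cterm (s_star a) b g h) <= c * d.
Proof.
move=> c0 d0 ac bd.
have -> : \sum_(h <- F) cterm (s_star a) b g h =
    \sum_(h <- F | gsrc h == gsrc g) ip g (a (gmul h (ginv g))) (b h).
  rewrite [RHS]big_mkcond; apply: eq_bigr => h _.
  by case: eqP => hg; [exact: cterm_star|rewrite /cterm; case: eqP].
rewrite -(ler_pXn2r (n:=2)) ?nnegrE ?mulr_ge0 ?rnorm_ge0 //.
apply: (le_trans (ip_sum_sqr_le F (P := fun h => gsrc h == gsrc g)
  (al := fun h => gmul h (ginv g)) (be := id) (k := g) (x := gsrc g) (y :=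
    grng g)
  (fun h => a (gmul h (ginv g))) (fun h => b h) _ (erefl _) (erefl _))).
  by move=> h /eqP hg; exact: mult_exl.
rewrite exprMn ler_pM ?rnorm_ge0 //.
have -> : \sum_(h <- F | gsrc h == gsrc g) sq (grng g) (a (gmul h (ginv g))) =
    \sum_(h <- [fset gmul h (ginv g) | h in F & gsrc h == gsrc g]%fset) sq (grng
      g) (a h).
  rewrite big_imfset /= ?big_filter // => h h'.
  move=> /andP[_ /eqP hg] /andP[_ /eqP hg'] /= e.
    by rewrite -(mult_exl (esym hg)).2 e (mult_exl (esym hg')).2.
move/l2_leP : ac; apply=> h /imfsetP[h' /=].
rewrite !inE => /andP[_ /eqP hg] ->.
by rewrite (mult_mid (mult_exl (esym hg))).
Qed.

(** A partial sum that avoids J involves only the tail of b, so [star_fsum_le] yields the Cauchy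
    criterion. *)
Lemma star_convol_at g a b c : 0 <= c ->
  l2_le (grng g) a c -> l2_tail (gsrc g) b -> convol_at (s_star a) b g.
Proof.
move=> c0 ac bt; have [|l] := has_sum_cauchy (f := cterm (s_star a) b g).
  move=> e e0; have c1 : 0 < c + 1 by rewrite ltr_wpDl.
  have [J bJ] := bt _ (divr_gt0 e0 c1); exists J => K KJ.
  rewrite (eq_big_seq (cterm (s_star a) (sec_cut (predC (mem J)) b) g));
    last first.
    by move=> h /KJ /= hJ; rewrite /cterm /sec_cut /= hJ.
  rewrite (le_trans (star_fsum_le _ c0 (ltW (divr_gt0 e0 c1)) ac bJ)) //.
  by rewrite mulrA ler_pdivrMr // mulrC ler_pM2l // lerDl.
exact: convol_atI.
Qed.

Lemma star_convol_le g a b c d : 0 <= c -> 0 <= d ->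
  l2_le (grng g) a c -> l2_le (gsrc g) b d -> convol_at (s_star a) b g ->
  rnorm (convol (s_star a) b g) <= c * d.
Proof. by move=> c0 d0 ac bd /has_sum_le; apply=> K; exact: star_fsum_le. Qed.

Section Unit.
Variables (x : G) (xu : units G x).

Lemma cterm_star_unit a b h :
  cterm (s_star a) b x h = if gsrc h == x then ip x (a h) (b h) else 0.
Proof.
case: eqP => [hx|]; last by rewrite /cterm (units_src xu); case: eqP.
rewrite cterm_star ?(units_src xu) //.
suff -> : gmul h (ginv x) = h by [].
by rewrite (units_inv xu) -hx (mult_srcr h).2.
Qed.

Lemma star_fsum_unit a b F : \sum_(h <- F) cterm (s_star a) b x h =
  \sum_(h <- F | gsrc h == x) ip x (a h) (b h).
Proof. by rewrite [RHS]big_mkcond; apply: eq_bigr => h _;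
  rewrite cterm_star_unit. Qed.

(** The sum over F is dominated by the sum over the union of J and F, which is close to the
    limit. *)
Lemma l2_le_convol a : convol_at (s_star a) a x ->
  l2_le x a (Num.sqrt (rnorm (convol (s_star a) a x))).
Proof.
move=> aa F; rewrite sqr_sqrtr ?rnorm_ge0 //; apply/ler_addgt0Pr => e e0.
have [J JK] := aa e e0; have := JK _ (fsubsetUl J F).
rewrite star_fsum_unit; set s := \sum_(h <- _ | _) _ => h.
have hF : rnorm (\sum_(h <- F | gsrc h == x) sq x (a h)) <= rnorm s.
  by apply: l2_le_sub => //; exact: fsubsetUr.
rewrite (le_trans hF) //; rewrite rdistC in h.
by rewrite -{1}(subrK (convol (s_star a) a x) s) (le_trans (rnormD _ _)) //
  addrC lerD // ltW.
Qed.

Lemma l2_tail_convol a : convol_at (s_star a) a x -> l2_tail x a.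
Proof.
move=> aa e e0; have [J JK] := has_sum_tail aa (exprn_gt0 2 e0).
exists J => F; rewrite sec_cut_fsum -fsum_filter.
set K := [fset g in _ | _]%fset.
have KJ g : g \in K -> g \notin J by rewrite !inE => /andP[/andP[_]].
have := JK K KJ; rewrite star_fsum_unit big_mkcond.
rewrite (eq_big_seq (fun h => sq x (a h))) // => h.
by rewrite !inE => /andP[_ ->].
Qed.

End Unit.

Lemma norm2_le a c : 0 <= c ->
  (norm2 a <= c%:E)%E <-> forall x, units G x -> l2_le x a c.
Proof.
move=> c0; rewrite /norm2 /nnsup ge_max lee_fin c0 /=; split.
  move=> /ereal_supP h x xu; apply/l2_leP => F Fx.
  have := h _ (ex_intro _ x (ex_intro _ F (And3 xu Fx erefl))).
  rewrite lee_fin => le; rewrite -[leLHS]sqr_sqrtr ?rnorm_ge0 //.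
  by rewrite ler_pXn2r ?nnegrE ?sqrtr_ge0.
move=> h; apply/ereal_supP => _ [x [F [xu Fx ->]]].
rewrite lee_fin -(ler_pXn2r (n:=2)) ?nnegrE ?sqrtr_ge0 // sqr_sqrtr ?rnorm_ge0
  //.
by have /l2_leP := h x xu; apply.
Qed.

Definition l2_bounded a := exists2 c, 0 <= c & forall x, units G x ->
  l2_le x a c.

Lemma norm2_ge0 a : (0 <= norm2 a)%E.
Proof. by rewrite /norm2 /nnsup le_max lexx. Qed.

Lemma norm2_fin a : (norm2 a < +oo)%E <-> l2_bounded a.
Proof.
split=> [|[c c0 /norm2_le h]]; last by rewrite (le_lt_trans (h c0)) // ltry.
move=> an; have fn : norm2 a \is a fin_num by rewrite ge0_fin_numE ?norm2_ge0.
exists (fine (norm2 a)); first by rewrite fine_ge0 ?norm2_ge0.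
by apply/norm2_le; rewrite ?fine_ge0 ?norm2_ge0 ?fineK.
Qed.

(** Convergence of a^* a at the units already makes the tails small, and small tails give
    convergence at every point. *)
Lemma HilbP a : Hilb B a <-> l2_bounded a /\ forall x, units G x -> l2_tail x a.
Proof.
split=> [[/norm2_fin ab /convol_definedP aa]|[ab at_]].
  by split=> // x xu; apply: l2_tail_convol.
split; first exact/norm2_fin.
apply/convol_definedP => g; have [c c0 ac] := ab.
apply: (star_convol_at c0); first by apply: ac; exact: units_grng.
by apply: at_; exact: units_gsrc.
Qed.

Lemma inner_unit a b x : units G x -> inner a b x = convol (s_star a) b x.
Proof. by move=> xu; rewrite /inner /restr_units; case: asboolP. Qed.

Lemma inner_not_unit a b x : ~ units G x -> inner a b x = 0.
Proof. by move=> xu; rewrite /inner /restr_units; case: asboolP. Qed.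

Lemma Hilb_convol_at a b x : Hilb B a -> Hilb B b -> units G x ->
  convol_at (s_star a) b x.
Proof.
move=> /HilbP[[c c0 ac] _] /HilbP[_ bt] xu; apply: (star_convol_at c0).
  by apply: ac; rewrite units_rng.
by apply: bt; rewrite units_src.
Qed.

(** At a unit the finite sums are dominated by their limit, and the limit obeys every bound that
    they obey. On [Hilb] the module norm thus has the same real bounds as [norm2]. *)
Lemma normH_le a c : 0 <= c -> Hilb B a ->
  (normH a <= c%:E)%E <-> forall x, units G x -> l2_le x a c.
Proof.
move=> c0 aH.
have -> : (normH a <= c%:E)%E = (normD (inner a a) <= (c ^+ 2)%:E)%E.
  have cE : c%:E = sqrte ((c ^+ 2)%:E) by rewrite /= sqrtr_sqr ger0_norm.
  by rewrite {1}cE lee_sqrt // lee_fin sqr_ge0.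
rewrite /normD /nnsup ge_max lee_fin sqr_ge0 /=; split.
  move=> /ereal_supP h x xu.
  have := h _ (ex_intro2 _ _ x I erefl); rewrite lee_fin inner_unit // => hx.
  apply: l2_le_mono (l2_le_convol xu (Hilb_convol_at aH aH xu)).
    exact: sqrtr_ge0.
  by rewrite -(ler_pXn2r (n:=2)) ?nnegrE ?sqrtr_ge0 // sqr_sqrtr ?rnorm_ge0.
move=> h; apply/ereal_supP => _ [x _ <-]; rewrite lee_fin.
have [xu|xu] := pselect (units G x); last first.
  by rewrite inner_not_unit // rnorm0 sqr_ge0.
rewrite inner_unit // expr2; apply: star_convol_le => //;
  last exact: Hilb_convol_at.
  by rewrite units_rng //; exact: h.
by rewrite units_src //; exact: h.
Qed.

End HilbertModule.

(** * Bounds for convolution on finitely supported sections *)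

Section OperatorBound.
Variables (R : realType) (G : etaleGroupoid) (B : fellBundle R G).
Implicit Types (a b f : bsection B) (g h k x y : G) (J K F : {fset G}) (c d :
  R).

(** The bound normb a <= c, tested fibre by fibre: left convolution acts on each source fibre
    separately. *)
Definition op_le a c := 0 <= c /\ forall x, units G x -> forall f,
  finsupp_section f -> forall d, 0 <= d -> l2_le x f d ->
    l2_le x (convol a f) (c * d).

Lemma finsupp_convol_at a f g : finsupp_section f -> convol_at a f g.
Proof.
by move=> /finsupp_sectionP[J fJ];
  have [] := @convol_fin _ _ _ a f J g (fun h _ => fJ h).
Qed.

Lemma finsupp_sec_cut (P : pred G) f : finsupp_section f ->
  finsupp_section (sec_cut P f).
Proof.
by move=> /finsupp_sectionP[J fJ]; apply/finsupp_sectionP; exists J => g /fJ;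
  rewrite /sec_cut => ->; case: ifP.
Qed.

Lemma finsupp_cut J a : finsupp_section (sec_cut (mem J) a).
Proof. by apply/finsupp_sectionP; exists J; exact: fin_supp_sec_cut. Qed.

Lemma finsupp_l2_bounded f : finsupp_section f -> l2_bounded f.
Proof.
move=> /finsupp_sectionP[J fJ]; pose c := \sum_(g <- J) rnorm (f g).
have c0 : 0 <= c by apply: sumr_ge0 => g _; exact: rnorm_ge0.
exists (#|` J|%:R * c) => [|x xu]; first by rewrite mulr_ge0.
have : l2_le x (sec_cut (mem J) f) (#|` J|%:R * c).
  apply: l2_le_fin => // g gJ _; rewrite /c (big_fsetD1 _ gJ) /= lerDl.
  by apply: sumr_ge0 => h _; exact: rnorm_ge0.
apply: eq_l2_le => g _; rewrite /sec_cut /=; case: ifPn => // /fJ ->//.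
Qed.

Lemma finsupp_l2_tail x f : finsupp_section f -> l2_tail x f.
Proof. by move=> /finsupp_sectionP[J fJ]; apply: (l2_tail_fin (J := J)) => g _;
  exact: fJ. Qed.

Lemma finsupp_Hilb f : finsupp_section f -> Hilb B f.
Proof.
move=> fs; apply/HilbP; split; first exact: finsupp_l2_bounded.
by move=> x _; exact: finsupp_l2_tail.
Qed.

Lemma l2_le0 x a : l2_le x a 0 -> forall g, gsrc g = x -> a g = 0.
Proof.
move=> h g gx; apply/eqP; rewrite -rnorm_eq0 eq_le rnorm_ge0 andbT.
exact: l2_le_pt h gx.
Qed.

Lemma l2_le_zero x a c : (forall g, gsrc g = x -> a g = 0) -> l2_le x a c.
Proof.
move=> h F; rewrite big1 ?rnorm0 ?sqr_ge0 // => g /eqP gx; rewrite h //.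
by rewrite /sq /ip ml0r // -gx; exact: multVg.
Qed.

Lemma convol_zero a f g : (forall h, gsrc h = gsrc g -> f h = 0) ->
  convol a f g = 0.
Proof.
move=> f0; have [|_ ->] := @convol_fin _ _ _ a f fset0 g; first by move=> h /f0.
by rewrite big_seq_fset0.
Qed.

Lemma normb_le a c : 0 <= c -> (normb a <= c%:E)%E <-> op_le a c.
Proof.
move=> c0; rewrite /normb /nnsup ge_max lee_fin c0 /=; split.
  move=> /ereal_supP h; split=> // x xu f fs d d0 fd.
  (* Cutting f down to one source fibre makes its global norm obey the bound that is known on that
     fibre. *)
  pose f' := sec_cut (fun g => gsrc g == x) f.
  have f's : finsupp_section f' by exact: finsupp_sec_cut.
  have ff g : gsrc g = x -> f' g = f g by rewrite /f' /sec_cut => ->;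
    rewrite eqxx.
  have f'd : (norm2 f' <= d%:E)%E.
    apply/norm2_le => // y yu; have [->|yx] := eqVneq y x;
      first exact: l2_le_cut.
    apply: l2_le_zero => g gy; rewrite /f' /sec_cut gy.
    by rewrite (negbTE yx).
  have /norm2_fin fin := finsupp_l2_bounded f's.
  have fn : norm2 f' \is a fin_num by rewrite ge0_fin_numE ?norm2_ge0.
  have r0 : 0 <= fine (norm2 f') by rewrite fine_ge0 ?norm2_ge0.
  suff : l2_le x (convol a f') (c * d).
    apply: eq_l2_le => g gx; apply/esym.
    have ff' k : gsrc k = gsrc g -> f' k = f k.
      by move=> kg; apply: ff; rewrite kg.
    by have [] := eq_convol_at ff' (finsupp_convol_at a g f's).
  have f'r : l2_le x f' (fine (norm2 f')).
    by apply: (iffLR (norm2_le _ r0)) => //; rewrite fineK.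
  (* If |f'|_2 = 0 the quotient is 0 by convention and carries no information; but then f' vanishes
     on the fibre, and so does the convolution. *)
  move: r0; rewrite le_eqVlt => /predU1P[r0|r0].
    rewrite -r0 in f'r; apply: l2_le_zero => g gx; apply: convol_zero => k.
    by rewrite gx; exact: l2_le0.
  have := h _ (ex_intro2 _ _ f' f's erefl).
  rewrite -(fineK fn) inver gt_eqF // lee_pdivrMr // -EFinM.
  move=> /(iffLR (norm2_le _ (mulr_ge0 c0 (ltW r0)))) /(_ x xu).
  apply: l2_le_mono; first by rewrite mulr_ge0 // (ltW r0).
  by rewrite ler_wpM2l // -lee_fin fineK.
move=> [_ h]; apply/ereal_supP => _ [f fs <-].
have /norm2_fin fin := finsupp_l2_bounded fs.
have fn : norm2 f \is a fin_num by rewrite ge0_fin_numE ?norm2_ge0.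
have r0 : 0 <= fine (norm2 f) by rewrite fine_ge0 ?norm2_ge0.
have fr : forall x, units G x -> l2_le x f (fine (norm2 f)).
  by apply/norm2_le; rewrite ?fineK.
have afr : (norm2 (convol a f) <= (c * fine (norm2 f))%:E)%E.
  by apply/norm2_le => [|x xu]; [rewrite mulr_ge0|apply: h => //; exact: fr].
move: r0; rewrite le_eqVlt => /predU1P[r0|r0].
  rewrite (_ : norm2 (convol a f) = 0%E) ?mul0e ?lee_fin //.
  by apply/eqP; rewrite eq_le norm2_ge0 andbT; move: afr; rewrite -r0 mulr0.
by rewrite -(fineK fn) inver gt_eqF // lee_pdivrMr.
Qed.

Lemma op_le_mono a c d : c <= d -> op_le a c -> op_le a d.
Proof.
move=> cd [c0 h]; split; first exact: le_trans cd.
move=> x xu f fs e e0 fe; apply: l2_le_mono (h x xu f fs e e0 fe).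
  exact: mulr_ge0.
by rewrite ler_wpM2r.
Qed.

Lemma op_leD a b c d : op_le a c -> op_le b d -> op_le (s_add a b) (c + d).
Proof.
move=> [c0 ac] [d0 bd]; split=> [|x xu f fs e e0 fe]; first exact: addr_ge0.
have := l2_leD xu (mulr_ge0 c0 e0) (mulr_ge0 d0 e0) (ac x xu f fs e e0 fe) (bd x
  xu f fs e e0 fe).
rewrite -mulrDl; apply: eq_l2_le => g gx.
by have [_ ->] := convol_atDl (finsupp_convol_at a g fs) (finsupp_convol_at b g
  fs).
Qed.

Lemma Re_norm_ge0 (t : R[i]) : 0 <= complex.Re `|t|.
Proof. by rewrite -ler0c RRe_real // ger0_real. Qed.

Lemma op_leZ (t : R[i]) a c : op_le a c ->
  op_le (s_scale t a) (complex.Re `|t| * c).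
Proof.
move=> [c0 ac]; split=> [|x xu f fs e e0 fe];
  first by rewrite mulr_ge0 ?Re_norm_ge0.
have := l2_leZ t (ac x xu f fs e e0 fe); rewrite mulrA; apply: eq_l2_le => g gx.
by have [_ ->] := convol_atZl t (finsupp_convol_at a g fs).
Qed.

Lemma op_leB a b c d : op_le a c -> op_le b d -> op_le (s_sub a b) (c + d).
Proof.
move=> ac /(op_leZ (-1)) bd; rewrite s_subE; apply: op_leD => //.
by move: bd; rewrite normrN1 mul1r.
Qed.

Lemma op_le0 a : (forall g, a g = 0) -> op_le a 0.
Proof.
move=> a0; split=> // x xu f fs d d0 fd; apply: l2_le_zero => g gx.
apply: convolE; rewrite (_ : cterm a f g = fun=> 0); first exact: has_sum0.
apply/funext => h; rewrite /cterm; case: eqP => // hg.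
by rewrite a0 (ml0l (mult_exl hg)).
Qed.

(** Adjointness of left convolution by a and by a^*, in a case where it is an exchange of two finite
    sums. *)
Lemma fin_adjoint x a a' f F J : units G x ->
  (forall g, gsrc g = x -> g \notin F -> a' g = 0) ->
  (forall g, gsrc g = x -> g \notin J -> f g = 0) ->
  \sum_(g <- F | gsrc g == x) ip x (a' g) (convol (s_star a) f g) =
  \sum_(h <- J | gsrc h == x) ip x (convol a a' h) (f h).
Proof.
move=> xu aF fJ.
transitivity (\sum_(g <- F | gsrc g == x) \sum_(h <- J | gsrc h == x)
    ip x (a' g) (ip g (a (gmul h (ginv g))) (f h))).
  apply: eq_bigr => g /eqP gx.
  have [|_ ->] := @convol_fin _ _ _ (s_star a) f J g.
    by move=> h; rewrite gx; exact: fJ.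
  rewrite /ip -gx (ml_sumr (multVg g)) [RHS]big_mkcond; apply: eq_bigr => h _.
  by case: eqP => [hg|hg]; [rewrite cterm_star|rewrite /cterm; case: eqP;
    rewrite ?(ml0r (multVg g))].
transitivity (\sum_(h <- J | gsrc h == x) \sum_(g <- F | gsrc g == x)
    ip x (ml h (a (gmul h (ginv g))) (a' g)) (f h)).
  rewrite exchange_big; apply: eq_bigr => h /eqP hx;
    apply: eq_bigr => g /eqP gx.
  have gh := mult_exl (etrans gx (esym hx)).
  have hxx : mult (ginv h) h x by rewrite -hx; exact: multVg.
  by rewrite /ip (ml_fstar _ _ gh) (mlA _ _ _ (multV gh) hxx (mult_divl gh)).
apply: eq_bigr => h /eqP hx; have hxx : mult (ginv h) h x by rewrite -hx;
  exact: multVg.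
have [|_ ->] := @convol_fin _ _ _ a a' F h.
  by move=> g; rewrite hx; exact: aF.
rewrite /ip fstar_sum (ml_suml hxx) [LHS]big_mkcond; apply: eq_bigr => g _.
rewrite /cterm hx; case: eqP => // _.
by rewrite fstar0 (ml0l hxx).
Qed.

(** Let a' be the restriction of a^* f to F and N the norm to be bounded. Then N is the norm of the
    pairing of a' with a^* f, that is of a a' with f, and so N <= c N^{1/2} d; divide by N^{1/2}. *)
Lemma op_le_star a c : op_le a c -> op_le (s_star a) c.
Proof.
move=> [c0 ac]; split=> [//|x xu f fs d d0 fd F].
have [J fJ] := (iffLR (finsupp_sectionP f) fs).
set a' := sec_cut (mem F) (convol (s_star a) f).
set N := rnorm _.
have N0 : 0 <= N by exact: rnorm_ge0.
have a'N : l2_le x a' (Num.sqrt N).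
  move=> K; rewrite sqr_sqrtr // sec_cut_fsum; apply: l2_le_sub => //.
  by apply/fsubsetP => g; rewrite !inE => /andP[].
have := ac x xu a' (finsupp_cut _ _) _ (sqrtr_ge0 _) a'N.
move=> /(ip_fsum_le J xu (mulr_ge0 c0 (sqrtr_ge0 _)) d0) /(_ fd).
rewrite -(@fin_adjoint x a a' f F J xu); last 2 first.
- by move=> g _ gF; rewrite /a' /sec_cut /= (negbTE gF).
- by move=> g _; exact: fJ.
rewrite big_seq_cond (eq_bigr (fun g => sq x (convol (s_star a) f g)));
  last first.
  by move=> g /andP[gF _]; rewrite /a' /sec_cut /= gF.
rewrite -big_seq_cond -/N -{1}(sqr_sqrtr N0) expr2 mulrAC.
have [N1|N1] := eqVneq N 0; first by rewrite N1 sqr_ge0.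
have N2 : 0 < Num.sqrt N by rewrite sqrtr_gt0 lt_def N1.
rewrite ler_pM2r // => h; rewrite -(sqr_sqrtr N0).
by rewrite ler_pXn2r ?nnegrE ?sqrtr_ge0 // mulr_ge0.
Qed.

(* Test on the section supported at [x] whose value there is the positive
   element [w = sum_F b^* b]: the norm of [b w] on [F] is that of [w^3]. *)
Lemma op_le_l2_le x b c : units G x -> op_le b c -> l2_le x b c.
Proof.
move=> xu [c0 bc] F; set w := \sum_(g <- F | _) _.
have xx : mult x x x by rewrite -{2}(units_src xu); exact: mult_srcr.
have xV := units_inv xu.
have Vxx : mult (ginv x) x x by rewrite xV.
pose f := sec_cut (mem [fset x]%fset) (fun g => tr g w).
have fx : f x = w by rewrite /f /sec_cut /= inE eqxx trE.
have fw : l2_le x f (1 * rnorm w).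
  have := @l2_le_fin _ _ B x (fun g =>
    tr g w) (rnorm w) [fset x]%fset xu (rnorm_ge0 _).
  rewrite cardfs1; apply=> g; rewrite inE => /eqP -> _; by rewrite trE.
rewrite mul1r in fw.
have := bc x xu f (finsupp_cut _ _) _ (rnorm_ge0 _) fw F.
have -> : \sum_(g <- F | gsrc g == x) sq x (convol b f g) =
  ml x (fstar w) (ml x w w).
  rewrite -[X in ml x (fstar w) (ml x X w)]/(\sum_(g <- F | gsrc g == x) sq x (b
    g)) (ml_suml xx) (ml_sumr Vxx).
  apply: eq_bigr => g /eqP gx.
  have gxg : mult g x g by rewrite -gx; exact: mult_srcr.
  have gg : mult (ginv g) g x by rewrite -gx; exact: multVg.
  have -> : convol b f g = ml g (b g) w.
    have [|_ ->] := @convol_fin _ _ _ b f [fset x]%fset g.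
      by move=> h _ hx; rewrite /f /sec_cut /= (negbTE hx).
    rewrite big_seq_fset1 cterm_mult ?(units_src xu) ?gx // fx xV.
    by rewrite gxg.2.
  rewrite /sq /ip (ml_fstar _ _ gxg).
  rewrite (mlA _ _ _ (multV gxg) gg (mult_divl gxg)); congr (ml _ _ _).
  by rewrite (mlA _ _ _ gg xx gxg).
have wV : tr x (fstar w) = w.
  rewrite /w fstar_sum; have trx0 : tr x (0 : fibre B (ginv x)) = 0.
    by apply: (addIr (tr x (0 : fibre B (ginv x)))); rewrite -trD // !add0r.
  rewrite (big_morph (fun u : fibre B (ginv x) => tr x u) (fun u v =>
    trD u v xV) trx0).
  apply: eq_bigr => g /eqP gx.
  have gxg : mult g x g by rewrite -gx; exact: mult_srcr.
  rewrite /sq (fstar_ip _ _ gxg) /ip; apply: Defs.inc_inj; rewrite inc_tr //.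
  have gg : mult (ginv g) g x by rewrite -gx; exact: multVg.
  have gg' : mult (ginv g) g (ginv x) by rewrite xV.
  by rewrite (inc_ml _ _ gg) (inc_ml _ _ gg').
move=> le3.
(* As w is self-adjoint, two uses of the C*-identity give |w^4| = |w|^4. With w^4 = w^3 w and |w^3|
   <= (c |w|)^2 what remains is |w| <= c^2. *)
have le4 : rnorm w ^+ 4 <= rnorm (ml x (fstar w) (ml x w w)) * rnorm w.
  pose s := sq x w.
  have -> : rnorm w ^+ 4 = rnorm (sq x s).
    by rewrite rnorm_sq ?units_src // /s rnorm_sq ?units_src // -exprM.
  rewrite (_ : sq x s = ml x (ml x (fstar w) (ml x w w)) w) ?ml_norm //.
  have sV : ml x (fstar s) s = ml x s s.
    have sE : inc (fstar s) = inc s.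
      rewrite /s /sq (fstar_ip _ _ xx) /ip.
      by rewrite (inc_ml _ _ Vxx) inc_ml // xV.
    by apply: Defs.inc_inj; rewrite (inc_ml _ _ Vxx) (inc_ml _ _ xx);
      exact: inc_fmul.
  have ws : ml x w w = s by rewrite /s /sq /ip -{1}wV ml_trl.
  rewrite {1}/sq /ip sV -{2}ws -(mlA _ _ _ xx xx xx); congr (ml _ _ _).
  by rewrite /s /sq /ip (mlA _ _ _ Vxx xx xx).
have [w0|w0] := eqVneq (rnorm w) 0; first by rewrite w0 sqr_ge0.
have {}w0 : 0 < rnorm w by rewrite lt_def w0 rnorm_ge0.
have := le_trans le4 (ler_wpM2r (ltW w0) le3).
have -> : rnorm w ^+ 4 = rnorm w * (rnorm w ^+ 2 * rnorm w) by ring.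
by rewrite exprMn mulrA !ler_pM2r // exprn_gt0.
Qed.

End OperatorBound.

(** * Convolution operators on the Hilbert module *)

Section Admissible.
Variables (R : realType) (G : etaleGroupoid) (B : fellBundle R G).
Implicit Types (a b f : bsection B) (g h k x y : G) (J K F : {fset G}) (c d :
  R).

Definition row_finite a := forall x, exists J, forall g, grng g = x ->
  g \notin J -> a g = 0.

Definition col_finite a := forall x, exists J, forall g, gsrc g = x ->
  g \notin J -> a g = 0.

(* All that the operator theory below uses of [Cr]: sections in [Cc] are row-
   and column-finite because a slice meets each range and source fibre at most
   once. *)
Definition admissible a := (exists c, op_le a c) /\
  forall e : R, 0 < e -> exists b, [/\ row_finite b,
    col_finite b & op_le (s_sub a b) e].

Lemma convol_cut a b J g : convol a (sec_cut (mem J) b) g =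
  \sum_(h <- J) cterm a b g h.
Proof.
have [|_ ->] := @convol_fin _ _ _ a (sec_cut (mem J) b) J g.
  by move=> h _ hJ; rewrite /sec_cut /= (negbTE hJ).
by apply: eq_big_seq => h hJ; rewrite /cterm /sec_cut /= hJ.
Qed.

Lemma admissible_convol_at a b d g : admissible a -> 0 <= d ->
  l2_le (gsrc g) b d -> convol_at a b g.
Proof.
move=> [_ aa] d0 bd; have [|l] := has_sum_cauchy (f := cterm a b g);
  last exact: convol_atI.
move=> e e0; have d1 : 0 < d + 1 by rewrite ltr_wpDl.
have [b0 [rf _ [e1 ab]]] := aa _ (divr_gt0 e0 d1).
have [J0 J0P] := rf (grng g).
(* These are the right factors h for which the left factor g h^{-1} can lie in the support of [b0];
   off them a may be replaced by a - b0. *)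
exists [fset gmul (ginv k) g | k in J0]%fset => F FJ.
have -> : \sum_(h <- F) cterm a b g h =
  convol (s_sub a b0) (sec_cut (mem F) b) g.
  rewrite convol_cut; apply: eq_big_seq => h hF; rewrite /cterm.
  case: eqP => // hg; rewrite /s_sub; have gh := mult_exl hg.
  rewrite [b0 _]J0P ?subr0 //; first by rewrite (mult_rng (mult_divr gh)).
  apply: contra (FJ h hF) => kJ; apply/imfsetP; exists (gmul g (ginv h)) => //=.
  by rewrite (mult_divl gh).2.
have xu := units_gsrc g.
have := ab _ xu _ (finsupp_cut F b) d d0 (l2_le_cut _ bd).
move=> /(l2_le_pt (mulr_ge0 e1 d0)) /(_ erefl) /le_trans; apply.
by rewrite mulrAC ler_pdivrMr // ler_pM2l // lerDl.
Qed.

Lemma fset_common (T : eqType) (r : seq T) (P : T -> {fset G} -> Prop) :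
  (forall t J K, (J `<=` K)%fset -> P t J -> P t K) ->
  (forall t, t \in r -> exists J, P t J) -> exists J, forall t, t \in r ->
    P t J.
Proof.
move=> mono; elim: r => [|t r IH] h; first by exists fset0.
have [|J JP] := IH; first by move=> s sr; apply: h; rewrite inE sr orbT.
have [|K KP] := h t; first by rewrite mem_head.
exists (J `|` K)%fset => s; rewrite inE => /predU1P[->|/JP].
  by apply: mono KP; exact: fsubsetUr.
by apply: mono; exact: fsubsetUl.
Qed.

(** The bound is known for the finite truncations of b, and [l2_le_lim] carries it to b; on a finite
    set F one truncation approximates all values. *)
Lemma op_le_convol a b c d x : units G x -> op_le a c -> 0 <= d ->
  l2_le x b d ->
  (forall g, gsrc g = x -> convol_at a b g) -> l2_le x (convol a b) (c * d).
Proof.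
move=> xu [c0 ac] d0 bd ab; apply: l2_le_lim => // [|F e e0];
  first exact: mulr_ge0.
have [||J JP] := @fset_common G F (fun g J => gsrc g = x ->
  forall K, (J `<=` K)%fset ->
    rnorm (convol a b g - \sum_(h <- K) cterm a b g h) < e).
- by move=> g J K JK h gx L KL; apply: h => //; exact: fsubset_trans KL.
- move=> g gF; have [gx|gx] := eqVneq (gsrc g) x; last first.
    by exists fset0 => gx'; rewrite gx' eqxx in gx.
  by have [J JP] := ab g gx e e0; exists J => _.
exists (convol a (sec_cut (mem J) b)).
  by apply: ac => //; [exact: finsupp_cut|exact: l2_le_cut].
by move=> g gF gx; rewrite convol_cut ltW // JP.
Qed.

Lemma sec_cutK J b : b = s_add (sec_cut (mem J) b) (sec_cut (predC (mem J)) b).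
Proof.
apply: functional_extensionality_dep => g; rewrite /s_add /sec_cut /=.
by case: (g \in J) => /=; rewrite (addr0, add0r).
Qed.

Lemma col_finite_convol a b x J : col_finite a ->
  exists K, forall g, gsrc g = x -> g \notin K ->
    convol a (sec_cut (mem J) b) g = 0.
Proof.
move=> cf; have [||K KP] := @fset_common G J (fun h K => gsrc h = x ->
    forall g, gsrc g = x -> g \notin K -> a (gmul g (ginv h)) = 0).
- move=> h K L KL hK hx g gx gL; apply: hK => //; apply: contra gL.
  exact: (fsubsetP KL).
- move=> h hJ; have [K KP] := cf (grng h).
  exists [fset gmul k h | k in K]%fset => hx g gx gK.
  have gh := mult_exl (etrans hx (esym gx)).
  apply: KP; first by rewrite (mult_mid gh).
  apply: contra gK => kK; apply/imfsetP; exists (gmul g (ginv h)) => //=.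
  by rewrite gh.2.
exists K => g gx gK; rewrite convol_cut big_seq big1 // => h hJ.
rewrite /cterm; case: eqP => // hg; rewrite KP // ?hg //.
by rewrite (ml0l (mult_exl hg)).
Qed.

(** Split b = b1 + b2 with b1 a finite truncation and b2 small, and take a0 column-finite close to
    a. Then a b = a b2 + (a - a0) b1 + a0 b1, where the first two terms are small and the last has
    finite support on the source fibre of x. *)
Lemma admissible_l2_tail a b d x : units G x -> admissible a -> 0 <= d ->
  l2_le x b d -> l2_tail x b -> l2_tail x (convol a b).
Proof.
move=> xu aa d0 bd bt e e0; have [[c ac] ap] := aa; have c0 := ac.1.
have e2 : 0 < e / 2 by rewrite divr_gt0.
have c1 : 0 < c + 1 by rewrite ltr_wpDl.
have d1 : 0 < d + 1 by rewrite ltr_wpDl.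
have [J bJ] := bt _ (divr_gt0 e2 c1).
have [a0 [_ cf a0e]] := ap _ (divr_gt0 e2 d1).
have [K KP] := col_finite_convol b x J cf.
set bJ' := sec_cut (predC (mem J)) b in bJ; set b1 := sec_cut (mem J) b in KP.
have b1s : finsupp_section b1 by exact: finsupp_cut.
have at1 g : gsrc g = x -> convol_at a bJ' g.
  move=> gx; apply: (admissible_convol_at aa (ltW (divr_gt0 e2 c1))).
  by rewrite gx.
exists K; have h1 := op_le_convol xu ac (ltW (divr_gt0 e2 c1)) bJ at1.
have h2 := a0e.2 x xu b1 b1s d d0 (l2_le_cut _ bd).
have := l2_leD xu (mulr_ge0 c0 (ltW (divr_gt0 e2 c1))) (mulr_ge0 a0e.1 d0) h1
  h2.
move=> /(l2_le_cut (predC (mem K))).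
set s := c * _ + _ => H.
have se : s <= e.
  rewrite [leRHS]splitr lerD //.
    by rewrite mulrA ler_pdivrMr // mulrC ler_pM2l // lerDl.
  by rewrite mulrAC ler_pdivrMr // ler_pM2l // lerDl.
have s0 : 0 <= s.
  exact: addr_ge0 (mulr_ge0 c0 (ltW (divr_gt0 e2 c1))) (mulr_ge0 (ltW (divr_gt0
    e2 d1)) d0).
apply: l2_le_mono s0 se _; apply: eq_l2_le H => g gx.
rewrite /sec_cut /=; case: ifPn => //= gK.
rewrite /s_add (sec_cutK J b).
have [_ ->] := convol_atDr (finsupp_convol_at a g b1s) (at1 g gx).
have [_ ->] := convol_atBl (finsupp_convol_at a g b1s) (finsupp_convol_at a0 g
  b1s).
by rewrite (KP g gx gK) subr0 addrC.
Qed.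

Lemma Hilb_convol_at_adm a b g : admissible a -> Hilb B b -> convol_at a b g.
Proof.
move=> aa /HilbP[[d d0 bd] _]; apply: (admissible_convol_at aa d0).
by apply: bd; exact: units_gsrc.
Qed.

Lemma admissible_Hilb a b : admissible a -> Hilb B b -> Hilb B (convol a b).
Proof.
move=> aa bH; have [[d d0 bd] bt] := iffLR (HilbP b) bH; apply/HilbP.
have [[c ac] _] := aa; split=> [|x xu].
  exists (c * d) => [|x xu]; first by rewrite mulr_ge0 // ac.1.
  by apply: op_le_convol => // [|g _]; [exact: bd|exact: Hilb_convol_at_adm].
by apply: (admissible_l2_tail xu aa d0); [exact: bd|exact: bt].
Qed.

Lemma row_finite_star a : row_finite a -> col_finite (s_star a).
Proof.
move=> rf x; have [J JP] := rf x; exists [fset ginv g | g in J]%fset => g gx gJ.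
apply/eqP; rewrite -rnorm_eq0 (rnorm_inc (inc_s_star a g)) rnorm_fstar rnorm_eq0
  JP //.
  by rewrite grngV.
by apply: contra gJ => gJ; apply/imfsetP; exists (ginv g); rewrite ?ginvK.
Qed.

Lemma col_finite_star a : col_finite a -> row_finite (s_star a).
Proof.
move=> rf x; have [J JP] := rf x; exists [fset ginv g | g in J]%fset => g gx gJ.
apply/eqP; rewrite -rnorm_eq0 (rnorm_inc (inc_s_star a g)) rnorm_fstar rnorm_eq0
  JP //.
  by rewrite gsrcV.
by apply: contra gJ => gJ; apply/imfsetP; exists (ginv g); rewrite ?ginvK.
Qed.

Lemma admissible_star a : admissible a -> admissible (s_star a).
Proof.
move=> [[c ac] ap]; split; first by exists c; exact: op_le_star.
move=> e /ap[b [rf cf ab]]; exists (s_star b); split.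
- exact: col_finite_star.
- exact: row_finite_star.
- by rewrite -s_starB; exact: op_le_star.
Qed.

Lemma s_sub_cut J b : s_sub b (sec_cut (mem J) b) = sec_cut (predC (mem J)) b.
Proof.
apply: functional_extensionality_dep => g; rewrite /s_sub /sec_cut /=.
by case: (g \in J) => /=; rewrite (subr0, subrr).
Qed.

Lemma convol_subr a b b' g : admissible a -> Hilb B b -> Hilb B b' ->
  convol a (s_sub b b') g = convol a b g - convol a b' g.
Proof.
move=> aa bH b'H.
by have [_ ->] := convol_atBr (Hilb_convol_at_adm g aa bH) (Hilb_convol_at_adm g
  aa b'H).
Qed.

Lemma op_le_convolB a b b' c d x : units G x -> admissible a -> op_le a c ->
  Hilb B b -> Hilb B b' -> 0 <= d ->
  l2_le x (s_sub b b') d -> l2_le x (s_sub (convol a b) (convol a b')) (c * d).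
Proof.
move=> xu aa ac bH b'H d0 bd.
apply: (eq_l2_le (a := convol a (s_sub b b'))) => [g gx|];
  first exact: convol_subr.
apply: op_le_convol => // g _.
by have [] := convol_atBr (Hilb_convol_at_adm g aa bH) (Hilb_convol_at_adm g aa
  b'H).
Qed.

(** Split the difference as (u - u')^* v + u'^* (v - v'). *)
Lemma star_convol_approx x (u u' v v' : bsection B) (p p' q q' : R) : units G x
  ->
  Hilb B u -> Hilb B u' -> Hilb B v -> Hilb B v' ->
  0 <= p -> 0 <= p' -> 0 <= q -> 0 <= q' ->
  l2_le x (s_sub u u') p' -> l2_le x v q -> l2_le x u' p ->
    l2_le x (s_sub v v') q' ->
  rnorm (convol (s_star u) v x - convol (s_star u') v' x) <= p' * q + p * q'.
Proof.
move=> xu uH u'H vH v'H p0 p'0 q0 q'0 up vq u'p vq'.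
have uv := Hilb_convol_at uH vH xu; have u'v := Hilb_convol_at u'H vH xu.
have u'v' := Hilb_convol_at u'H v'H xu.
have [c1 e1] := convol_atBl uv u'v; have [c2 e2] := convol_atBr u'v u'v'.
rewrite -(subrKA (convol (s_star u') v x)) -e1 -e2 -s_starB in c1 *.
rewrite (le_trans (rnormD _ _)) // lerD //.
  by apply: star_convol_le => //; rewrite ?(units_rng xu) ?(units_src xu).
by apply: star_convol_le => //; rewrite ?(units_rng xu) ?(units_src xu).
Qed.

(** The convolutions inside may have infinite support, but each pairing has a finitely supported
    factor, so [fin_adjoint] applies. *)
Lemma fin_admissible_adjoint a b b' J K x : units G x ->
  convol (s_star (convol a (sec_cut (mem J) b))) (sec_cut (mem K) b') x =
  convol (s_star (sec_cut (mem J) b)) (convol (s_star a) (sec_cut (mem K) b'))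
    x.
Proof.
move=> xu; set b1 := sec_cut _ b; set b1' := sec_cut _ b'.
have b1J g : g \notin J -> b1 g = 0 by exact: fin_supp_sec_cut.
have b1K g : g \notin K -> b1' g = 0 by exact: fin_supp_sec_cut.
have [_ ->] := @convol_fin _ _ _ (s_star (convol a b1)) b1' K x (fun g _ =>
  @b1K g).
rewrite star_fsum_unit // -(@fin_adjoint _ _ _ x a b1 b1' J K xu); last 2 first.
- by move=> g _; exact: b1J.
- by move=> g _; exact: b1K.
rewrite -star_fsum_unit //; apply/esym/convolE/has_sum_fin => g gJ.
rewrite cterm_star_unit // b1J // /ip fstar0; case: eqP => // gx.
by rewrite ml0l // -gx; exact: multVg.
Qed.

(** Both sides depend continuously on b and b' in the l^2-norms and agree on truncations. The
    constant collects the four error terms of the two uses of [star_convol_approx]. *)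
Lemma admissible_adjoint a b b' x : units G x -> admissible a -> Hilb B b ->
  Hilb B b' ->
  convol (s_star (convol a b)) b' x =
    convol (s_star b) (convol (s_star a) b') x.
Proof.
move=> xu aa bH b'H; have aa' := admissible_star aa.
have [[c ac] _] := aa; have c0 := ac.1; have ac' := op_le_star ac.
have [[d d0 bd] bt] := iffLR (HilbP b) bH.
have [[d' d'0 bd'] bt'] := iffLR (HilbP b') b'H.
have abH := admissible_Hilb aa bH; have ab'H := admissible_Hilb aa' b'H.
apply/eqP; rewrite -subr_eq0; apply/eqP.
apply: (@rnorm_small_mul _ _ _ ((c * d' + c * d) + (c * d' + d * c))).
  by rewrite !addr_ge0 ?mulr_ge0.
move=> e e0; have [J bJ] := bt x xu e e0; have [K bK] := bt' x xu e e0.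
have ge0 := ltW e0; have bdx := bd x xu; have bdx' := bd' x xu.
set b1 := sec_cut (mem J) b; set b1' := sec_cut (mem K) b'.
have b1H : Hilb B b1 by apply: finsupp_Hilb; exact: finsupp_cut.
have b1H' : Hilb B b1' by apply: finsupp_Hilb; exact: finsupp_cut.
have ab1H := admissible_Hilb aa b1H; have ab1H' := admissible_Hilb aa' b1H'.
rewrite -s_sub_cut in bJ; rewrite -s_sub_cut in bK.
have aat g : convol_at a b1 g by exact: Hilb_convol_at_adm.
have aat' g : convol_at (s_star a) b' g by exact: Hilb_convol_at_adm.
have h1 := star_convol_approx xu abH ab1H b'H b1H' (mulr_ge0 c0 d0) (mulr_ge0 c0
  ge0)
  d'0 ge0 (op_le_convolB xu aa ac bH b1H ge0 bJ) bdx'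
  (op_le_convol xu ac d0 (l2_le_cut _ bdx) (fun g _ => aat g)) bK.
have h2 := star_convol_approx xu bH b1H ab'H ab1H' d0 ge0 (mulr_ge0 c0 d'0)
  (mulr_ge0 c0 ge0) bJ (op_le_convol xu ac' d'0 bdx' (fun g _ => aat' g))
  (l2_le_cut _ bdx) (op_le_convolB xu aa' ac' b'H b1H' ge0 bK).
have h0 := fin_admissible_adjoint a b b' J K xu.
rewrite -/b1 -/b1' in h0; rewrite h0 {h0} in h1.
rewrite -(subrKA (convol (s_star b1) (convol (s_star a) b1') x)).
rewrite (le_trans (rnormD _ _)) // mulrDr lerD //.
  by rewrite (le_trans h1) //; lra.
by rewrite rdistC (le_trans h2) //; lra.
Qed.

(** [op_le_l2_le] turns the operator bound of b into an l^2-bound on each source fibre. *)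
Lemma admissible_convol_defined a b : admissible a -> admissible b ->
  convol_defined a b.
Proof.
move=> aa [[d bd] _]; apply/convol_definedP => g.
apply: (admissible_convol_at aa bd.1).
by apply: op_le_l2_le => //; exact: units_gsrc.
Qed.

Lemma op_leM a b c d : admissible a -> op_le a c -> op_le b d ->
  convol_defined a b ->
  op_le (convol a b) (c * d).
Proof.
move=> aa ac bd ab; split=> [|x xu f fs e e0 fe];
  first by rewrite mulr_ge0 ?ac.1 ?bd.1.
rewrite (convolA_fin ab fs) -mulrA; apply: op_le_convol => //.
- by rewrite mulr_ge0 // bd.1.
- exact: bd.2.
- move=> g gx; apply: (admissible_convol_at (d := d * e) aa).
    by rewrite mulr_ge0 // bd.1.
  by rewrite gx; exact: bd.2.
Qed.

(** Known for finitely supported sections by [convolA_fin], and both sides are continuous in v on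
    each source fibre. *)
Lemma admissible_convolA a b v : admissible a -> admissible b ->
  admissible (convol a b) -> Hilb B v ->
  convol (convol a b) v = convol a (convol b v).
Proof.
move=> aa ba aba vH; apply: functional_extensionality_dep => g.
have xu := units_gsrc g; set x := gsrc g in xu.
have [[c ac] _] := aa; have [[d bd] _] := ba; have [[m abm] _] := aba.
have [_ vt] := iffLR (HilbP v) vH.
apply/eqP; rewrite -subr_eq0; apply/eqP.
apply: (@rnorm_small_mul _ _ _ (m + c * d)).
  by rewrite addr_ge0 ?mulr_ge0 ?abm.1 ?ac.1 ?bd.1.
move=> e e0; have [J vJ] := vt x xu e e0; rewrite -s_sub_cut in vJ.
have ge0 := ltW e0; set v1 := sec_cut (mem J) v in vJ.
have v1s : finsupp_section v1 by exact: finsupp_cut.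
have v1H := finsupp_Hilb v1s.
have h1 := op_le_convolB xu aba abm vH v1H ge0 vJ.
have h2 := op_le_convolB xu ba bd vH v1H ge0 vJ.
have h3 := op_le_convolB xu aa ac (admissible_Hilb ba vH) (admissible_Hilb ba
  v1H)
  (mulr_ge0 bd.1 ge0) h2.
have {}h1 := l2_le_pt (mulr_ge0 abm.1 ge0) h1 (erefl x).
have {}h3 := l2_le_pt (mulr_ge0 ac.1 (mulr_ge0 bd.1 ge0)) h3 (erefl x).
rewrite /s_sub -(convolA_fin (admissible_convol_defined aa ba) v1s) in h3.
rewrite -(subrKA (convol (convol a b) v1 g)) (le_trans (rnormD _ _)) // mulrDr
  lerD //.
  by rewrite mulrC.
by rewrite rdistC (le_trans h3) // mulrA mulrC.
Qed.

End Admissible.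

(** * Bicompact sets and continuous sections *)

(** Composition for a map continuous on a subspace A only, along [phi] with values in A merely near
    t; the product of the groupoid and that of the bundle are such maps. *)
Lemma within_cvg (T U V : topologicalType) (A : set U) (F : U -> V) (phi : T ->
  U)
    (t : T) (u : U) :
  {within A, continuous F} -> A u -> phi x @[x --> t] --> u ->
  (\forall x \near t, A (phi x)) -> F (phi x) @[x --> t] --> F u.
Proof.
move=> FA Au phit At.
have FAu W : nbhs (F u) W -> within A (nbhs u) (F @^-1` W).
  by move=> WF; rewrite nbhs_subspace_in //; exact: (FA u W WF).
move=> W /FAu /phit /=; apply: filterS2 At => x Ax; exact.
Qed.

Section Etale.
Variable G : etaleGroupoid.
Implicit Types (g h k x y : G) (K L U V W : set G).

Lemma gmul_cvg (T : topologicalType) (t : T) (f h : T -> G) k l :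
  composable k l -> f z @[z --> t] --> k -> h z @[z --> t] --> l ->
  (\forall z \near t, composable (f z) (h z)) ->
  gmul (f z) (h z) @[z --> t] --> gmul k l.
Proof.
move=> kl fk hl fh.
have H := @within_cvg T _ _ _ _ (fun z => (f z, h z)) t (k,
  l) (@gmul_continuous G).
by apply: H => //; exact: cvg_pair.
Qed.

Lemma gsrc_continuous : continuous (@gsrc G).
Proof.
move=> g; apply: gmul_cvg; first by rewrite /composable gsrcV.
- exact: ginv_continuous.
- exact: cvg_id.
- by near=> h; rewrite /composable gsrcV.
Unshelve. all: by end_near.
Qed.

Lemma grng_continuous : continuous (@grng G).
Proof.
move=> g; apply: gmul_cvg; first by rewrite /composable grngV.
- exact: cvg_id.
- exact: ginv_continuous.
- by near=> h; rewrite /composable grngV.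
Unshelve. all: by end_near.
Qed.

Lemma open_ginv U : open U -> open (@ginv G @^-1` U).
Proof. by move=> Uo; apply: open_comp => // g _; exact: ginv_continuous. Qed.

Lemma grng_open U : open U -> open (@grng G @` U).
Proof.
move=> Uo; rewrite (_ : _ @` _ = @gsrc G @` (@ginv G @^-1` U)).
  by apply: gsrc_open; exact: open_ginv.
apply/seteqP; split=> _ [g Ug <-].
  by exists (ginv g); rewrite /= ?ginvK ?gsrcV.
by exists (ginv g); rewrite // grngV.
Qed.

(* the inverse of the range map on the open slice [U] *)
Definition rlift U g : G := xget g [set k | U k /\ grng k = grng g].

Definition liftable U g := exists2 k, U k & grng k = grng g.

Section Slice.
Variables (U : set G) (Uo : open U) (Us : slice U).

Lemma lift_mem g : liftable U g -> U (rlift U g) /\ grng (rlift U g) = grng g.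
Proof. by move=> [k Uk kg]; rewrite /rlift;
  case: xgetP => [h -> //|/(_ k)/(_ (conj Uk kg))]. Qed.

Lemma slice_grng_inj k l : U k -> U l -> grng k = grng l -> k = l.
Proof. by move=> Uk Ul; apply: Us.2; rewrite inE. Qed.

Lemma slice_gsrc_inj k l : U k -> U l -> gsrc k = gsrc l -> k = l.
Proof. by move=> Uk Ul; apply: Us.1; rewrite inE. Qed.

Lemma liftE g k : U k -> grng k = grng g -> rlift U g = k.
Proof.
move=> Uk kg; have [|Ul lg] := @lift_mem g; first by exists k.
by apply: slice_grng_inj => //; rewrite lg.
Qed.

Lemma near_liftable g : liftable U g -> \forall h \near g, liftable U h.
Proof.
move=> [k Uk kg].
have : nbhs (grng g) (grng @` U).
  by apply: open_nbhs_nbhs; split; [exact: grng_open|exists k].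
move=> H; have {}H : nbhs g (@grng G @^-1` (grng @` U)) :=
  @grng_continuous g _ H.
by apply: filterS H => h /= [l Ul lh]; exists l.
Qed.

(** The range map is open, so for a neighbourhood W' of the lift the set r[W' [&] U] is a
    neighbourhood of r(g), and over it the unique lift lies in W'. *)
Lemma lift_cvg g : liftable U g -> rlift U h @[h --> g] --> rlift U g.
Proof.
move=> gl W; have [Ug rg] := lift_mem gl.
rewrite nbhsE => -[W' [W'o W'l] W'W].
have : nbhs (grng g) (grng @` (W' `&` U)).
  by apply: open_nbhs_nbhs; split;
    [exact: grng_open (openI W'o Uo)|exists (rlift U g)].
move=> H; have {}H : nbhs g (@grng G @^-1` (grng @` (W' `&` U))) :=
  @grng_continuous g _ H.
apply: filterS H => h /= [l [W'l' Ul] lh].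
by apply: W'W; rewrite (liftE Ul lh).
Qed.

End Slice.

Definition set_inv K : set G := @ginv G @` K.

Lemma slice_inv U : slice U -> slice (@ginv G @^-1` U).
Proof.
move=> [Us Ur]; split=> k l; rewrite !inE /= => Uk Ul kl.
  by apply: (can_inj (@ginvK G)); apply: Ur; rewrite ?inE ?grngV.
by apply: (can_inj (@ginvK G)); apply: Us; rewrite ?inE ?gsrcV.
Qed.

Lemma gsrc_set_inv K : gsrc @` set_inv K = grng @` K.
Proof.
apply/seteqP; split=> [_ [_ [k Kk <-] <-]|_ [k Kk <-]].
  by exists k; rewrite // gsrcV.
by exists (ginv k); rewrite ?gsrcV //; exists k.
Qed.

Lemma grng_set_inv K : grng @` set_inv K = gsrc @` K.
Proof.
apply/seteqP; split=> [_ [_ [k Kk <-] <-]|_ [k Kk <-]].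
  by exists k; rewrite // grngV.
by exists (ginv k); rewrite ?grngV //; exists k.
Qed.

Lemma bicompact_inv K : bicompact K -> bicompact (set_inv K).
Proof.
move=> [[Ks Kr] Kc [U [Uo Us KU]]]; split.
- by split; rewrite ?gsrc_set_inv ?grng_set_inv.
- apply: continuous_compact => //; apply: continuous_subspaceT.
  exact: ginv_continuous.
- exists (@ginv G @^-1` U); split; [exact: open_ginv|exact: slice_inv|].
  by move=> _ [k Kk <-] /=; rewrite ginvK; exact: KU.
Qed.

Definition set_mul K L : set G := [set g | exists k l, [/\ K k,
  L l & mult k l g]].

Lemma set_inv_mul K L : set_inv (set_mul K L) = set_mul (set_inv L) (set_inv K).
Proof.
apply/seteqP; split=> [_ [g [k [l [Kk Ll klg]]] <-]|g [_ [_ [[l Ll <-] [k Kk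
  <-]] lkg]]].
  by exists (ginv l), (ginv k); split; [exists l|exists k|exact: multV].
exists (ginv g); last by rewrite ginvK.
by exists k, l; split => //; have := multV lkg; rewrite !ginvK.
Qed.

Lemma closed_gsrc_mul K L V : open V -> slice V -> L `<=` V ->
  closed_in_units (gsrc @` K) -> closed_in_units (gsrc @` L) ->
  closed_in_units (gsrc @` set_mul K L).
Proof.
move=> Vo Vs LV [C Cc KC] [D Dc LD].
have Wo : open (gsrc @` (V `&` (@grng G @^-1` (~` C)))).
  apply: gsrc_open; apply: openI => //; apply: open_comp;
    last exact: closed_openC.
  by move=> g _; exact: grng_continuous.
exists (D `&` ~` (gsrc @` (V `&` (@grng G @^-1` (~` C))))).
  by apply: closedI => //; exact: open_closedC.
apply/seteqP; split.
  move=> _ [g [k [l [Kk Ll klg]]] <-]; rewrite (mult_src klg).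
  have Dl : (D `&` units G) (gsrc l) by rewrite -LD; exists l.
  split; [split; [by case: Dl|]|by case: Dl].
  move=> [l' [Vl' Cl'] ll']; apply: Cl'.
  rewrite (slice_gsrc_inj Vs Vl' (LV _ Ll) ll') -(mult_mid klg).
  by have [] : (C `&` units G) (gsrc k) by rewrite -KC; exists k.
move=> y [[Dy Wy] yu]; have : (gsrc @` L) y by rewrite LD.
move=> [l Ll ly]; have [Cl|Cl] := pselect (C (grng l)); last first.
  by case: Wy; exists l => //; split => //; exact: LV.
have : (gsrc @` K) (grng l) by rewrite KC; split => //; exact: units_grng.
move=> [k Kk kl]; exists (gmul k l); last by rewrite gsrcM.
by exists k, l; split.
Qed.

Lemma slice_mul U V : slice U -> slice V -> slice (set_mul U V).
Proof.
move=> Us Vs; split=> g g'; rewrite !inE =>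
  -[k [l [Uk Vl m]]] [k' [l' [Uk' Vl' m']]].
  rewrite (mult_src m) (mult_src m') => ll.
  have e := slice_gsrc_inj Vs Vl Vl' ll; subst l'.
  have e : k = k'.
    by apply: (slice_gsrc_inj Us) => //; rewrite (mult_mid m) (mult_mid m').
  by subst k'; rewrite -m.2 -m'.2.
rewrite (mult_rng m) (mult_rng m') => ll.
have e := slice_grng_inj Us Uk Uk' ll; subst k'.
have e : l = l'.
  by apply: (slice_grng_inj Vs) => //; rewrite -(mult_mid m) -(mult_mid m').
by subst l'; rewrite -m.2 -m'.2.
Qed.

(** Near g, left factors are supplied by [rlift U]; the complementary right factor then depends
    continuously on the point. *)
Lemma lift_quot_cvg U k l g : open U -> slice U -> U k -> mult k l g ->
  gmul (ginv (rlift U h)) h @[h --> g] --> l.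
Proof.
move=> Uo Us Uk klg; have kg := esym (mult_rng klg).
have gl : liftable U g by exists k.
have lk := liftE Us Uk kg.
have m := mult_divl klg; rewrite -m.2; apply: gmul_cvg.
- by case: m.
- rewrite -lk; apply: cvg_comp; [exact: lift_cvg|exact: ginv_continuous].
- exact: cvg_id.
- near=> h; have [|_ lh] := @lift_mem U h; first by near: h;
  exact: near_liftable.
  by rewrite /composable gsrcV.
Unshelve. all: by end_near.
Qed.

Lemma lift_mul_mem U V g : slice U -> set_mul U V g <->
  liftable U g /\ V (gmul (ginv (rlift U g)) g).
Proof.
move=> Us; split=> [[k [l [Uk Vl m]]]|[gl Vg]].
  have kg := esym (mult_rng m).
  split; first by exists k.
  by rewrite (liftE Us Uk kg) (mult_divl m).2.
have [Ug lg] := lift_mem gl.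
by exists (rlift U g), (gmul (ginv (rlift U g)) g); split => //;
  exact: mult_exr.
Qed.

Lemma near_set_mul U V g : open U -> slice U -> open V -> set_mul U V g ->
  \forall h \near g, set_mul U V h.
Proof.
move=> Uo Us Vo gUV; have [gl Vg] := iffLR (lift_mul_mem V g Us) gUV.
have [k [l [Uk Vl m]]] := gUV.
have q := lift_quot_cvg Uo Us Uk m.
have Vn : nbhs l V by apply: open_nbhs_nbhs.
near=> h; apply/lift_mul_mem => //; split.
  by near: h; exact: near_liftable.
by near: h; exact: q.
Unshelve. all: by end_near.
Qed.

Lemma open_mul U V : open U -> slice U -> open V -> open (set_mul U V).
Proof. by move=> Uo Us Vo; rewrite openE => g; exact: near_set_mul. Qed.

(** If the unit space is not Hausdorff, the composable pairs in K x L need not form a closed set.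
    Instead, K L is the continuous image of those k in K with s(k) in r[L], and these form a compact
    set because r[L] is closed in the units. *)
Lemma compact_mul K L V : open V -> slice V -> L `<=` V -> compact K ->
  closed_in_units (grng @` L) -> compact (set_mul K L).
Proof.
move=> Vo Vs LV Kc [C Cc LC].
pose K' := K `&` (@gsrc G @^-1` C).
have K'c : compact K'.
  apply: compact_closedI => //; apply: closed_comp => // g _.
  exact: gsrc_continuous.
(* The inverse of k has range s(k), so this multiplies k by the element of V composable with it. *)
pose phi k := gmul k (rlift V (ginv k)).
have K'l k : K' k -> exists2 l, L l & grng l = gsrc k.
  move=> [Kk Ck]; have : (grng @` L) (gsrc k) by rewrite LC; split => //;
    exact: units_gsrc.
  by move=> [l Ll lk]; exists l.
have phiE k l : L l -> grng l = gsrc k -> phi k = gmul k l.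
  by move=> Ll lk; rewrite /phi (liftE Vs (LV _ Ll)) // grngV.
rewrite (_ : set_mul K L = phi @` K').
  apply: continuous_compact => //; apply: continuous_in_subspaceT => k.
  rewrite inE => kK'; have [l Ll lk] := K'l k kK'.
  have kl : liftable V (ginv k) by exists l; rewrite ?grngV //; exact: LV.
  have [_ lr] := lift_mem kl.
  apply: gmul_cvg; first by rewrite /composable lr grngV.
  - exact: cvg_id.
  - apply: (cvg_comp (@ginv G) (rlift V));
    [exact: ginv_continuous|exact: lift_cvg].
  - near=> h.
    have /lift_mem[_ hr] : liftable V (ginv h).
      by near: h; exact: (ginv_continuous (near_liftable Vo kl)).
    by rewrite /composable hr grngV.
apply/seteqP; split.
  move=> g [k [l [Kk Ll m]]]; exists k;
    last by rewrite (phiE _ l) ?(mult_mid m) // m.2.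
  split=> //=; rewrite (mult_mid m).
  by have [] : (C `&` units G) (grng l) by rewrite -LC; exists l.
move=> _ [k kK' <-]; have [l Ll lk] := K'l k kK'.
by exists k, l; split => //; [case: kK'|rewrite (phiE _ l)].
Unshelve. all: by end_near.
Qed.

Lemma bicompact_mul K L : bicompact K -> bicompact L -> bicompact (set_mul K L).
Proof.
move=> Kb Lb; have [[Ks Kr] Kc [U [Uo Us KU]]] := Kb.
have [[Ls Lr] Lc [V [Vo Vs LV]]] := Lb.
split.
- split; first exact: (closed_gsrc_mul Vo Vs).
  rewrite -gsrc_set_inv set_inv_mul.
  apply: (closed_gsrc_mul (open_ginv Uo) (slice_inv Us)).
  + by move=> _ [k Kk <-] /=; rewrite ginvK; exact: KU.
  + by rewrite gsrc_set_inv.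
  + by rewrite gsrc_set_inv.
- exact: (compact_mul Vo Vs).
- exists (set_mul U V); split; [exact: open_mul|exact: slice_mul|].
  by move=> g [k [l [/KU Uk /LV Vl m]]]; exists k, l.
Qed.

End Etale.

(** * Sections supported in slices *)

Section SliceSections.
Variables (R : realType) (G : etaleGroupoid) (B : fellBundle R G).
Implicit Types (a b f s t : bsection B) (g h k x y : G) (J F : {fset G}) (c d :
  R).
Implicit Types (K L U V : set G).

Lemma supp_eq0 a U g : supp a `<=` U -> ~ U g -> a g = 0.
Proof. by move=> aU gU; apply/eqP; apply: contra_notT gU => /aU. Qed.

Lemma slice_row_finite a U : slice U -> supp a `<=` U -> row_finite a.
Proof.
move=> Us aU x; have [[k Uk kx]|nk] := pselect (exists2 k, U k & grng k = x).
  exists [fset k]%fset => g gx; rewrite inE => gk; apply: (supp_eq0 aU) => Ug.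
  by move/eqP: gk; apply; apply: (slice_grng_inj Us) => //; rewrite gx.
exists fset0 => g gx _; apply: (supp_eq0 aU) => Ug.
by apply: nk; exists g.
Qed.

Lemma slice_col_finite a U : slice U -> supp a `<=` U -> col_finite a.
Proof.
move=> Us aU x; have [[k Uk kx]|nk] := pselect (exists2 k, U k & gsrc k = x).
  exists [fset k]%fset => g gx; rewrite inE => gk; apply: (supp_eq0 aU) => Ug.
  by move/eqP: gk; apply; apply: (slice_gsrc_inj Us) => //; rewrite gx.
exists fset0 => g gx _; apply: (supp_eq0 aU) => Ug.
by apply: nk; exists g.
Qed.

Lemma slice_rterm U a b g : slice U -> supp a `<=` U ->
  forall k, (liftable U g -> k != rlift U g) -> rterm a b g k = 0.
Proof.
move=> Us aU k kl; rewrite /rterm; case: eqP => // kg.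
rewrite (supp_eq0 aU) ?(ml0l (mult_exr kg)) // => Uk.
by have /negP := kl (ex_intro2 _ _ k Uk kg); apply; rewrite (liftE Us Uk kg).
Qed.

Lemma slice_convol U a b g : slice U -> supp a `<=` U -> liftable U g ->
  convol a b g = ml g (a (rlift U g)) (b (gmul (ginv (rlift U g)) g)).
Proof.
move=> Us aU gl; have [_ lg] := lift_mem gl.
apply/has_sum_sum/has_sum_rterm.
have -> : ml g (a (rlift U g)) (b (gmul (ginv (rlift U g)) g)) =
    \sum_(k <- [fset rlift U g]%fset) rterm a b g k.
  by rewrite big_seq_fset1 /rterm lg eqxx.
by apply: has_sum_fin => k; rewrite inE => kl;
  apply: (slice_rterm _ Us aU) => _.
Qed.

Lemma slice_convol0 U a b g : slice U -> supp a `<=` U -> ~ liftable U g ->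
  convol a b g = 0.
Proof.
move=> Us aU gl; apply/has_sum_sum/has_sum_rterm.
rewrite (_ : rterm a b g = fun=> 0); first exact: has_sum0.
by apply/funext => k; apply: (slice_rterm _ Us aU) => /gl.
Qed.

(** Only one factorization of g has its left factor in U, so (a f)(g) is a single product a(k)
    f(theta g). By [posf_mul_bound] its square is at most c^2 times that of f(theta g), and theta is
    injective where it matters because U is a slice. *)
Lemma slice_op_le U a c : slice U -> supp a `<=` U -> 0 < c ->
  (forall g, rnorm (a g) <= c) -> op_le a c.
Proof.
move=> Us aU c0 ac; split=> [|x xu f fs d d0 fd F]; first exact: ltW.
pose P g := (gsrc g == x) && `[< liftable U g >].
pose theta g := gmul (ginv (rlift U g)) g.
have thm g : P g -> mult (rlift U g) (theta g) g.
  by move=> /andP[_ /asboolP gl]; apply: mult_exr; have [] := lift_mem gl.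
have thx g : P g -> gsrc (theta g) = x.
  by move=> Pg; rewrite -(mult_src (thm g Pg)); case/andP: Pg => /eqP.
have -> : \sum_(g <- F | gsrc g == x) sq x (convol a f g) =
    \sum_(g <- F | P g) sq x (convol a f g).
  rewrite [LHS]big_mkcond [RHS]big_mkcond; apply: eq_bigr => g _.
  rewrite /P; case: eqP => //= gx.
  case: asboolP => // gl; rewrite (slice_convol0 _ Us aU gl) /sq /ip ml0r //.
  by rewrite -gx; exact: multVg.
have c2 : 0 < c ^+ 2 by rewrite exprn_gt0.
apply: (@le_trans _ _ (rnorm (\sum_(g <- F | P g) (c ^+ 2)%:C%C *: sq x (f
  (theta g))))).
  have sP : posf (\sum_(g <- F | P g) sq x (convol a f g)).
    by apply: posf_sum => // g /andP[/eqP gx _]; exact: posf_sq.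
  have dP : posf (\sum_(g <- F | P g) ((c ^+ 2)%:C%C *: sq x (f (theta g)) - sq
    x (convol a f g))).
    apply: posf_sum => // g Pg; have /andP[_ /asboolP gl] := Pg.
    rewrite (slice_convol _ Us aU gl) -/(theta g).
    have ac2 : rnorm (a (rlift U g)) ^+ 2 <= c ^+ 2.
      by rewrite ler_pXn2r ?nnegrE ?rnorm_ge0 ?(ltW c0).
    exact: (posf_mul_bound (f (theta g)) (thm g Pg) (thx g Pg) c2 ac2).
  apply: (le_trans (rnorm_posfD xu sP dP)).
  rewrite -big_split /= (eq_bigr (fun g =>
    (c ^+ 2)%:C%C *: sq x (f (theta g)))) //.
  by move=> g _; rewrite addrC subrK.
rewrite -scaler_sumr rnormZr ger0_norm ?(ltW c2) // exprMn ler_pM2l //.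
have -> : \sum_(g <- F | P g) sq x (f (theta g)) =
    \sum_(h <- [fset theta g | g in F & P g]%fset) sq x (f h).
  rewrite big_imfset /= ?big_filter // => g g' /andP[_ Pg] /andP[_ Pg'] /= e.
  have m := thm g Pg; have m' := thm g' Pg'.
  have [|Ul _] := @lift_mem _ U g; first by case/andP: Pg => _ /asboolP.
  have [|Ul' _] := @lift_mem _ U g'; first by case/andP: Pg' => _ /asboolP.
  have ll : rlift U g = rlift U g'.
    by apply: (slice_gsrc_inj Us) => //; rewrite (mult_mid m) (mult_mid m') e.
  by rewrite -m.2 -m'.2 ll e.
move/l2_leP : fd; apply=> h /imfsetP[g /= /andP[_ Pg] ->].
exact: thx.
Qed.

Lemma inc_coord (u : B) : inc (Defs.coord u) = u.
Proof.
rewrite /Defs.coord /at_fibre; have [v vu] := inc_surj u.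
by case: xgetP => [w -> //|/(_ v)].
Qed.

Lemma rnorm_coord g (v : fibre B g) : rnorm (Defs.coord (inc v)) = rnorm v.
Proof. by apply: rnorm_inc; rewrite inc_coord. Qed.

(** Upper semicontinuity of the norm makes each point of K have a neighbourhood where the section is
    bounded by an integer; compactness makes one integer serve for all of K, and off K the section
    is 0. *)
Lemma cont_sections_bounded K a : compact K -> cont_sections K a ->
  exists2 c, 0 < c & forall g, rnorm (a g) <= c.
Proof.
move=> Kc [aK ac].
have /compact_near_coveringP := Kc.
move=> /(_ nat \oo (fun n g => rnorm (a g) < n.+1%:R)) H.
have : \forall n \near \oo, K `<=` (fun g => rnorm (a g) < n.+1%:R).
  apply: H => g Kg.
  have ng : nbhs (inc (a g)) [set u : B | rnorm (Defs.coord u) < rnorm (a g) +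
    1].
    apply: open_nbhs_nbhs; split; first exact: norm_usc.
    by rewrite /= rnorm_coord ltrDl.
  have {}ng : nbhs g [set h | rnorm (a h) < rnorm (a g) + 1].
    have H' : nbhs g ((fun h => inc (a h)) @^-1`
      [set u : B | rnorm (Defs.coord u) < rnorm (a g) + 1]) := ac g Kg _ ng.
    by apply: filterS H' => h /=; rewrite rnorm_coord.
  pose N := Num.truncn (rnorm (a g) + 1).
  exists ([set h | rnorm (a h) < rnorm (a g) + 1], [set n | (N <= n)%N]).
    by split => //; exists N.
  move=> [h n] /= [hg Nn]; rewrite (lt_le_trans hg) // ltW //.
  by rewrite (lt_le_trans (truncnS_gt _)) // ler_nat.
move=> [n _ /(_ n (leqnn n)) Kn]; exists n.+1%:R => // g.
have [/Kn/ltW//|gK] := pselect (K g).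
by rewrite (supp_eq0 aK gK) rnorm0.
Qed.

(* the spanning sections of [Cc] *)
Definition generator a := exists2 K, bicompact K & cont_sections K a.

Lemma generator_star a : generator a -> generator (s_star a).
Proof.
move=> [K Kb [aK ac]]; exists (set_inv K); first exact: bicompact_inv.
split.
  move=> g; rewrite /supp /= => ag; exists (ginv g); last by rewrite ginvK.
  apply: aK; rewrite /supp /=; apply: contra ag => /eqP ag.
  by rewrite -rnorm_eq0 (rnorm_inc (inc_s_star a g)) ag rnorm_fstar rnorm0.
move=> _ [k Kk <-].
have -> : (fun h => inc (s_star a h)) =
  (fun u : B => inc (fstar (Defs.coord u))) \o
    (fun h => inc (a h)) \o @ginv G.
  apply/funext => h /=; rewrite inc_s_star; apply: inc_fstar.
  by rewrite inc_coord.
apply: continuous_comp; first exact: ginv_continuous.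
apply: continuous_comp; last exact: fstar_continuous.
by rewrite ginvK; exact: ac.
Qed.

(** Continuity at g in K L must hold along all nearby points, in K L or not. All of them lift to U,
    and there the convolution is one product of a at the lift and b at the remaining factor, with a
    continuous on K and b on L. *)
Lemma generator_mul a b : generator a -> generator b -> generator (convol a b).
Proof.
move=> [K Kb [aK ac]] [L Lb [bL bc]]; exists (set_mul K L);
  first exact: bicompact_mul.
have [_ _ [U [Uo Us KU]]] := Kb; have [_ _ [V [Vo Vs LV]]] := Lb.
have aU : supp a `<=` U by exact: subset_trans KU.
split.
  move=> g; rewrite /supp /= => abg.
  have [gl|/(slice_convol0 b Us aU) e] := pselect (liftable U g);
    last by rewrite e eqxx in abg.
  have [Ul lg] := lift_mem gl; have m := mult_exr lg.
  rewrite (slice_convol b Us aU gl) in abg.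
  exists (rlift U g), (gmul (ginv (rlift U g)) g); split => //.
    by apply: aK; rewrite /supp /=; apply: contra abg => /eqP ->;
      rewrite (ml0l m).
  by apply: bL; rewrite /supp /=; apply: contra abg => /eqP ->;
    rewrite (ml0r m).
move=> g [k [l [Kk Ll m]]].
have Uk := KU _ Kk; have kg := esym (mult_rng m).
have lk := liftE Us Uk kg; have gl : liftable U g by exists k.
have q := lift_quot_cvg Uo Us Uk m.
pose M (p : B * B) : B := inc (fmul (Defs.coord p.1) (Defs.coord p.2)).
pose phi h : B * B := (inc (a (rlift U h)),
  inc (b (gmul (ginv (rlift U h)) h))).
have Mphi h : liftable U h -> inc (convol a b h) = M (phi h).
  move=> hl; have [_ lh] := lift_mem hl.
  rewrite (slice_convol b Us aU hl) (inc_ml _ _ (mult_exr lh)) /M /=.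
  by apply: inc_fmul; rewrite inc_coord.
have phig : phi h @[h --> g] --> phi g.
  have -> : phi g = (inc (a k), inc (b l)) by rewrite /phi lk (mult_divl m).2.
  apply: cvg_pair.
    apply: (cvg_comp (rlift U) (fun h => inc (a h))); first exact: lift_cvg.
    by rewrite lk; exact: ac.
  apply: (cvg_comp (fun h => gmul (ginv (rlift U h)) h) (fun h => inc (b h)));
    first exact: q.
  exact: bc.
rewrite /prop_for /continuous_at Mphi //.
have near_l := near_liftable Uo gl.
apply: (@cvg_trans _ (M (phi h) @[h --> g])).
  by apply: near_eq_cvg; apply: filterS near_l => h /Mphi.
have comp h : liftable U h -> [set p : B * B | composable (rho p.1) (rho p.2)]
  (phi h).
  by move=> hl; have [_ lh] := lift_mem hl; rewrite /= !rho_inc;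
    case: (mult_exr lh).
have H := @within_cvg G _ _ _ M phi g (phi g) (@fmul_continuous _ _ B) (comp g
  gl) phig.
by apply: H; apply: filterS near_l => h /comp.
Qed.

End SliceSections.

(** * The reduced algebra *)

Section Reduced.
Variables (R : realType) (G : etaleGroupoid) (B : fellBundle R G).
Implicit Types (a b f s v : bsection B) (g h k x y : G) (J F : {fset G}) (c d e
  : R).

Let sext a b : (forall g, a g = b g) -> a = b.
Proof. exact: functional_extensionality_dep. Qed.

Definition s_zero : bsection B := fun g => 0.

Lemma Cc0 : Cc B s_zero.
Proof.
by exists 0%N, (fun=> 0), (fun=> s_zero); split=> [[]//|g]; rewrite big_ord0.
Qed.

Lemma Cc_ind (P : bsection B -> Prop) : P s_zero ->
  (forall (t : R[i]) s a, generator s -> Cc B a -> P a ->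
    P (s_add (s_scale t s) a)) ->
  forall a, Cc B a -> P a.
Proof.
move=> P0 PD a [n]; elim: n a => [|n IH] a [l [s [sg ae]]].
  by rewrite (_ : a = s_zero) //; apply: sext => g; rewrite ae big_ord0.
have sg' i : exists2 K, bicompact K & cont_sections K (s (fintype.lift ord0 i))
  by exact: sg.
pose a' : bsection B := fun g =>
  \sum_(i < n) l (fintype.lift ord0 i) *: s (fintype.lift ord0 i) g.
rewrite (_ : a = s_add (s_scale (l ord0) (s ord0)) a'); last first.
  by apply: sext => g; rewrite ae big_ord_recl.
apply: PD; first exact: sg.
  by exists n, (l \o fintype.lift ord0), (s \o fintype.lift ord0); split.
by apply: IH; exists (l \o fintype.lift ord0), (s \o fintype.lift ord0); split.
Qed.

Lemma CcD a b : Cc B a -> Cc B b -> Cc B (s_add a b).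
Proof.
move=> [n [l [s [sg ae]]]] [m [l' [s' [sg' be]]]].
exists (n + m)%N, (fun i => match fintype.split i with inl j => l j | inr j =>
  l' j end),
  (fun i => match fintype.split i with inl j => s j | inr j => s' j end).
split=> [i|g]; first by case: (fintype.split i).
rewrite big_split_ord /s_add ae be; congr (_ + _); apply: eq_bigr => i _.
  by rewrite (unsplitK (inl i : 'I_n + 'I_m)).
by rewrite (unsplitK (inr i : 'I_n + 'I_m)).
Qed.

Lemma CcZ (t : R[i]) a : Cc B a -> Cc B (s_scale t a).
Proof.
move=> [n [l [s [sg ae]]]]; exists n, (fun i => t * l i), s; split=> // g.
by rewrite /s_scale ae scaler_sumr; apply: eq_bigr => i _; rewrite scalerA.
Qed.

Lemma generator_Cc a : generator a -> Cc B a.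
Proof.
move=> ag; exists 1%N, (fun=> 1), (fun=> a); split=> // g.
by rewrite big_ord1 scale1r.
Qed.

Lemma generator_finite a : generator a ->
  [/\ row_finite a, col_finite a & exists c, op_le a c].
Proof.
move=> [K [Kb Kc [U [Uo Us KU]]] aK].
have aU : supp a `<=` U by apply: subset_trans KU; case: aK.
split; [exact: slice_row_finite aU|exact: slice_col_finite aU|].
have [c c0 ac] := cont_sections_bounded Kc aK.
by exists c; exact: slice_op_le aU c0 ac.
Qed.

Lemma Cc_finite a : Cc B a -> [/\ row_finite a, col_finite a & exists c,
  op_le a c].
Proof.
apply: (@Cc_ind (fun a => [/\ row_finite a, col_finite a & exists c,
  op_le a c])) =>
  [|t s {}a sg _ [ra ca [c ac]]].
  split; [by move=> x; exists fset0|by move=> x; exists fset0|].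
  by exists 0; exact: op_le0.
have [rs cs [d sd]] := generator_finite sg; split.
- move=> x; have [J JP] := rs x; have [K KP] := ra x;
  exists (J `|` K)%fset => g gx.
  rewrite inE negb_or /s_add /s_scale => /andP[/JP -> // /KP -> //].
  by rewrite scaler0 addr0.
- move=> x; have [J JP] := cs x; have [K KP] := ca x;
  exists (J `|` K)%fset => g gx.
  rewrite inE negb_or /s_add /s_scale => /andP[/JP -> // /KP -> //].
  by rewrite scaler0 addr0.
- by eexists; apply: op_leD ac; exact: op_leZ sd.
Qed.

Lemma Cc_admissible a : Cc B a -> admissible a.
Proof.
move=> /Cc_finite[ra ca ac]; split=> // e e0; exists a; split => //.
apply: (@op_le_mono _ _ _ _ 0); first exact: ltW.
by apply: op_le0 => g; rewrite /s_sub subrr.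
Qed.

(** Row-finiteness of [a] makes the sum over left factors finite, whatever [b] is. *)
Lemma Cc_convol_at a b g : Cc B a -> convol_at a b g.
Proof.
move=> /Cc_finite[ra _ _]; have [J JP] := ra (grng g).
have : has_sum (rterm a b g) (\sum_(k <- J) rterm a b g k).
  apply: has_sum_fin => k kJ; rewrite /rterm; case: eqP => // kg.
  by rewrite JP // (ml0l (mult_exr kg)).
by move=> /has_sum_rterm/has_sum_cterm; exact: convol_atI.
Qed.

Lemma Cc_star a : Cc B a -> Cc B (s_star a).
Proof.
apply: (@Cc_ind (fun a => Cc B (s_star a))) => [|t s {}a sg _ aC].
  rewrite (_ : s_star s_zero = s_zero); first exact: Cc0.
  apply: sext => g; apply/eqP; rewrite -rnorm_eq0 (rnorm_inc (inc_s_star _ g)).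
  by rewrite rnorm_fstar rnorm0.
rewrite s_starD s_starZ; apply: CcD => //; apply: CcZ; apply: generator_Cc.
exact: generator_star.
Qed.

Lemma Cc_mul a b : Cc B a -> Cc B b -> Cc B (convol a b).
Proof.
move=> aC bC; move: a aC.
apply: (@Cc_ind (fun a => Cc B (convol a b))) => [|t s a sg aC abC].
  rewrite (_ : convol s_zero b = s_zero); first exact: Cc0.
  apply: sext => g; apply: convolE; rewrite (_ : cterm _ _ _ = fun=> 0);
    first exact: has_sum0.
  by apply/funext => h; rewrite /cterm; case: eqP => // hg;
    rewrite (ml0l (mult_exl hg)).
have sC := generator_Cc sg.
have -> : convol (s_add (s_scale t s) a) b =
  s_add (s_scale t (convol s b)) (convol a b).
  apply: sext => g.
  have [_ ->] := convol_atDl (Cc_convol_at b g (CcZ t sC)) (Cc_convol_at b g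
    aC).
  by have [_ ->] := convol_atZl t (Cc_convol_at b g sC).
apply: CcD => //; apply: CcZ; move: b bC {abC}.
apply: (@Cc_ind (fun b => Cc B (convol s b))) => [|t' s' b s'g bC sbC].
  rewrite (_ : convol s s_zero = s_zero); first exact: Cc0.
  by apply: sext => g; exact: convol_zero.
have -> : convol s (s_add (s_scale t' s') b) =
  s_add (s_scale t' (convol s s')) (convol s b).
  apply: sext => g.
  have [_ ->] := convol_atDr (Cc_convol_at (s_scale t' s') g sC) (Cc_convol_at b
    g sC).
  by have [_ ->] := convol_atZr t' (Cc_convol_at s' g sC).
by apply: CcD => //; apply: CcZ; apply: generator_Cc; exact: generator_mul.
Qed.

Lemma CrP a : Cr a <-> forall e, 0 < e ->
  exists2 b, Cc B b & op_le (s_sub a b) e.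
Proof.
split=> h e e0.
  have [b bC ab] := h e e0; exists b => //.
  by apply/normb_le; rewrite ltW.
have e2 : 0 < e / 2 by rewrite divr_gt0.
have [b bC /(normb_le _ (ltW e2)) ab] := h _ e2; exists b => //.
by rewrite (le_lt_trans ab) // lte_fin ltr_pdivrMr // mulr_natr mulr2n ltrDl.
Qed.

Lemma Cc_Cr a : Cc B a -> Cr a.
Proof.
move=> aC; apply/CrP => e e0; exists a => //.
apply: (@op_le_mono _ _ _ _ 0); first exact: ltW.
by apply: op_le0 => g; rewrite /s_sub subrr.
Qed.

Lemma s_subK a b : s_add (s_sub a b) b = a.
Proof. by apply: sext => g; rewrite /s_add /s_sub subrK. Qed.

Lemma Cr_admissible a : Cr a -> admissible a.
Proof.
move=> /CrP ap; split.
  have [b /Cc_finite[_ _ [c bc]] ab] := ap 1 ltr01.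
  by exists (1 + c); rewrite -(s_subK a b); exact: op_leD.
move=> e /ap[b /Cc_finite[rb cb _] ab].
by exists b.
Qed.

Lemma CrD a b : Cr a -> Cr b -> Cr (s_add a b).
Proof.
move=> /CrP ap /CrP bp; apply/CrP => e e0;
  have e2 : 0 < e / 2 by rewrite divr_gt0.
have [a' a'C aa'] := ap _ e2; have [b' b'C bb'] := bp _ e2.
exists (s_add a' b'); first exact: CcD.
rewrite [e]splitr (_ : s_sub _ _ = s_add (s_sub a a') (s_sub b b')).
  exact: (op_leD aa' bb').
by apply: sext => g; rewrite /s_add /s_sub opprD addrACA.
Qed.

Lemma CrZ (t : R[i]) a : Cr a -> Cr (s_scale t a).
Proof.
move=> /CrP ap; apply/CrP => e e0.
have t1 : 0 < complex.Re `|t| + 1 by rewrite ltr_wpDl ?Re_norm_ge0.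
have [a' a'C aa'] := ap _ (divr_gt0 e0 t1); exists (s_scale t a');
  first exact: CcZ.
rewrite (_ : s_sub _ _ = s_scale t (s_sub a a')).
  apply: op_le_mono (op_leZ t aa').
  by rewrite mulrA ler_pdivrMr // mulrC ler_pM2l // lerDl.
by apply: sext => g; rewrite /s_scale /s_sub scalerBr.
Qed.

Lemma CrB a b : Cr a -> Cr b -> Cr (s_sub a b).
Proof. by move=> aC bC; rewrite s_subE; exact: CrD aC (CrZ (-1) bC). Qed.

Lemma Cr_star a : Cr a -> Cr (s_star a).
Proof.
move=> /CrP ap; apply/CrP => e /ap[b bC ab]; exists (s_star b);
  first exact: Cc_star.
by rewrite -s_starB; exact: op_le_star.
Qed.

Lemma Cr_mul a b : Cr a -> Cr b -> Cr (convol a b).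
Proof.
move=> aC bC; apply/CrP => e e0.
have aa := Cr_admissible aC; have ba := Cr_admissible bC.
have [[c ac] _] := aa; have [[d bd] _] := ba.
have e2 : 0 < e / 2 by rewrite divr_gt0.
have d1 : 0 < d + 1 by rewrite ltr_wpDl // bd.1.
have e1 := divr_gt0 e2 d1; set p := e / 2 / (d + 1) in e1.
have [a' a'C aa'] := iffLR (CrP a) aC p e1.
have a'c : op_le a' (c + p).
  rewrite (_ : a' = s_sub a (s_sub a a')); first exact: op_leB.
  by apply: sext => g; rewrite /s_sub opprB addrC subrK.
have c1 : 0 < c + p + 1 by rewrite ltr_wpDl // a'c.1.
(* [b'] is chosen after [a'] since its tolerance involves the bound c + p of [a']; the difference is
   a b - a' b' = (a - a') b + a' (b - b'). *)
have [b' b'C bb'] := iffLR (CrP b) bC _ (divr_gt0 e2 c1).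
exists (convol a' b'); first exact: Cc_mul.
have a'a := Cc_admissible a'C; have b'a := Cc_admissible b'C.
have aa'C := CrB aC (Cc_Cr a'C); have bb'C := CrB bC (Cc_Cr b'C).
have aa'a := Cr_admissible aa'C; have bb'a := Cr_admissible bb'C.
have := op_leD (op_leM aa'a aa' bd (admissible_convol_defined aa'a ba))
  (op_leM a'a a'c bb' (admissible_convol_defined a'a bb'a)).
rewrite (_ : s_add _ _ = s_sub (convol a b) (convol a' b')).
  apply: op_le_mono; rewrite [leRHS]splitr lerD //.
    by rewrite mulrAC ler_pdivrMr // ler_pM2l // lerDl.
  by rewrite mulrA ler_pdivrMr // mulrC ler_pM2l // lerDl.
apply: sext => g; rewrite /s_add /s_sub.
have dfn (u w : bsection B) : admissible u -> admissible w -> convol_at u w g.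
  by move=> ua wa; have /convol_definedP := admissible_convol_defined ua wa.
have [_ ->] := convol_atBl (dfn _ _ aa ba) (dfn _ _ a'a ba).
by have [_ ->] := convol_atBr (dfn _ _ a'a ba) (dfn _ _ a'a b'a);
  rewrite addrA subrK.
Qed.

End Reduced.

Lemma near_all (T : eqType) (r : seq T) (P : T -> nat -> Prop) :
  (forall t, t \in r -> \forall n \near \oo, P t n) ->
  \forall n \near \oo, forall t, t \in r -> P t n.
Proof.
elim: r => [|t r IH] h; first by near=> n.
have h1 := h t (mem_head _ _).
have h2 : \forall n \near \oo, forall s, s \in r -> P s n.
  by apply: IH => s sr; apply: h; rewrite inE sr orbT.
near=> n => s; rewrite inE => /predU1P[->|]; first by near: n.
by move: s; near: n.
Unshelve. all: by end_near.
Qed.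

Lemma ereal_eq_le (R : realType) (a b : \bar R) : (0 <= a)%E -> (0 <= b)%E ->
  (forall c : R, 0 <= c -> (a <= c%:E)%E <-> (b <= c%:E)%E) -> a = b.
Proof.
move=> a0 b0 h; apply/eqP; rewrite eq_le; apply/andP; split.
- case: b b0 h => [r r0 h||//]; last by move=> _ _; exact: leey.
  by apply/h.
- case: a a0 h => [r r0 h||//]; last by move=> _ _; exact: leey.
  by apply/h.
Qed.

(** * Comparison of sections with operators *)

Section Isomorphism.
Variables (R : realType) (G : etaleGroupoid) (B : fellBundle R G).
Implicit Types (a b f v : bsection B) (g h k x y : G) (J F : {fset G}) (c d e :
  R).
Implicit Types (T S : operator B).

Let sext a b : (forall g, a g = b g) -> a = b.
Proof. exact: functional_extensionality_dep. Qed.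

Definition l2_all a c := forall x, units G x -> l2_le x a c.

Lemma HilbZ (t : R[i]) a : Hilb B a -> Hilb B (s_scale t a).
Proof.
move=> /HilbP[[c c0 ac] at_]; apply/HilbP; split.
  exists (complex.Re `|t| * c); first by rewrite mulr_ge0 ?Re_norm_ge0.
  by move=> x xu; apply: l2_leZ; exact: ac.
move=> x xu e e0; have t1 : 0 < complex.Re `|t| + 1 by rewrite ltr_wpDl
  ?Re_norm_ge0.
have [J aJ] := at_ x xu _ (divr_gt0 e0 t1); exists J.
apply: (@l2_le_mono _ _ _ _ _ (complex.Re `|t| * (e / (complex.Re `|t| + 1)))).
- by rewrite mulr_ge0 ?Re_norm_ge0 // ltW // divr_gt0.
- by rewrite mulrA ler_pdivrMr // mulrC ler_pM2l // lerDl.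
- apply: eq_l2_le (l2_leZ t aJ) => g _; rewrite /s_scale /sec_cut.
  by case: ifP => //; rewrite scaler0.
Qed.

Lemma HilbD a b : Hilb B a -> Hilb B b -> Hilb B (s_add a b).
Proof.
move=> /HilbP[[c c0 ac] at_] /HilbP[[d d0 bd] bt]; apply/HilbP; split.
  exists (c + d); first exact: addr_ge0.
  by move=> x xu; apply: l2_leD => //; [exact: ac|exact: bd].
move=> x xu e e0; have e2 : 0 < e / 2 by rewrite divr_gt0.
have [J aJ] := at_ x xu _ e2; have [K bK] := bt x xu _ e2.
exists (J `|` K)%fset; rewrite [e]splitr.
have := l2_leD xu (ltW e2) (ltW e2) aJ bK =>
  /(l2_le_cut (predC (mem (J `|` K)%fset))).
apply: eq_l2_le => g _; rewrite /s_add /sec_cut /=; case: ifP => //.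
by rewrite inE negb_or => /andP[-> ->].
Qed.

Lemma HilbB a b : Hilb B a -> Hilb B b -> Hilb B (s_sub a b).
Proof. by move=> aH bH; rewrite s_subE; exact: HilbD aH (HilbZ (-1) bH). Qed.

Lemma admissible_is_adjoint a : admissible a ->
  is_adjoint (convol a) (convol (s_star a)).
Proof.
move=> aa; split=> [b bH|b bH|b b' bH b'H].
- exact: (admissible_Hilb aa bH).
- exact: (admissible_Hilb (admissible_star aa) bH).
- apply: sext => x; have [xu|xu] := pselect (units G x).
    by rewrite !inner_unit // admissible_adjoint.
  by rewrite !inner_not_unit.
Qed.

(** The difference v of the two sides satisfies v^* v = 0 at every unit, by moving T to the other
    side of the pairing. *)
Lemma adjoint_scale T S (t : R[i]) b : is_adjoint T S -> Hilb B b ->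
  T (s_scale t b) = s_scale t (T b).
Proof.
move=> [TH SH TS] bH; have tbH := HilbZ t bH.
have TbH := TH _ bH; have TtbH := TH _ tbH; have tTbH := HilbZ t TbH.
set v := s_sub (T (s_scale t b)) (s_scale t (T b)).
have vH : Hilb B v by exact: HilbB.
have SvH := SH _ vH.
have v0 x : units G x -> l2_le x v 0.
  move=> xu; have vv : convol (s_star v) v x = 0.
    rewrite {1}/v s_starB.
    have [_ ->] := convol_atBl (Hilb_convol_at TtbH vH xu) (Hilb_convol_at tTbH
      vH xu).
    rewrite -!inner_unit // TS // !inner_unit // !s_starZ.
    have [_ ->] := convol_atZl t^* (Hilb_convol_at bH SvH xu).
    have [_ ->] := convol_atZl t^* (Hilb_convol_at TbH vH xu).
    by rewrite -!inner_unit // TS // subrr.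
  by have := l2_le_convol xu (Hilb_convol_at vH vH xu);
    rewrite vv rnorm0 sqrtr0.
apply: sext => g; apply/eqP; rewrite -subr_eq0; apply/eqP.
exact: (l2_le0 (v0 _ (units_gsrc g)) (erefl (gsrc g))).
Qed.

Lemma normop_leI T c : 0 <= c ->
  (forall b, Hilb B b -> l2_all b 1 -> Hilb B (T b) /\ l2_all (T b) c) ->
  (normop T <= c%:E)%E.
Proof.
move=> c0 h; rewrite /normop /nnsup ge_max lee_fin c0 /=.
apply/ereal_supP => _ [b [bH b1] <-].
have [TbH Tbc] := h b bH (iffLR (normH_le ler01 bH) b1).
exact/normH_le.
Qed.

Lemma normop_leE T c d b : 0 <= c -> (forall b, Hilb B b -> Hilb B (T b)) ->
  (forall (t : R[i]) b, Hilb B b -> T (s_scale t b) = s_scale t (T b)) ->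
  (normop T <= c%:E)%E -> Hilb B b -> 0 <= d -> l2_all b d ->
    l2_all (T b) (c * d).
Proof.
move=> c0 TH Tt; rewrite /normop /nnsup ge_max lee_fin c0 /= =>
  /ereal_supP Tc bH d0 bd x xu.
apply: l2_le_eps => [|e e0]; first exact: mulr_ge0.
have c1 : 0 < c + 1 by rewrite ltr_wpDl.
(* [normop] sees the unit ball only, so b is divided by d + q. The positive q covers d = 0, and c q
   <= e. *)
have q0 := divr_gt0 e0 c1; set q := e / (c + 1) in q0.
have dq : 0 < d + q by rewrite ltr_wpDl.
pose t : R[i] := ((d + q)^-1)%:C%C; pose b' := s_scale t b.
have tn : complex.Re `|t| = (d + q)^-1.
  by rewrite /t normc_def /= expr0n addr0 sqrtr_sqr ger0_norm // invr_ge0 ltW.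
have b'H : Hilb B b' by exact: HilbZ.
have b'1 : (normH b' <= 1%:E)%E.
  apply/normH_le => // y yu; have := l2_leZ t (bd y yu); rewrite tn.
  apply: l2_le_mono; first by rewrite mulr_ge0 // invr_ge0 ltW.
  by rewrite mulrC ler_pdivrMr // mul1r lerDl ltW.
have := Tc _ (ex_intro2 _ _ b' (conj b'H b'1) erefl).
move=> /(iffLR (normH_le c0 (TH _ b'H))) /(_ x xu).
rewrite Tt // => /(l2_leZ ((d + q)%:C%C : R[i])).
have -> : complex.Re `|((d + q)%:C%C : R[i])| = d + q.
  by rewrite normc_def /= expr0n addr0 sqrtr_sqr ger0_norm // ltW.
move=> H; apply: (@l2_le_mono _ _ _ _ _ ((d + q) * c)).
- by rewrite mulr_ge0 // ltW.
- rewrite mulrC mulrDr lerD2l /q mulrA ler_pdivrMr // mulrC ler_pM2l //.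
  by rewrite lerDl.
- apply: eq_l2_le H => g _; rewrite /s_scale scalerA -rmorphM /=.
  by rewrite mulfV ?gt_eqF // rmorph1 scale1r.
Qed.

Lemma admissible_convolZ (t : R[i]) a b : admissible a -> Hilb B b ->
  convol a (s_scale t b) = s_scale t (convol a b).
Proof.
move=> aa bH; apply: sext => g.
by have [_ ->] := convol_atZr t (Hilb_convol_at_adm g aa bH).
Qed.

(* It is enough to test an operator on finitely supported sections that vanish
   off one fibre [Gamma x]. *)
Lemma normop_op_le T a c : 0 <= c -> (forall b, Hilb B b -> Hilb B (T b)) ->
  (forall (t : R[i]) b, Hilb B b -> T (s_scale t b) = s_scale t (T b)) ->
  (forall f, finsupp_section f -> T f = convol a f) ->
  (normop T <= c%:E)%E -> op_le a c.
Proof.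
move=> c0 TH Tt Ta Tc; split=> // x xu f fs d d0 fd.
pose f' := sec_cut (fun g => gsrc g == x) f.
have f's : finsupp_section f' by exact: finsupp_sec_cut.
have f'd : l2_all f' d.
  move=> y yu; have [->|yx] := eqVneq y x; first exact: l2_le_cut.
  by apply: l2_le_zero => g gy; rewrite /f' /sec_cut gy (negbTE yx).
have := normop_leE c0 TH Tt Tc (finsupp_Hilb f's) d0 f'd xu.
rewrite Ta //; apply: eq_l2_le => g gx; apply/esym.
have ff' k : gsrc k = gsrc g -> f' k = f k.
  by rewrite gx /f' /sec_cut => ->; rewrite eqxx.
by have [_ ->] := eq_convol_at ff' (finsupp_convol_at a g f's).
Qed.

Lemma normop_convol a : admissible a -> normop (convol a) = normb a.
Proof.
move=> aa; apply: ereal_eq_le => [||c c0];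
  rewrite ?/normop ?/normb ?le_max ?lexx //.
split=> [h|/(normb_le _ c0) ac].
  apply/normb_le => //; apply: normop_op_le h => // [b|t b].
    exact: admissible_Hilb.
  exact: admissible_convolZ.
apply: normop_leI => // b bH b1; split; first exact: admissible_Hilb.
move=> x xu; rewrite -[c]mulr1; apply: op_le_convol => //; first exact: b1.
by move=> g _; exact: Hilb_convol_at_adm.
Qed.

Lemma Cr_classical a : Cr a -> classical_Cr (convol a).
Proof.
move=> aC; have aa := Cr_admissible aC; split.
  by exists (convol (s_star a)); exact: admissible_is_adjoint.
move=> e e0; have e2 : 0 < e / 2 by rewrite divr_gt0.
have [b bC ab] := iffLR (CrP a) aC _ e2; exists b => //.
have ba := Cc_admissible bC.
apply: (@le_lt_trans _ _ (e / 2)%:E); last first.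
  by rewrite lte_fin ltr_pdivrMr // mulr_natr mulr2n ltrDl.
apply: normop_leI => [|v vH v1]; first exact: ltW.
have E : op_sub (convol a) (convol b) v = convol (s_sub a b) v.
  apply: sext => g; rewrite /op_sub /s_sub.
  by have [_ ->] := convol_atBl (Hilb_convol_at_adm g aa vH) (Hilb_convol_at_adm
    g ba vH).
have aba := Cr_admissible (CrB aC (Cc_Cr bC)).
rewrite E; split; first exact: admissible_Hilb.
move=> x xu; rewrite -[_ / 2]mulr1; apply: op_le_convol => //; first exact: v1.
by move=> g _; exact: Hilb_convol_at_adm.
Qed.

(** a - b annihilates the finitely supported sections, so 0 is an operator bound for it, and
    [op_le_l2_le] turns this into vanishing at each point. *)
Lemma Cr_inj a b : Cr a -> Cr b -> op_eq (convol a) (convol b) -> a = b.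
Proof.
move=> aC bC ab; apply: sext => g; apply/eqP; rewrite -subr_eq0; apply/eqP.
have ab0 : op_le (s_sub a b) 0.
  split=> // x xu f fs d d0 fd; apply: l2_le_zero => h hx.
  have [_ ->] := convol_atBl (finsupp_convol_at a h fs) (finsupp_convol_at b h
    fs).
  by rewrite ab ?subrr //; exact: finsupp_Hilb.
have xu := units_gsrc g.
exact: (l2_le0 (op_le_l2_le xu ab0) (erefl (gsrc g))).
Qed.

Lemma op_le_pt a c g : op_le a c -> rnorm (a g) <= c.
Proof.
move=> ac; have xu := units_gsrc g.
exact: (l2_le_pt ac.1 (op_le_l2_le xu ac) (erefl (gsrc g))).
Qed.

(** Completeness for [normb], with [p] as modulus of convergence. Values at points are dominated by
    operator bounds, so the limit exists pointwise, and [l2_le_lim] passes the bounds to it. *)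
Lemma op_le_complete (u : nat -> bsection B) (p : nat -> R) :
  (forall e, 0 < e -> \forall n \near \oo, p n <= e) ->
  (forall m n, op_le (s_sub (u m) (u n)) (p m + p n)) ->
  exists a, forall n, op_le (s_sub a (u n)) (p n).
Proof.
move=> p0 up.
have ex g : cvg (u n g @[n --> \oo]).
  apply: rnorm_cauchy => e e0; have e3 : 0 < e / 3 by rewrite divr_gt0.
  have [N _ Np] := p0 _ e3; exists (u N g); exists N => // n Nn /=.
  apply: (le_lt_trans (op_le_pt g (up N n))).
  have := Np N (leqnn N); have := Np n Nn => /=; lra.
exists (fun g => lim (u n g @[n --> \oo])); set a := fun g => _.
have an g e : 0 < e -> \forall n \near \oo, rnorm (a g - u n g) <= e.
  move=> e0; have /cvg_rnormP/(_ e e0) H := ex g.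
  have {}H : \forall n \near \oo, rnorm (a g - u n g) < e by exact: H.
  by apply: filterS H => n /ltW.
move=> n; have p_ge0 : 0 <= p n.
  have [h _] := up n n; lra.
split=> // x xu f fs d d0 fd.
apply: l2_le_eps => [|e e0]; first exact: mulr_ge0.
have d1 : 0 < d + 1 by rewrite ltr_wpDl.
have q0 := divr_gt0 e0 d1; set q := e / (d + 1) in q0.
have pq : 0 <= p n + q by rewrite addr_ge0 // ltW.
have bound : (p n + q) * d <= p n * d + e.
  by rewrite mulrDl lerD2l /q mulrAC ler_pdivrMr // ler_pM2l // lerDl.
apply: l2_le_mono bound _; first exact: mulr_ge0.
have [J fJ] := iffLR (finsupp_sectionP f) fs.
apply: l2_le_lim => // [|F r r0]; first exact: mulr_ge0.
pose M := \sum_(h <- J) rnorm (f h).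
have M0 : 0 <= M by apply: sumr_ge0 => h _; exact: rnorm_ge0.
have M1 : 0 < M + 1 by rewrite ltr_wpDl.
have r1 := divr_gt0 r0 M1.
(* Only the points g h^{-1}, with g in F and h in the support of f, contribute to the convolution on
   F; they are finitely many, so one index m serves them all. *)
have [m [mq mF]] : exists m, p m <= q /\
    forall k, k \in [seq gmul g (ginv h) | g <- F, h <- J] ->
      rnorm (a k - u m k) <= r / (M + 1).
  have H : \forall m \near \oo, p m <= q /\ forall k,
      k \in [seq gmul g (ginv h) | g <- F, h <- J] ->
        rnorm (a k - u m k) <= r / (M + 1).
    apply: filterI; first exact: p0.
    by apply: near_all => k _; exact: an.
  by have [N _ /(_ N (leqnn N))] := H; exists N.
exists (convol (s_sub (u m) (u n)) f).
  apply: l2_le_mono ((up m n).2 x xu f fs d d0 fd).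
    by rewrite mulr_ge0 //; exact: (up m n).1.
  by rewrite ler_wpM2r // addrC lerD2l.
move=> g gF gx.
have at_ w : convol_at w f g by exact: finsupp_convol_at.
have -> : convol (s_sub a (u n)) f g - convol (s_sub (u m) (u n)) f g =
  convol (s_sub a (u m)) f g.
  have [_ ->] := convol_atBl (at_ a) (at_ (u n)).
  have [_ ->] := convol_atBl (at_ (u m)) (at_ (u n)).
  have [_ ->] := convol_atBl (at_ a) (at_ (u m)).
  by rewrite opprB addrA subrK.
have [|_ ->] := @convol_fin _ _ _ (s_sub a (u m)) f J g; first by move=> h _;
  exact: fJ.
apply: (le_trans (ler_rnorm_sum _ _ _)).
apply: (@le_trans _ _ (\sum_(h <- J) r / (M + 1) * rnorm (f h))).
  rewrite big_seq [leRHS]big_seq; apply: ler_sum => h hJ; rewrite /cterm.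
  case: eqP => hg; last by rewrite rnorm0 mulr_ge0 ?rnorm_ge0 // ltW.
  rewrite (le_trans (ml_norm (mult_exl hg) _ _)) // ler_wpM2r ?rnorm_ge0 //.
  by apply: mF; apply/allpairsP; exists (g, h).
by rewrite -mulr_sumr -/M mulrAC ler_pdivrMr // ler_pM2l // lerDl.
Qed.

(** Approximants c_n of T within 1 / (n + 1) are Cauchy for [normb], since the operator norm
    controls their action on finitely supported sections. Their limit a lies in [Cr], and at each
    point both a b and T b are limits of c_n b. *)
Lemma classical_surj T : classical_Cr T -> exists2 a, Cr a & op_eq (convol a) T.
Proof.
move=> [[S TS] TC].
pose p n : R := n.+1%:R^-1.
have p_gt0 n : 0 < p n by rewrite invr_gt0.
have p0 e : 0 < e -> \forall n \near \oo, p n <= e.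
  move=> e0; exists (Num.truncn e^-1) => // n /= Nn.
  rewrite /p -[leRHS]invrK lef_pV2 ?posrE ?invr_gt0 //.
  by rewrite ltW // (lt_le_trans (truncnS_gt _)) // ler_nat.
have /choice[u uP] n : exists c : bsection B,
  Cc B c /\ (normop (op_sub T (convol c)) <= (p n)%:E)%E.
  by have [c cC /ltW h] := TC _ (p_gt0 n); exists c.
have uC n := (uP n).1; have ua n := Cc_admissible (uC n).
have [TH _ _] := TS.
have TuH n b : Hilb B b -> Hilb B (op_sub T (convol (u n)) b).
  by move=> bH; apply: HilbB; [exact: TH|exact: admissible_Hilb].
have Tuc n d b : Hilb B b -> 0 <= d -> l2_all b d ->
    l2_all (op_sub T (convol (u n)) b) (p n * d).
  (* [T] is a bare function on sections; the homogeneity that [normop_leE] asks for comes from its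
     adjoint. *)
  move=> bH d0 bd; apply: normop_leE (uP n).2 bH d0 bd;
    [exact: ltW|exact: TuH|].
  move=> t v vH; rewrite /op_sub (adjoint_scale t TS vH) admissible_convolZ //.
  by apply: sext => g; rewrite /s_sub /s_scale scalerBr.
have cut_l2 x f d : l2_le x f d -> l2_all (sec_cut (fun g => gsrc g == x) f) d.
  move=> fd y yu; have [->|yx] := eqVneq y x; first exact: l2_le_cut.
  by apply: l2_le_zero => g gy; rewrite /sec_cut gy (negbTE yx).
have up m n : op_le (s_sub (u m) (u n)) (p m + p n).
  split=> [|x xu f fs d d0 fd]; first by rewrite addr_ge0 // ltW.
  set f' := sec_cut (fun g => gsrc g == x) f.
  have f's : finsupp_section f' by exact: finsupp_sec_cut.
  have f'H := finsupp_Hilb f's; have f'd := cut_l2 x f d fd.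
  have h1 := Tuc m d f' f'H d0 f'd x xu; have h2 := Tuc n d f' f'H d0 f'd x xu.
  have pd (i : nat) : 0 <= p i * d by rewrite mulr_ge0 // ltW.
  have := l2_leB xu (pd n) (pd m) h2 h1; rewrite -mulrDl addrC;
    apply: eq_l2_le => g gx.
  have ff' k : gsrc k = gsrc g -> f' k = f k.
    by rewrite gx /f' /sec_cut => ->; rewrite eqxx.
  have [_ ->] := eq_convol_at ff' (finsupp_convol_at (s_sub (u m) (u n)) g f's).
  have [_ ->] := convol_atBl (finsupp_convol_at (u m) g f's) (finsupp_convol_at
    (u n) g f's).
  by rewrite /op_sub /s_sub opprB [LHS]addrC addrA subrK.
have [a au] := op_le_complete p0 up.
have aC : Cr a.
  by apply/CrP => e /p0[n _ /(_ n (leqnn n)) pn]; exists (u n) => //;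
    exact: op_le_mono (au n).
exists a => // b bH; have aa := Cr_admissible aC.
have [[d d0 bd] _] := iffLR (HilbP b) bH.
apply: sext => g; apply/eqP; rewrite -subr_eq0; apply/eqP.
apply: (@rnorm_small_mul _ _ _ (d + d)); first exact: addr_ge0.
move=> e /p0[n _ /(_ n (leqnn n)) pn].
have xu := units_gsrc g; have auC := CrB aC (Cc_Cr (uC n)).
have h1 : l2_le (gsrc g) (convol (s_sub a (u n)) b) (p n * d).
  apply: op_le_convol => //; first exact: bd.
  by move=> h _; exact: (Hilb_convol_at_adm h (Cr_admissible auC) bH).
have pd : 0 <= p n * d by rewrite mulr_ge0 // ltW.
have {}h1 := l2_le_pt pd h1 erefl.
have h2 := l2_le_pt pd (Tuc n d b bH d0 bd (gsrc g) xu) erefl.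
have [_ e1] := convol_atBl (Hilb_convol_at_adm g aa bH) (Hilb_convol_at_adm g
  (ua n) bH).
rewrite e1 in h1; rewrite /op_sub /s_sub rdistC in h2.
rewrite -(subrKA (convol (u n) b g)) (le_trans (rnormD _ _)) // mulrDr lerD //.
  by rewrite (le_trans h1) // ler_wpM2r.
by rewrite (le_trans h2) // ler_wpM2r.
Qed.

End Isomorphism.

Theorem corollary3p10 (R : realType) (G : etaleGroupoid) (B : fellBundle R G) :
  (forall a : bsection B, Cc B a ->
     (forall b : bsection B, Hilb B b -> convol_defined a b) /\
     adjointable (convol a)) /\
  (exists phi : bsection B -> operator B, cstar_isomorphism phi).
Proof.
split=> [a aC|].
  have aa := Cc_admissible aC; split=> [b bH|].
    by apply/convol_definedP => g; exact: Hilb_convol_at_adm.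
  by exists (convol (s_star a)); exact: admissible_is_adjoint.
exists (@convol R G B); split.
- exact: Cr_classical.
- exact: Cr_inj.
- exact: classical_surj.
- move=> a b aC bC; split; first exact: CrD.
  move=> v vH; apply: functional_extensionality_dep => g.
  by have [_ ->] := convol_atDl (Hilb_convol_at_adm g (Cr_admissible aC) vH)
    (Hilb_convol_at_adm g (Cr_admissible bC) vH).
- move=> l a aC; split; first exact: CrZ.
  move=> v vH; apply: functional_extensionality_dep => g.
  by have [_ ->] := convol_atZl l (Hilb_convol_at_adm g (Cr_admissible aC) vH).
- move=> a b aC bC; have aa := Cr_admissible aC; have ba := Cr_admissible bC.
  split; [exact: admissible_convol_defined|exact: Cr_mul|move=> v vH].
  exact: (admissible_convolA aa ba (Cr_admissible (Cr_mul aC bC)) vH).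
- move=> a aC; split; first exact: Cr_star.
  by apply: admissible_is_adjoint; exact: Cr_admissible.
- by move=> a aC; apply: normop_convol; exact: Cr_admissible.
Qed.
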